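(* Let $\tau(m)$, $m\ge1$, be the Ramanujan numbers. For every $m\ge1$ the following are equivalent: (a) $\tau(m)=0$; (b) the shell $(W_8)_{2m}$ is a spherical $8$-design (and then also a spherical $11$-design); (c) for every even selfdual lattice $\Lambda$ of rank $16$, the shell $\Lambda_{2m}$ is a spherical $4$-design (and then also a spherical $7$-design).
   Context: The Ramanujan numbers are defined by $\sum_{m\ge1}\tau(m)q^{2m}=q^2\prod_{k\ge1}(1-q^{2k})^{24}$ (with $q=e^{i\pi z}$; equivalently $\Delta_{24}=\theta_3^8\Delta_8^2$ where $\Delta_8=\tfrac1{16}\theta_2^4\theta_4^4$). $W_8=\{x\in\mathbb R^8:2x_i\in\mathbb Z,\ x_i-x_1\in\mathbb Z,\ \sum x_i\in2\mathbb Z\}$ is the even selfdual lattice of rank 8. A selfdual lattice is an integral lattice equal to its dual; even means all norms even. Shell $\Lambda_m=\{x\in\Lambda:\langle x,x\rangle=m\}$. For antipodal sets $X$, $X$ is a spherical $t$-design iff $\sum_{x\in X}P(x)=0$ for every homogeneous harmonic polynomial $P$ of every even degree $2j$ with $2\le2j\le t$. *)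

(* Defs.v *)
From HB Require Import structures.
From mathcomp Require Import all_boot all_order all_algebra.
From mathcomp Require Import reals.
From mathcomp Require Import mpoly.
Set Implicit Arguments.
Unset Strict Implicit.
Unset Printing Implicit Defensive.
Import Order.TTheory GRing.Theory Num.Theory.
Local Open Scope ring_scope.

(* Ramanujan numbers: sum_{m>=1} tau(m) x^m = x * prod_{k>=1} (1-x^k)^24
   (x = q^2).  The coefficient of x^m only depends on the factors with
   k <= m, so the finite truncation below is exact. *)
Definition ramanujan_tau (m : nat) : int :=
  ('X * \prod_(1 <= k < m.+1) (1 - 'X^k) ^+ 24 : {poly int})`_m.

Definition dotv (R : realType) (n : nat) (x y : 'rV[R]_n) : R :=
  \sum_(i < n) x 0 i * y 0 i.

Definition is_intR (R : realType) (r : R) : Prop := exists z : int, r = z%:~R.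

Definition is_lattice (R : realType) (n : nat) (L : 'rV[R]_n -> Prop) : Prop :=
  exists B : 'M[R]_n, B \in unitmx /\
    forall x, L x <-> exists z : 'rV[int]_n, x = map_mx (fun a : int => a%:~R) z *m B.

Definition dual_lattice (R : realType) (n : nat) (L : 'rV[R]_n -> Prop) :
  'rV[R]_n -> Prop :=
  fun y => forall x, L x -> is_intR (dotv x y).

(* Selfdual: L equals its dual (this forces L to be integral). *)
Definition selfdual (R : realType) (n : nat) (L : 'rV[R]_n -> Prop) : Prop :=
  forall y, L y <-> dual_lattice L y.

Definition even_lattice (R : realType) (n : nat) (L : 'rV[R]_n -> Prop) : Prop :=
  forall x, L x -> exists z : int, dotv x x = (2 * z)%:~R.

Definition even_selfdual_lattice (R : realType) (n : nat) (L : 'rV[R]_n -> Prop) :=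
  [/\ is_lattice L, selfdual L & even_lattice L].

Definition shell (R : realType) (n : nat) (L : 'rV[R]_n -> Prop) (r : R) :
  'rV[R]_n -> Prop := fun x => L x /\ dotv x x = r.

Definition W8 (R : realType) : 'rV[R]_8 -> Prop :=
  fun x => [/\ forall i, is_intR (2 * x 0 i),
               forall i, is_intR (x 0 i - x 0 0) &
               exists z : int, \sum_(i < 8) x 0 i = (2 * z)%:~R].

Definition laplacian (R : realType) (n : nat) (P : {mpoly R[n]}) : {mpoly R[n]} :=
  \sum_(i < n) mderiv i (mderiv i P).

Definition harmonic (R : realType) (n : nat) (P : {mpoly R[n]}) : Prop :=
  laplacian P = 0.

Definition evalv (R : realType) (n : nat) (P : {mpoly R[n]}) (x : 'rV[R]_n) : R :=
  P.@[fun i => x 0 i].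

Definition spherical_design (R : realType) (n t : nat) (X : 'rV[R]_n -> Prop) : Prop :=
  exists s : seq 'rV[R]_n,
    [/\ uniq s, (forall x, X x <-> x \in s),
        (exists r : R, forall x, x \in s -> dotv x x = r) &
        forall (j : nat) (P : {mpoly R[n]}), (1 <= j <= t)%N ->
          P \is j.-homog -> harmonic P -> \sum_(x <- s) evalv P x = 0].

(* Main.v *)
(* For a harmonic homogeneous polynomial P of degree j and an even selfdual lattice L of rank n (here
   n = 8 or 16), the series sum_m (sum_{x in L_{2m}} P(x)) q^m is a modular form of weight n/2 + j
   for the full modular group, and a cusp form when j > 0.  Cusp forms of weight 6, 8, 10 and 14
   vanish and those of weight 12 are multiples of Delta = sum tau(m) q^m.  For W8 the degrees
   2, 4, 6, 10 give weights 6, 8, 10, 14 and degree 8 gives weight 12; in rank 16 the degrees 2, 6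
   give weights 10, 14 and degree 4 gives weight 12; odd degrees vanish by antipodality.  Hence
   tau(m) = 0 makes the shells designs.  Conversely the form attached to W8 and P = x_1 ... x_8 is
   Delta / 2, and the one attached to W8 + W8 and P = Re (x_1 + i x_9)^4 is a nonzero multiple of Delta.

   Modularity comes from Poisson summation.  In dimension one it is obtained from the discrete
   Fourier transform on finer and finer grids; in dimension n by completing squares; the polynomial
   P is brought in by differentiating with respect to a shift, using Euler's identity and Laplace's
   equation.  A modular form F of weight k with enough vanishing coefficients is zero because
   |F|^2 (Im z)^k is invariant, bounded, and contracted by a Parseval estimate on the fundamental
   domain.  Delta is identified through Jacobi's identity
   prod (1 - q^k)^3 = sum (-1)^n (2n+1) q^(n(n+1)/2), proved from its finite q-binomial version. *)
From Pilot Require Import Defs.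
From HB Require Import structures.
From mathcomp Require Import all_boot all_order all_algebra.
From mathcomp Require Import reals.
From mathcomp Require Import mpoly.
From mathcomp Require Import ring lra zify.
From mathcomp Require Import complex.
From mathcomp Require Import boolp classical_sets functions sequences exp trigo derive topology normedtype.
Set Implicit Arguments.
Unset Strict Implicit.
Unset Printing Implicit Defensive.
Import Order.TTheory GRing.Theory Num.Theory.
Local Open Scope ring_scope.
Local Open Scope complex_scope.

Local Notation Re := complex.Re.
Local Notation Im := complex.Im.

(* [sequences] also exports a constant [harmonic]. *)
Local Notation harmonic := Pilot.Defs.harmonic.

(** * Elementary bounds *)

Section RealBounds.
Import numFieldNormedType.Exports.
Variable R : realType.
Implicit Types x : R.

(** No integral, contour or holomorphy is used. A modular form is a coefficient sequence whose power
    series converges absolutely in the unit disc and satisfies the relation for z -> -1/z; the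
    identity theorem is replaced by Parseval over roots of unity. The Gaussian integral is never
    evaluated: Poisson summation is obtained up to that constant, and the case where both sides are
    the same nonzero series fixes it. The covolume of a selfdual lattice is fixed in the same way,
    at P = 1 and lam = 1. The contraction that stands in for the valence formula is slightly lossy:
    it lets r vanishing coefficients kill weight k only when k < 10.795 r. The constant is 4 . 3.12
    . 0.865, a little less than 4 pi Im z at height sqrt 3 / 2. Weights 8 and 12 fit directly.
    Weight 14 does not; it is handled by squaring, because a form of weight 14 vanishes at i.
    Weights 6 and 10 are raised to 14 by multiplying with the theta series of W8. *)

Lemma le_of_deriv (F f : R -> R) : (forall x, is_derive x 1 F (f x)) ->
  (forall x, 0 <= x -> 0 <= f x) -> forall x, 0 <= x -> F 0 <= F x.
Proof.
move=> dF f0 x x0.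
have /(_ (fun y _ => dF y)) := @MVT_segment R F f 0 x x0.
case=> [|c + E]; first by apply: derivable_within_continuous => y _; exact: ex_derive.
rewrite in_itv /= => /andP[c0 _].
by rewrite -subr_ge0 E subr0; apply: mulr_ge0 => //; apply: f0.
Qed.

Lemma is_derive_monom (c : R) n x :
  is_derive x 1 (fun y : R => c * y ^+ n.+1) (c * (n.+1%:R * x ^+ n)).
Proof.
have H := @is_deriveZ _ _ _ _ c x 1 _ (@is_deriveX _ _ id n.+1 x 1 1 (is_derive_id _ _)).
have -> : c * (n.+1%:R * x ^+ n) = c *: ((n.+1%:R * id x ^+ n) *: (1 : R)).
  by rewrite /GRing.scale /= mulr1.
move: H; set g := (X in is_derive _ _ X _) => H.
suff -> : (fun y : R => c * y ^+ n.+1) = g by exact: H.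
by apply: funext => y; rewrite /g /= exprfctE.
Qed.

(** Base of a ladder of Taylor bounds for sine and cosine: the derivative of each difference is
    nonnegative by the bound that precedes it. *)
Lemma sin_le_id x : 0 <= x -> sin x <= x.
Proof.
move=> x0; set F := fun x : R => - sin x + 1 * x ^+ 1.
have : F 0 <= F x.
  apply: (@le_of_deriv F (fun x => - cos x + 1 * (1%:R * x ^+ 0))) => // y.
    by do 1 (apply: is_deriveD; last exact: is_derive_monom).
  by move=> y0; have := cos_le1 y; rewrite ?expr0; lra.
by rewrite /F sin0 !expr0n /=; lra.
Qed.

Lemma cos_ge_taylor2 x : 0 <= x -> 1 - x ^+ 2 / 2 <= cos x.
Proof.
move=> x0; set F := fun x : R => cos x + 2^-1 * x ^+ 2.
have : F 0 <= F x.
  apply: (@le_of_deriv F (fun x => - sin x + 2^-1 * (2%:R * x ^+ 1))) => // y.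
    by do 1 (apply: is_deriveD; last exact: is_derive_monom).
  by move=> y0; have := sin_le_id y0; rewrite ?expr1; lra.
by rewrite /F cos0 !expr0n /=; lra.
Qed.

Lemma sin_ge_taylor3 x : 0 <= x -> x - x ^+ 3 / 6 <= sin x.
Proof.
move=> x0; set F := fun x : R => sin x + (-1) * x ^+ 1 + 6^-1 * x ^+ 3.
have : F 0 <= F x.
  apply: (@le_of_deriv F (fun x => cos x + (-1) * (1%:R * x ^+ 0) + 6^-1 * (3%:R * x ^+ 2))) => // y.
    by do 2 (apply: is_deriveD; last exact: is_derive_monom).
  by move=> y0; have := cos_ge_taylor2 y0; rewrite ?expr0; lra.
by rewrite /F sin0 !expr0n /=; lra.
Qed.

Lemma cos_le_taylor4 x : 0 <= x -> cos x <= 1 - x ^+ 2 / 2 + x ^+ 4 / 24.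
Proof.
move=> x0; set F := fun x : R => - cos x + (- 2^-1) * x ^+ 2 + 24^-1 * x ^+ 4.
have : F 0 <= F x.
  apply: (@le_of_deriv F (fun x => - - sin x + (- 2^-1) * (2%:R * x ^+ 1) + 24^-1 * (4%:R * x ^+ 3))) => // y.
    by do 2 (apply: is_deriveD; last exact: is_derive_monom).
  by move=> y0; have := sin_ge_taylor3 y0; rewrite ?expr1; lra.
by rewrite /F cos0 !expr0n /=; lra.
Qed.

Lemma sin_le_taylor5 x : 0 <= x -> sin x <= x - x ^+ 3 / 6 + x ^+ 5 / 120.
Proof.
move=> x0; set F := fun x : R => - sin x + 1 * x ^+ 1 + (- 6^-1) * x ^+ 3 + 120^-1 * x ^+ 5.
have : F 0 <= F x.
  apply: (@le_of_deriv F (fun x => - cos x + 1 * (1%:R * x ^+ 0) + (- 6^-1) * (3%:R * x ^+ 2) + 120^-1 * (5%:R * x ^+ 4))) => // y.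
    by do 3 (apply: is_deriveD; last exact: is_derive_monom).
  by move=> y0; have := cos_le_taylor4 y0; rewrite ?expr0; lra.
by rewrite /F sin0 !expr0n /=; lra.
Qed.

Lemma cos_ge_taylor6 x : 0 <= x -> 1 - x ^+ 2 / 2 + x ^+ 4 / 24 - x ^+ 6 / 720 <= cos x.
Proof.
move=> x0; set F := fun x : R => cos x + 2^-1 * x ^+ 2 + (- 24^-1) * x ^+ 4 + 720^-1 * x ^+ 6.
have : F 0 <= F x.
  apply: (@le_of_deriv F (fun x => - sin x + 2^-1 * (2%:R * x ^+ 1) + (- 24^-1) * (4%:R * x ^+ 3) + 720^-1 * (6%:R * x ^+ 5))) => // y.
    by do 3 (apply: is_deriveD; last exact: is_derive_monom).
  by move=> y0; have := sin_le_taylor5 y0; rewrite ?expr1; lra.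
by rewrite /F cos0 !expr0n /=; lra.
Qed.

(** If pi were below 3.12, the degree 6 Taylor bound would make cos (pi / 2) positive. The value
    3.12 enters the rate constant of the contraction argument. *)
Lemma pi_ge312 : 312 / 100 <= pi :> R.
Proof.
rewrite leNgt; apply/negP => h.
have p0 := @pi_gt0 R.
have := @cos_ge_taylor6 (pi / 2) (ltac:(lra)); rewrite cos_pihalf.
set u := (pi / 2) ^+ 2.
have u0 : 0 <= u by rewrite /u sqr_ge0.
have u1 : u < 244 / 100 by rewrite /u; nra.
rewrite (_ : (pi / 2) ^+ 4 = u ^+ 2); last by rewrite /u; ring.
rewrite (_ : (pi / 2) ^+ 6 = u ^+ 3); last by rewrite /u; ring.
have u3 : u ^+ 3 <= 244 / 100 * u ^+ 2 by nra.
nra.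
Qed.

Lemma pi_le4 : pi <= 4 :> R.
Proof. have := @pihalf_02 R => /andP[_ ?]; lra. Qed.

Lemma sin_abs_le x : `|sin x| <= `|x|.
Proof.
wlog x0 : x / 0 <= x => [H|].
  have [/H//|/ltW x0] := leP 0 x.
  by have := H (- x); rewrite oppr_ge0 sinN !normrN; exact.
rewrite (ger0_norm x0) ler_norml sin_le_id // andbT.
have [x1|x1] := leP x 1; last by have := sin_geN1 x; lra.
have := sin_ge_taylor3 x0; have : x ^+ 3 <= x by rewrite exprS; nra.
lra.
Qed.

Lemma cos_sub1_abs_le x : `|cos x - 1| <= x ^+ 2.
Proof.
wlog x0 : x / 0 <= x => [H|].
  have [/H//|/ltW x0] := leP 0 x.
  by have := H (- x); rewrite oppr_ge0 cosN sqrrN; exact.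
rewrite ler_norml; have := cos_ge_taylor2 x0; have := cos_le1 x; have := sqr_ge0 x.
by move=> ? ? ?; apply/andP; split; lra.
Qed.

Lemma sin_subid_abs_le x : `|sin x - x| <= x ^+ 2.
Proof.
wlog x0 : x / 0 <= x => [H|].
  have [/H//|/ltW x0] := leP 0 x.
  by have := H (- x); rewrite oppr_ge0 sinN sqrrN -opprD normrN; exact.
have s1 := sin_le_id x0; have s2 := sin_ge_taylor3 x0.
have s3 := sin_abs_le x; rewrite (ger0_norm x0) ler_norml in s3.
rewrite ler_norml; apply/andP; split; last by have := sqr_ge0 x; lra.
have [x1|x1] := leP x 2; last by case/andP: s3 => ? ?; rewrite expr2; nra.
have : x ^+ 3 <= 2 * x ^+ 2 by rewrite exprS; have := sqr_ge0 x; nra.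
by have := sqr_ge0 x; lra.
Qed.

(** On [0, 1] the quartic bound suffices; beyond 1 cosine decreases while x^2 <= 16, so the value at
    1 gives the crude constant 1/40. This bounds from below the multiplier by which a second
    difference acts on a discrete Fourier transform. *)
Lemma one_sub_cos_ge x : 0 <= x <= pi -> x ^+ 2 / 40 <= 1 - cos x.
Proof.
move=> /andP[x0 xpi].
have cb (y : R) : 0 <= y <= 1 -> 11 / 24 * y ^+ 2 <= 1 - cos y.
  move=> /andP[y0 y1]; have := cos_le_taylor4 y0.
  have : y ^+ 4 <= y ^+ 2.
    rewrite (_ : y ^+ 4 = y ^+ 2 * y ^+ 2); last by ring.
    by rewrite ler_piMl ?sqr_ge0 // exprn_ile1.
  lra.
have [x1|x1] := leP x 1.
  have := cb x; rewrite x0 x1 => /(_ isT); have := sqr_ge0 x; lra.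
have := cb 1; rewrite ler01 lexx => /(_ isT); rewrite expr1n mulr1 => c1.
have : cos x < cos 1.
  rewrite (@ltr_cos R) // !in_itv /= ?x0 ?xpi //.
  by rewrite ler01 (le_trans _ (@pi_ge2 R)) // ler1n.
have : x ^+ 2 <= 16 by have := pi_le4; nra.
lra.
Qed.

Lemma abs_expR_sub1 x : `|expR x - 1| <= `|x| * expR `|x|.
Proof.
have e1 := expR_ge1Dx x; have [x0|x0] := leP 0 x.
  rewrite ger0_norm //; last lra.
  rewrite ger0_norm; last lra.
  have e2 := expR_ge1Dx (- x).
  have := expRxMexpNx_1 x; have := expR_gt0 x.
  move: (expR x) (expR (- x)) e1 e2 => a b *.
  nra.
rewrite (ltr0_norm x0) ltr0_norm; last by rewrite subr_lt0 expR_lt1.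
have := expR_ge1Dx (- x); nra.
Qed.

Lemma abs_expR_sub1Dx x : `|expR x - 1 - x| <= x ^+ 2 * expR `|x|.
Proof.
have e1 := expR_ge1Dx x; have e2 := expR_ge1Dx (- x).
rewrite ger0_norm; last lra.
have [x0|x0] := leP 0 x.
  rewrite ger0_norm //.
  have := expRxMexpNx_1 x; have := expR_gt0 x.
  move: (expR x) (expR (- x)) e1 e2 => a b *.
  have : a * (1 - x) <= 1 by nra.
  nra.
rewrite ltr0_norm //.
have := expRxMexpNx_1 x; have := expR_gt0 x; have := expR_gt0 (- x).
move: (expR x) (expR (- x)) e1 e2 => a b *.
have ? : a * (1 - x) <= 1 by nra.
have : (a - 1 - x) * (1 - x) <= x ^+ 2 by nra.
nra.
Qed.

End RealBounds.

(** * Unordered sums *)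

Section ComplexModulus.
Variable R : realType.
Local Notation C := R[i].
Implicit Types z w : C.

(** The modulus as an element of [R], where [lra] and [nra] apply; the norm of [R[i]] takes its
    values in [R[i]] itself. *)
Definition cn z : R := Num.sqrt (Re z ^+ 2 + Im z ^+ 2).

Lemma cn_normr z : (cn z)%:C = `|z|.
Proof. by rewrite normc_def. Qed.

Lemma cn_ge0 z : 0 <= cn z.
Proof. exact: sqrtr_ge0. Qed.

Lemma cn0 : cn 0 = 0.
Proof. by rewrite /cn /= expr0n addr0 sqrtr0. Qed.

Lemma cnM z w : cn (z * w) = cn z * cn w.
Proof. by apply: complexI; rewrite rmorphM /= !cn_normr normrM. Qed.

Lemma cnD z w : cn (z + w) <= cn z + cn w.
Proof. by rewrite -lecR rmorphD /= !cn_normr ler_normD. Qed.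

Lemma cnN z : cn (- z) = cn z.
Proof. by apply: complexI; rewrite !cn_normr normrN. Qed.

Lemma cnB z w : cn (z - w) <= cn z + cn w.
Proof. by rewrite -(cnN w) cnD. Qed.

Lemma cnBC z w : cn (z - w) = cn (w - z).
Proof. by rewrite -opprB cnN. Qed.

Lemma cn_real (r : R) : cn r%:C = `|r|.
Proof. by rewrite /cn /= expr0n addr0 sqrtr_sqr. Qed.

Lemma cn1 : cn 1 = 1.
Proof. by rewrite (cn_real 1) normr1. Qed.

Lemma cn_eq0 z : (cn z == 0) = (z == 0).
Proof.
apply/eqP/eqP => [h|->]; last exact: cn0.
by apply/eqP; rewrite -normr_eq0 -cn_normr h.
Qed.

Lemma cnX z n : cn (z ^+ n) = cn z ^+ n.
Proof. by elim: n => [|n IH]; rewrite ?expr0 ?cn1 // !exprS cnM IH. Qed.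

Lemma cn_sum I (s : seq I) (P : pred I) (F : I -> C) :
  cn (\sum_(i <- s | P i) F i) <= \sum_(i <- s | P i) cn (F i).
Proof.
elim/big_ind2: _ => [|a b c d h1 h2|//]; first by rewrite cn0.
by rewrite (le_trans (cnD _ _)) // lerD.
Qed.

Lemma sqr_cn z : cn z ^+ 2 = Re z ^+ 2 + Im z ^+ 2.
Proof. by rewrite sqr_sqrtr // addr_ge0 // sqr_ge0. Qed.

Lemma abs_Re_le z : `|Re z| <= cn z.
Proof. by rewrite -sqrtr_sqr ler_wsqrtr // lerDl sqr_ge0. Qed.

Lemma abs_Im_le z : `|Im z| <= cn z.
Proof. by rewrite -sqrtr_sqr ler_wsqrtr // lerDr sqr_ge0. Qed.

Lemma cn_le_ReIm z : cn z <= `|Re z| + `|Im z|.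
Proof.
rewrite -(ler_pXn2r (n := 2)) ?nnegrE ?cn_ge0 ?addr_ge0 //.
rewrite sqr_cn sqrrD !real_normK ?num_real //.
have := mulr_ge0 (normr_ge0 (Re z)) (normr_ge0 (Im z)); lra.
Qed.

Lemma cn_sub_tri (a b c : C) : cn (a - c) <= cn (a - b) + cn (b - c).
Proof. by rewrite (_ : a - c = (a - b) + (b - c)); [exact: cnD | ring]. Qed.

Lemma cn_small_eq0 z : (forall e, 0 < e -> cn z <= e) -> z = 0.
Proof.
move=> h; apply/eqP; rewrite -cn_eq0 eq_le cn_ge0 andbT.
apply/ler_addgt0Pr => e e0; rewrite add0r; exact: h.
Qed.

Lemma cn_ge_sub z w : cn z - cn w <= cn (z + w).
Proof. by rewrite lerBlDr -{1}[z](addrK w) cnB. Qed.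

Lemma complex_eqP z w : Re z = Re w -> Im z = Im w -> z = w.
Proof. by case: z w => [a b] [c d] /= -> ->. Qed.

Lemma cReD z w : Re (z + w) = Re z + Re w. Proof. by case: z w => [? ?] []. Qed.
Lemma cImD z w : Im (z + w) = Im z + Im w. Proof. by case: z w => [? ?] []. Qed.
Lemma cReN z : Re (- z) = - Re z. Proof. by case: z. Qed.
Lemma cImN z : Im (- z) = - Im z. Proof. by case: z. Qed.
Lemma cReM z w : Re (z * w) = Re z * Re w - Im z * Im w.
Proof. by case: z w => [? ?] []. Qed.
Lemma cImM z w : Im (z * w) = Re z * Im w + Im z * Re w.
Proof. by case: z w => [? ?] []. Qed.

End ComplexModulus.

Section FiniteSums.
Variables (R : realType) (I : eqType).

Lemma sum_uniq_split (V : zmodType) (F : I -> V) (s0 s : seq I) :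
  uniq s0 -> uniq s -> {subset s0 <= s} ->
  \sum_(i <- s) F i = \sum_(i <- s0) F i + \sum_(i <- [seq i <- s | i \notin s0]) F i.
Proof.
move=> u0 us sub; rewrite -big_cat /=; apply: perm_big; apply: uniq_perm => //.
  rewrite cat_uniq u0 filter_uniq //= andbT.
  by apply/hasPn => x; rewrite mem_filter => /andP[].
move=> x; rewrite mem_cat mem_filter.
by case: (boolP (x \in s0)) => //= /sub ->.
Qed.

Lemma sum_le_subset (F : I -> R) (s0 s : seq I) : (forall i, 0 <= F i) ->
  uniq s0 -> uniq s -> {subset s0 <= s} -> \sum_(i <- s0) F i <= \sum_(i <- s) F i.
Proof.
move=> F0 u0 us sub; rewrite (sum_uniq_split F u0 us sub) lerDl.
by apply: sumr_ge0.
Qed.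

End FiniteSums.

Section UnorderedSums.
Variable R : realType.
Local Notation C := R[i].

Definition hassum (I : eqType) (u : I -> C) (S : C) := forall e : R, 0 < e ->
  exists s0 : seq I, forall s, uniq s -> {subset s0 <= s} ->
    cn (\sum_(i <- s) u i - S) <= e.

Definition rbound (I : eqType) (b : I -> R) (B : R) :=
  forall s, uniq s -> \sum_(i <- s) b i <= B.

Definition summ (I : eqType) (u : I -> C) := exists B, rbound (fun i => cn (u i)) B.

(** The value 0 is a default for families without a sum. Absolute summability [summ], a bound on all
    finite partial sums of moduli, guarantees that a sum exists. *)
Definition csum (I : eqType) (u : I -> C) : C :=
  if pselect (exists S, hassum u S) is left h then projT1 (cid h) else 0.

Section Basic.
Variable I : eqType.
Implicit Types u v : I -> C.

Lemma hassum_unique u S T : hassum u S -> hassum u T -> S = T.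
Proof.
move=> hS hT; apply/eqP; rewrite -subr_eq0; apply/eqP; apply: cn_small_eq0 => e e0.
have [s1 h1] := hS (e / 2) (ltac:(by lra)); have [s2 h2] := hT (e / 2) (ltac:(by lra)).
set s := undup (s1 ++ s2).
have us : uniq s by exact: undup_uniq.
have i1 : {subset s1 <= s} by move=> x xs; rewrite mem_undup mem_cat xs.
have i2 : {subset s2 <= s} by move=> x xs; rewrite mem_undup mem_cat xs orbT.
have := h1 s us i1; have := h2 s us i2.
have := cn_sub_tri S (\sum_(i <- s) u i) T; rewrite (cnBC S (\sum_(i <- s) u i)); lra.
Qed.

Lemma csumE u S : hassum u S -> csum u = S.
Proof.
move=> h; rewrite /csum; case: pselect => [h'|[]]; last by exists S.
by apply: (hassum_unique _ h); case: cid.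
Qed.

Lemma hassumD u v S T : hassum u S -> hassum v T -> hassum (fun i => u i + v i) (S + T).
Proof.
move=> hS hT e e0.
have [s1 h1] := hS (e / 2) (ltac:(by lra)); have [s2 h2] := hT (e / 2) (ltac:(by lra)).
exists (s1 ++ s2) => s us sub.
have i1 : {subset s1 <= s} by move=> x xs; apply: sub; rewrite mem_cat xs.
have i2 : {subset s2 <= s} by move=> x xs; apply: sub; rewrite mem_cat xs orbT.
rewrite big_split /= (_ : _ - _ = (\sum_(i <- s) u i - S) + (\sum_(i <- s) v i - T)); last by ring.
have := h1 s us i1; have := h2 s us i2; have := cnD (\sum_(i <- s) u i - S) (\sum_(i <- s) v i - T).
lra.
Qed.

Lemma hassumZ (c : C) u S : hassum u S -> hassum (fun i => c * u i) (c * S).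
Proof.
move=> hS e e0; have c0 := cn_ge0 c.
have [s1 h1] := hS (e / (cn c + 1)) (ltac:(by apply: divr_gt0; lra)).
exists s1 => s us sub; rewrite -mulr_sumr -mulrBr cnM.
have := h1 s us sub; rewrite ler_pdivlMr; last lra.
have := cn_ge0 (\sum_(i <- s) u i - S); nra.
Qed.

Lemma hassum_nonneg (b : I -> R) B : (forall i, 0 <= b i) -> rbound b B ->
  exists S : R, hassum (fun i => (b i)%:C) S%:C /\ rbound b S /\
    (forall e, 0 < e -> exists s0, uniq s0 /\ S - e < \sum_(i <- s0) b i).
Proof.
move=> b0 hB; pose E := [set x : R | exists s, uniq s /\ x = \sum_(i <- s) b i]%classic.
have Ene : (E !=set0)%classic by exists 0, [::]; rewrite big_nil.
have Eub : has_ubound E by exists B => x [s [us ->]]; exact: hB.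
have hs : has_sup E by [].
have ub : rbound b (sup E) by move=> s us; apply: sup_ubound => //; exists s.
have ap e : 0 < e -> exists s0, uniq s0 /\ sup E - e < \sum_(i <- s0) b i.
  by move=> e0; have [x [s [us ->]] h] := sup_adherent e0 hs; exists s.
exists (sup E); split; last by split.
move=> e e0; have [s0 [u0 h0]] := ap e e0; exists s0 => s us sub.
rewrite -(rmorph_sum (real_complex R)) -(rmorphB (real_complex R)) cn_real ler_norml.
have := ub s us; have := sum_le_subset b0 u0 us sub; move=> ? ?; apply/andP; split; lra.
Qed.

(** A real family f dominated by the moduli is the difference of [|f|] and [|f| - f], both
    nonnegative with bounded partial sums, hence summable to a supremum. Real and imaginary parts
    are treated this way separately. *)
Lemma summ_hassum u : summ u -> hassum u (csum u).
Proof.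
move=> [B hB]; suff [S hS] : exists S, hassum u S by rewrite (csumE hS).
have key (f : I -> R) : (forall i, `|f i| <= cn (u i)) -> exists S, hassum (fun i => (f i)%:C) S.
  move=> hf.
  have [|s us|S1 [h1 _]] := @hassum_nonneg (fun i => `|f i|) B; first by [].
    by apply: le_trans (hB s us); apply: ler_sum => i _.
  have [i|s us|S2 [h2 _]] := @hassum_nonneg (fun i => `|f i| - f i) (B + B).
  - by rewrite subr_ge0 ler_norm.
  - apply: (@le_trans _ _ (\sum_(i <- s) (cn (u i) + cn (u i)))).
      by apply: ler_sum => i _; have := hf i; have := ler_norm (- f i); rewrite normrN; lra.
    by rewrite big_split lerD // hB.
  exists (S1%:C + (-1) * S2%:C).
  have := hassumD h1 (hassumZ (-1) h2); congr hassum; apply: funext => i.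
  by rewrite mulN1r -rmorphB /=; congr (_%:C); ring.
have [S1 h1] := key (fun i => Re (u i)) (fun i => abs_Re_le _).
have [S2 h2] := key (fun i => Im (u i)) (fun i => abs_Im_le _).
exists (S1 + 'i * S2); have := hassumD h1 (hassumZ 'i h2); congr hassum.
by apply: funext => i; rewrite -complexE.
Qed.

Lemma eq_csum u v : u =1 v -> csum u = csum v.
Proof. by move=> /funext ->. Qed.

Lemma summ_le (b : I -> R) B u : rbound b B -> (forall i, cn (u i) <= b i) -> summ u.
Proof.
by move=> hB h; exists B => s us; apply: le_trans (hB s us); apply: ler_sum => i _.
Qed.

Lemma summ_dom u v : summ v -> (forall i, cn (u i) <= cn (v i)) -> summ u.
Proof. by move=> [B hB] /(summ_le hB). Qed.

Lemma summD u v : summ u -> summ v -> summ (fun i => u i + v i).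
Proof.
move=> [A hA] [B hB]; apply: (@summ_le (fun i => cn (u i) + cn (v i)) (A + B)).
  by move=> s us; rewrite big_split lerD ?hA ?hB.
by move=> i; exact: cnD.
Qed.

Lemma summZ c u : summ u -> summ (fun i => c * u i).
Proof.
move=> [B hB]; exists (cn c * B) => s us.
under eq_bigr do rewrite cnM.
by rewrite -mulr_sumr ler_wpM2l ?cn_ge0 ?hB.
Qed.

Lemma csumD u v : summ u -> summ v -> csum (fun i => u i + v i) = csum u + csum v.
Proof. by move=> hu hv; apply: csumE; apply: hassumD; apply: summ_hassum. Qed.

Lemma csumZ c u : summ u -> csum (fun i => c * u i) = c * csum u.
Proof. by move=> hu; apply: csumE; apply: hassumZ; apply: summ_hassum. Qed.

Lemma summN u : summ u -> summ (fun i => - u i).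
Proof. by move=> h; apply: (summ_dom h) => i; rewrite cnN. Qed.

Lemma csumN u : summ u -> csum (fun i => - u i) = - csum u.
Proof.
by move=> h; rewrite -mulN1r -csumZ //; apply: eq_csum => i; rewrite mulN1r.
Qed.

Lemma summB u v : summ u -> summ v -> summ (fun i => u i - v i).
Proof. by move=> hu hv; apply: summD => //; apply: summN. Qed.

Lemma csumB u v : summ u -> summ v -> csum (fun i => u i - v i) = csum u - csum v.
Proof. by move=> hu hv; rewrite csumD ?csumN //; apply: summN. Qed.

Lemma cn_csum_le u B : rbound (fun i => cn (u i)) B -> cn (csum u) <= B.
Proof.
move=> hB; apply/ler_addgt0Pr => e e0.
have hu : summ u by exists B.
have [s0 h] := summ_hassum hu e0.
have := h (undup s0) (undup_uniq _) (fun x => ltac:(by rewrite mem_undup)).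
have := hB _ (undup_uniq s0); have := cn_sum (undup s0) xpredT u.
rewrite cnBC; have := cn_ge_sub (csum u) (- \sum_(i <- undup s0) u i); rewrite cnN; lra.
Qed.

(** A finite set whose sum of moduli comes within e of the supremum controls, for every larger set,
    both the absolute tail and the error of the partial sum. *)
Lemma csum_tail u e : summ u -> 0 < e -> exists s0, uniq s0 /\
  forall s, uniq s -> {subset s0 <= s} ->
    rbound (fun i => if i \in s then 0 else cn (u i)) e /\ cn (csum u - \sum_(i <- s) u i) <= e.
Proof.
move=> hu e0; have [B hB] := hu.
have [S [_ [ub ap]]] := hassum_nonneg (fun i => cn_ge0 (u i)) hB.
have [s0 [u0 h0]] := ap e e0; exists s0; split=> // s us sub.
have tl : rbound (fun i => if i \in s then 0 else cn (u i)) e.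
  move=> t ut; rewrite (bigID (fun i => i \in s)) /= big1 ?add0r; last by move=> i ->.
  rewrite (eq_bigr (fun i => cn (u i))); last by move=> i /negbTE ->.
  have := ub (s ++ [seq i <- t | i \notin s]).
  rewrite cat_uniq us filter_uniq // andbT big_cat /= big_filter.
  rewrite (_ : ~~ has _ _); last by apply/hasPn => x; rewrite mem_filter => /andP[].
  move=> /(_ isT); have := sum_le_subset (fun i => cn_ge0 (u i)) u0 us sub; lra.
split=> //.
have e1 : csum (fun i => if i \in s then u i else 0) = \sum_(i <- s) u i.
  apply: csumE => d d0; exists s => t ut st; rewrite (sum_uniq_split _ us ut st).
  rewrite [X in _ + X - _]big1_seq ?addr0; last first.
    by move=> i /andP[_]; rewrite mem_filter => /andP[/negbTE ->].
  by rewrite (eq_big_seq u) ?subrr ?cn0 ?ltW // => i ->.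
have s1 : summ (fun i => if i \in s then u i else 0).
  by apply: (summ_dom hu) => i; case: ifP; rewrite // cn0 cn_ge0.
rewrite -e1 -csumB //; apply: cn_csum_le; move: tl; congr rbound; apply: funext => i.
by case: ifP; rewrite ?subrr ?subr0 ?cn0.
Qed.

Lemma csum_fin (s : seq I) u : uniq s -> (forall i, i \notin s -> u i = 0) ->
  summ u /\ csum u = \sum_(i <- s) u i.
Proof.
move=> us h; have eqs t : uniq t -> {subset s <= t} -> \sum_(i <- t) u i = \sum_(i <- s) u i.
  move=> ut st; rewrite (sum_uniq_split _ us ut st) [X in _ + X]big1_seq ?addr0 //.
  by move=> i /andP[_]; rewrite mem_filter => /andP[/h].
split; last by apply: csumE => e e0; exists s => t ut st; rewrite eqs // subrr cn0 ltW.
exists (\sum_(i <- s) cn (u i)) => t ut.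
rewrite (bigID (fun i => i \in s)) /= [X in _ + X]big1 ?addr0; last by move=> i /h ->; rewrite cn0.
rewrite -big_filter; apply: sum_le_subset => //; first by move=> i; exact: cn_ge0.
  exact: filter_uniq.
by move=> i; rewrite mem_filter => /andP[].
Qed.

Lemma summ0 : summ (fun _ : I => 0 : C).
Proof. by have [] := @csum_fin [::] (fun=> 0 : C). Qed.

Lemma csum0 : csum (fun _ : I => 0 : C) = 0.
Proof. by have [//|_ ->] := @csum_fin [::] (fun=> 0 : C) isT; rewrite big_nil. Qed.

Lemma csum_sum (T : Type) (s : seq T) (F : T -> I -> C) : (forall t, summ (F t)) ->
  summ (fun i => \sum_(t <- s) F t i) /\
  csum (fun i => \sum_(t <- s) F t i) = \sum_(t <- s) csum (F t).
Proof.
move=> h; elim: s => [|t s [IH1 IH2]].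
  rewrite big_nil (_ : (fun _ => _) = (fun=> 0)) ?csum0; last by apply: funext => i; rewrite big_nil.
  by split=> //; exact: summ0.
rewrite (_ : (fun _ => _) = (fun i => F t i + \sum_(t <- s) F t i)); last first.
  by apply: funext => i; rewrite big_cons.
by rewrite big_cons csumD // IH2; split=> //; apply: summD.
Qed.

Lemma csum_real_ge (b : I -> R) i0 : (forall i, 0 <= b i) -> summ (fun i => (b i)%:C) ->
  b i0 <= Re (csum (fun i => (b i)%:C)).
Proof.
move=> b0 [B hB]; have hb : rbound b B.
  by move=> s us; have := hB s us; under eq_bigr do rewrite cn_real ger0_norm //.
have [S [hS [ub _]]] := hassum_nonneg b0 hb; rewrite (csumE hS) /=.
by have := ub [:: i0] isT; rewrite big_seq1.
Qed.

End Basic.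

(** Every finite list in [J] has a finite preimage list in [I] with the same sum, for any function
    supported on the image. The list must serve both [u] and its moduli, hence the quantification
    over the target monoid in [lift]. *)
Lemma csum_inj (I J : eqType) (f : I -> J) (u : J -> C) : injective f ->
  (forall j, (forall i, f i <> j) -> u j = 0) ->
  (summ u <-> summ (u \o f)) /\ (summ u -> csum u = csum (u \o f)).
Proof.
move=> fi fz.
have lift t : uniq t -> exists s, uniq s /\ (forall j, j \in map f s -> j \in t) /\
    (forall i, f i \in t -> i \in s) /\
    forall (V : nmodType) (G : J -> V), (forall j, (forall i, f i <> j) -> G j = 0) ->
      \sum_(j <- t) G j = \sum_(i <- s) G (f i).
  elim: t => [_|j t IH /= /andP[jt ut]].
    by exists [::]; split=> //; split=> //; split=> // V G _; rewrite !big_nil.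
  have [s [us [h1 [h2 h3]]]] := IH ut.
  have [[i fij]|nj] := pselect (exists i, f i = j); last first.
    exists s; split=> //; split; first by move=> k /h1; rewrite in_cons => ->; rewrite orbT.
    split; first by move=> i; rewrite in_cons => /orP[/eqP e|/h2//]; case: nj; exists i.
    by move=> V G G0; rewrite big_cons G0 ?add0r ?h3 // => i e; case: nj; exists i.
  exists (i :: s); split.
    by rewrite /= us andbT; apply: contra jt => si; rewrite -fij; apply: h1; rewrite mem_map.
  split.
    by move=> k /=; rewrite !in_cons fij => /orP[->//|/h1 ->]; rewrite orbT.
  split.
    by move=> k; rewrite !in_cons -fij => /orP[/eqP/fi ->|/h2 ->]; rewrite ?eqxx ?orbT.
  by move=> V G G0; rewrite !big_cons fij h3.
have E : summ u <-> summ (u \o f).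
  split=> [[B hB]|[B hB]]; exists B.
    move=> s us; have := hB (map f s); rewrite map_inj_uniq // big_map; exact.
  move=> t ut; have [s [us [_ [_ h]]]] := lift t ut.
  by rewrite (h _ (fun j => cn (u j))) ?hB // => j /fz ->; rewrite cn0.
split=> // hu; apply: csumE => e e0.
have [s0 h0] := summ_hassum (E.1 hu) e0; exists (map f s0) => t ut sub.
have [s [us [_ [h2 h3]]]] := lift t ut; rewrite (h3 _ u fz); apply: h0 => // i is0.
by apply: h2; apply: sub; exact: map_f.
Qed.

Lemma csum_reindex (I J : eqType) (f : I -> J) (g : J -> I) (u : J -> C) :
  cancel f g -> cancel g f ->
  (summ u <-> summ (u \o f)) /\ (summ u -> csum u = csum (u \o f)).
Proof.
move=> fg gf; apply: csum_inj; first exact: can_inj fg.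
by move=> j /(_ (g j)); rewrite gf.
Qed.

Section Fubini.
Variables I J : eqType.

Lemma rbound2 (b : I -> R) B (c : I * J -> R) : (forall p, 0 <= c p) ->
  (forall i, rbound (fun j => c (i, j)) (b i)) -> rbound b B -> rbound c B.
Proof.
move=> c0 hc hB s us.
pose s1 := undup (map fst s); pose s2 := undup (map snd s).
apply: (@le_trans _ _ (\sum_(p <- [seq (i, j) | i <- s1, j <- s2]) c p)).
  apply: sum_le_subset => //; first by apply: allpairs_uniq; rewrite ?undup_uniq // => -[? ?] [].
  move=> [i j] ps; apply/allpairsP; exists (i, j) => /=.
  by rewrite !mem_undup; split=> //; apply/mapP; exists (i, j).
rewrite big_allpairs /=; apply: le_trans (hB s1 (undup_uniq _)).
by apply: ler_sum => i _; apply: hc; exact: undup_uniq.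
Qed.

Lemma summ_row (u : I * J -> C) i : summ u -> summ (fun j => u (i, j)).
Proof.
move=> [B hB]; exists B => s us.
have := hB [seq (i, j) | j <- s]; rewrite big_map; apply.
by rewrite map_inj_uniq // => ? ? [].
Qed.

(** A finite set that nearly exhausts the double sum sits in a rectangle. For the finitely many rows
    involved, one finite set of columns approximates all row sums together, so the iterated and the
    double sum differ by at most e. *)
Lemma fubini (u : I * J -> C) : summ u ->
  summ (fun i => csum (fun j => u (i, j))) /\
  csum u = csum (fun i => csum (fun j => u (i, j))).
Proof.
move=> hu; have [B hB] := hu.
have hrow (s : seq I) e : 0 < e -> uniq s -> exists T0 : seq J, forall T, uniq T ->
    {subset T0 <= T} ->
    \sum_(i <- s) cn (csum (fun j => u (i, j)) - \sum_(j <- T) u (i, j)) <= e.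
  elim: s e => [|i s IH] e e0 /=; first by exists [::] => T _ _; rewrite big_nil ltW.
  move=> /andP[_ us].
  have [T1 h1] := IH (e / 2) (ltac:(by lra)) us.
  have [T2 h2] := summ_hassum (summ_row i hu) (ltac:(by lra) : 0 < e / 2).
  exists (T1 ++ T2) => T uT sub; rewrite big_cons.
  have := h1 T uT (fun x hx => sub x (ltac:(by rewrite mem_cat hx))).
  have := h2 T uT (fun x hx => sub x (ltac:(by rewrite mem_cat hx orbT))).
  by rewrite cnBC; lra.
have uall (s : seq I) (T : seq J) : uniq s -> uniq T -> uniq [seq (i, j) | i <- s, j <- T].
  by move=> us uT; apply: allpairs_uniq => // -[? ?] [].
have S1 : summ (fun i => csum (fun j => u (i, j))).
  exists (B + 1) => s us; have [T0 h0] := hrow s 1 ltr01 us.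
  set T := undup T0; have := h0 T (undup_uniq _) (fun x => ltac:(by rewrite mem_undup)).
  have := hB [seq (i, j) | i <- s, j <- T] (uall _ _ us (undup_uniq _)).
  rewrite big_allpairs /=.
  have : \sum_(i <- s) cn (csum (fun j => u (i, j))) <=
     \sum_(i <- s) (cn (csum (fun j => u (i, j)) - \sum_(j <- T) u (i, j)) +
                    \sum_(j <- T) cn (u (i, j))).
    apply: ler_sum => i _; have := cn_sum T xpredT (fun j => u (i, j)).
    have := cn_ge_sub (csum (fun j => u (i, j))) (- \sum_(j <- T) u (i, j)).
    rewrite cnN; lra.
  rewrite big_split /=; lra.
split=> //; symmetry; apply: csumE => e e0.
have [s0 h0] := summ_hassum hu (ltac:(by lra) : 0 < e / 2).
exists (map fst s0) => s us sub.
have [T0 hT] := hrow s (e / 2) (ltac:(by lra)) us.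
set T := undup (T0 ++ map snd s0).
have uT : uniq T by exact: undup_uniq.
have := hT T uT (fun x hx => ltac:(by rewrite mem_undup mem_cat hx)).
have := h0 [seq (i, j) | i <- s, j <- T] (uall _ _ us uT).
have sb : {subset s0 <= [seq (i, j) | i <- s, j <- T]}.
  move=> [i j] ps; apply/allpairsP; exists (i, j) => /=; split=> //.
    by apply: sub; apply/mapP; exists (i, j).
  by rewrite mem_undup mem_cat; apply/orP; right; apply/mapP; exists (i, j).
move=> /(_ sb); rewrite big_allpairs /=.
have := cn_sum s xpredT (fun i => csum (fun j => u (i, j)) - \sum_(j <- T) u (i, j)).
rewrite sumrB; have := cn_sub_tri (\sum_(i <- s) csum (fun j => u (i, j)))
   (\sum_(i <- s) \sum_(j <- T) u (i, j)) (csum u); lra.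
Qed.

End Fubini.

Lemma csum_swap (I J : eqType) (u : I -> J -> C) : summ (fun p : I * J => u p.1 p.2) ->
  csum (fun i => csum (u i)) = csum (fun j => csum (fun i => u i j)).
Proof.
move=> h; have [_ e1] := fubini h.
pose sw (p : J * I) := (p.2, p.1); pose sw' (p : I * J) := (p.2, p.1).
have [] := @csum_reindex _ _ sw sw' (fun p : I * J => u p.1 p.2); try by case.
move=> E1 E2; have [_ e2] := fubini (E1.1 h).
by have := E2 h; rewrite e1 e2.
Qed.

Lemma csum_mul (I J : eqType) (a : I -> C) (b : J -> C) : summ a -> summ b ->
  summ (fun p : I * J => a p.1 * b p.2) /\
  csum (fun p : I * J => a p.1 * b p.2) = csum a * csum b.
Proof.
move=> ha hb; have [A hA] := ha; have [B hB] := hb.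
have h : summ (fun p : I * J => a p.1 * b p.2).
  exists (A * B); apply: (@rbound2 _ _ (fun i => cn (a i) * B)).
  - by move=> p; exact: cn_ge0.
  - move=> i s us /=; under eq_bigr do rewrite cnM.
    by rewrite -mulr_sumr ler_wpM2l ?cn_ge0 ?hB.
  - move=> s us; rewrite -mulr_suml ler_wpM2r ?hA //.
    by have := hB [::] isT; rewrite big_nil.
split=> //; have [_ ->] := fubini h => /=.
rewrite mulrC -csumZ //; apply: eq_csum => i.
by rewrite csumZ // mulrC.
Qed.

(** The family is spread over the graph of [p] inside the product of [I] and [J], where each row has
    one nonzero entry, and the two orders of summation are compared. *)
Lemma csum_fibers (I J : eqType) (p : I -> J) (u : I -> C) : summ u ->
  summ (fun j => csum (fun i => if p i == j then u i else 0)) /\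
  csum u = csum (fun j => csum (fun i => if p i == j then u i else 0)).
Proof.
move=> hu; have [B hB] := hu.
pose w (q : I * J) := if p q.1 == q.2 then u q.1 else 0.
have row i : summ (fun j => w (i, j)) /\ csum (fun j => w (i, j)) = u i.
  have [j|h1 h2] := @csum_fin J [:: p i] (fun j => w (i, j)) isT.
    by rewrite inE eq_sym /w /= => /negbTE ->.
  by split=> //; rewrite h2 big_seq1 /w /= eqxx.
have hw : summ w.
  exists B; apply: (@rbound2 _ _ (fun i => cn (u i))) => // [q|i s us]; first exact: cn_ge0.
  rewrite (bigID (fun j => p i == j)) /= [X in _ + X]big1; last first.
    by move=> j /negbTE h; rewrite /w /= h cn0.
  rewrite addr0 -big_filter (eq_big_seq (fun=> cn (u i))); last first.
    by move=> j; rewrite mem_filter /w /= => /andP[-> _].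
  rewrite big_const_seq count_predT iter_addr_0 size_filter.
  apply: (@le_trans _ _ (cn (u i) *+ 1)) => //; apply: ler_wpMn2l; first exact: cn_ge0.
  rewrite (eq_count (a2 := pred1 (p i))); last by move=> j; rewrite /= eq_sym.
  by rewrite count_uniq_mem //; case: (_ \in _).
pose w' (q : J * I) := w (q.2, q.1).
have [] := @csum_reindex _ _ (fun q : J * I => (q.2, q.1)) (fun q => (q.2, q.1)) w; try by case.
move=> E1 E2; have [h1 h2] := fubini (E1.1 hw); split; first exact: h1.
rewrite -h2 -E2 //; have [_ ->] := fubini hw.
by apply: eq_csum => i; have [_ ->] := row i.
Qed.

End UnorderedSums.

(** * The complex exponential *)

(** The integers from -M to M: a full period of frequencies for the grid with 2M + 1 points per
    unit. *)
Definition symrange (M : nat) : seq int := [seq (k%:Z - M%:Z) | k <- iota 0 (M + M).+1].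

Lemma symrange_uniq M : uniq (symrange M).
Proof. by rewrite map_inj_uniq ?iota_uniq // => a b /(addIr _) []. Qed.

Lemma mem_symrange M (j : int) : (j \in symrange M) = (`|j| <= M)%N.
Proof.
apply/mapP/idP => [[k + ->]|jM]; first by rewrite mem_iota; lia.
by exists `|(j + M%:Z)%R|%N; [rewrite mem_iota; lia | lia].
Qed.

Section ComplexExp.
Variable R : realType.
Local Notation C := R[i].
Implicit Types z w : C.

Lemma natC n : (n%:R : C) = (n%:R : R)%:C.
Proof. by rewrite rmorph_nat. Qed.

Lemma intC (k : int) : (k%:~R : C) = (k%:~R : R)%:C.
Proof. by rewrite rmorph_int. Qed.

Lemma cn_nat n : cn (n%:R : C) = n%:R.
Proof. by rewrite natC cn_real ger0_norm. Qed.

(** Locked so that conversion does not unfold it during algebraic rewriting; [cexpE] gives the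
    formula. *)
Definition cexp : C -> C := locked (fun z => (expR (Re z))%:C * (cos (Im z) +i* sin (Im z))).

Lemma cexpE z : cexp z = (expR (Re z))%:C * (cos (Im z) +i* sin (Im z)).
Proof. by rewrite /cexp -lock. Qed.

Lemma cexpD z w : cexp (z + w) = cexp z * cexp w.
Proof.
rewrite !cexpE cReD cImD expRD cosD sinD rmorphM /=.
rewrite [RHS]mulrACA; congr (_ * _).
by apply: complex_eqP; rewrite ?cReM ?cImM /=; ring.
Qed.

Lemma cexp_real (r : R) : cexp r%:C = (expR r)%:C.
Proof. by rewrite cexpE /= cos0 sin0 mulr1. Qed.

Lemma cexp0 : cexp 0 = 1.
Proof. by rewrite (cexp_real 0) expR0. Qed.

Lemma cn_cexp z : cn (cexp z) = expR (Re z).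
Proof.
rewrite cexpE cnM cn_real ger0_norm ?expR_ge0 //.
by rewrite [X in _ * X](_ : _ = 1) ?mulr1 // /cn /= cos2Dsin2 sqrtr1.
Qed.

Lemma cexp_neq0 z : cexp z != 0.
Proof. by rewrite -cn_eq0 cn_cexp gt_eqF ?expR_gt0. Qed.

Lemma cexpN z : cexp (- z) = (cexp z)^-1.
Proof.
apply: (mulfI (cexp_neq0 z)); rewrite -cexpD addrN cexp0 divff //; exact: cexp_neq0.
Qed.

Lemma cexp_i (b : R) : cexp ('i * b%:C) = cos b +i* sin b.
Proof.
have e1 : Re ('i * b%:C) = 0 by rewrite cReM /=; ring.
have e2 : Im ('i * b%:C) = b by rewrite cImM /=; ring.
by rewrite cexpE e1 e2 expR0 mul1r.
Qed.

Definition ce (x : R) : C := cexp ('i * (2 * pi * x)%:C).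

Lemma ceD x y : ce (x + y) = ce x * ce y.
Proof. by rewrite /ce -cexpD mulrDr rmorphD mulrDr. Qed.

Lemma cn_ce x : cn (ce x) = 1.
Proof. by rewrite /ce cn_cexp cReM /= mulr0 mul0r subrr expR0. Qed.

Lemma ce0 : ce 0 = 1.
Proof. by rewrite /ce mulr0 mulr0 cexp0. Qed.

Lemma ceN x : ce (- x) = (ce x)^-1.
Proof. by rewrite /ce mulrN rmorphN mulrN cexpN. Qed.

Lemma ce_int (k : int) : ce k%:~R = 1.
Proof.
have nat1 n : ce n%:R = 1.
  elim: n => [|n IH]; first exact: ce0.
  by rewrite -addn1 natrD ceD IH mul1r /ce mulr1 cexp_i mulr_natl cos2pi sin2pi.
case: k => n; first exact: nat1.
by rewrite NegzE mulrNz ceN -pmulrn nat1 invr1.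
Qed.

Lemma ce_int_mul (k j : int) : ce (k%:~R * j%:~R) = 1.
Proof. by rewrite -intrM ce_int. Qed.

Lemma ceMn x n : ce (n%:R * x) = ce x ^+ n.
Proof.
elim: n => [|n IH]; first by rewrite mul0r ce0 expr0.
by rewrite exprS -IH -ceD; congr ce; rewrite -addn1 natrD; ring.
Qed.

Lemma ceE x : ce x = cos (2 * pi * x) +i* sin (2 * pi * x).
Proof. by rewrite /ce cexp_i. Qed.

Lemma cn_cexpi_sub1 (b : R) : cn (cexp ('i * b%:C) - 1) <= `|b|.
Proof.
rewrite -(ler_pXn2r (n := 2)) ?nnegrE ?cn_ge0 // sqr_cn cexp_i /=.
rewrite real_normK ?num_real //.
have := cos2Dsin2 b.
have : 1 - b ^+ 2 / 2 <= cos b.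
  have [b0|b0] := leP 0 b; first exact: cos_ge_taylor2.
  by rewrite -sqrrN -cosN; apply: cos_ge_taylor2; lra.
rewrite oppr0 addr0; nra.
Qed.

Lemma cn_cexpi_sub1B (b : R) : cn (cexp ('i * b%:C) - 1 - 'i * b%:C) <= 2 * b ^+ 2.
Proof.
apply: le_trans (cn_le_ReIm _) _.
have e1 : Re (cexp ('i * b%:C) - 1 - 'i * b%:C) = cos b - 1.
  by rewrite cexp_i !cReD !cReN cReM /=; ring.
have e2 : Im (cexp ('i * b%:C) - 1 - 'i * b%:C) = sin b - b.
  by rewrite cexp_i !cImD !cImN cImM /=; ring.
rewrite e1 e2.
have := cos_sub1_abs_le b; have := sin_subid_abs_le b; lra.
Qed.

Lemma cexp_ReIm z : cexp z = (expR (Re z))%:C * cexp ('i * (Im z)%:C).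
Proof. by rewrite cexp_i cexpE. Qed.

Lemma cn_cexp_sub1 z : cn (cexp z - 1) <= 2 * cn z * expR (cn z).
Proof.
rewrite cexp_ReIm.
set a := Re z; set b := Im z.
have ha : `|a| <= cn z := abs_Re_le z; have hb : `|b| <= cn z := abs_Im_le z.
have -> : (expR a)%:C * cexp ('i * b%:C) - 1 =
    (expR a)%:C * (cexp ('i * b%:C) - 1) + (expR a - 1)%:C by rewrite rmorphB /=; ring.
apply: le_trans (cnD _ _) _; rewrite cnM !cn_real (ger0_norm (expR_ge0 _)).
have h1 := cn_cexpi_sub1 b; have h2 := abs_expR_sub1 a.
have h3 : expR `|a| <= expR (cn z) by rewrite ler_expR.
have h4 : expR a <= expR (cn z) by rewrite ler_expR (le_trans (ler_norm _)).
have := expR_gt0 (cn z); have := expR_gt0 a; have := expR_gt0 `|a|; have := normr_ge0 a.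
have := cn_ge0 (cexp ('i * b%:C) - 1).
move=> p1 p2 p3 p4 p5.
have q1 : expR a * cn (cexp ('i * b%:C) - 1) <= expR (cn z) * cn z.
  by apply: ler_pM => //; [exact: ltW | exact: le_trans hb].
have q2 : `|a| * expR `|a| <= cn z * expR (cn z) by apply: ler_pM => //; exact: ltW.
lra.
Qed.

Lemma cn_cexp_sub1B z : cn (cexp z - 1 - z) <= 4 * cn z ^+ 2 * expR (cn z).
Proof.
rewrite cexp_ReIm.
set a := Re z; set b := Im z.
have ha : `|a| <= cn z := abs_Re_le z; have hb : `|b| <= cn z := abs_Im_le z.
have -> : (expR a)%:C * cexp ('i * b%:C) - 1 - z =
    (expR a)%:C * (cexp ('i * b%:C) - 1 - 'i * b%:C) + (expR a - 1 - a)%:C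
    + 'i * (b * (expR a - 1))%:C.
  have ez : z = a%:C + 'i * b%:C by exact: complexE.
  by rewrite {1}ez !(rmorphB, rmorphM, rmorph1) /=; ring.
apply: le_trans (cnD _ _) _; apply: le_trans (lerD (cnD _ _) (lexx _)) _.
rewrite !cnM !cn_real (ger0_norm (expR_ge0 _)) normrM.
have -> : cn ('i : C) = 1 by rewrite /cn /= expr0n add0r expr1n sqrtr1.
have h1 := cn_cexpi_sub1B b; have h2 := abs_expR_sub1 a; have h5 := abs_expR_sub1Dx a.
have h3 : expR `|a| <= expR (cn z) by rewrite ler_expR.
have h4 : expR a <= expR (cn z) by rewrite ler_expR (le_trans (ler_norm _)).
have p1 := expR_gt0 a; have p3 := expR_gt0 `|a|; have p4 := normr_ge0 a; have p5 := normr_ge0 b.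
have p6 := cn_ge0 (cexp ('i * b%:C) - 1 - 'i * b%:C).
have b2 : b ^+ 2 <= cn z ^+ 2 by rewrite -real_normK ?num_real // ler_pXn2r ?nnegrE ?cn_ge0.
have a2 : a ^+ 2 <= cn z ^+ 2 by rewrite -real_normK ?num_real // ler_pXn2r ?nnegrE ?cn_ge0.
have ab : `|b| * `|a| <= cn z ^+ 2 by rewrite expr2 ler_pM.
have q1 : expR a * cn (cexp ('i * b%:C) - 1 - 'i * b%:C) <= expR (cn z) * (2 * cn z ^+ 2).
  by apply: ler_pM => //; [exact: ltW | lra].
have q2 : `|expR a - 1 - a| <= cn z ^+ 2 * expR (cn z).
  by apply: le_trans h5 _; apply: ler_pM => //; [exact: sqr_ge0 | exact: ltW].
have q3 : `|b| * `|expR a - 1| <= cn z ^+ 2 * expR (cn z).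
  apply: le_trans (_ : `|b| * (`|a| * expR `|a|) <= _); first by rewrite ler_wpM2l.
  by rewrite mulrA; apply: ler_pM => //; [exact: mulr_ge0 | exact: ltW].
lra.
Qed.

(** With d = c / p, exp (c u) = exp (d u)^p >= (1 + d u)^p, and (1 + 1/d) (1 + d u) >= 1 + u. *)
Lemma poly_le_exp (c : R) p : 0 < c ->
  exists2 K : R, 0 < K & forall u, 0 <= u -> (1 + u) ^+ p <= K * expR (c * u).
Proof.
move=> c0; case: p => [|p].
  by exists 1 => // u u0; rewrite expr0 mul1r -[1]expR0 ler_expR mulr_ge0 // ltW.
pose d := c / p.+1%:R; have d0 : 0 < d by apply: divr_gt0.
exists ((1 + d^-1) ^+ p.+1) => [|u u0].
  by apply: exprn_gt0; rewrite addr_gt0 // invr_gt0.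
have -> : c * u = p.+1%:R * (d * u) by rewrite /d; field; rewrite addrC natr1 pnatr_eq0.
rewrite expRM_natl -exprMn ler_pXn2r ?nnegrE //; last first.
- by apply: mulr_ge0; [rewrite addr_ge0 // invr_ge0 ltW | exact: expR_ge0].
- lra.
have e1 := expR_ge1Dx (d * u).
have di : d * d^-1 = 1 by rewrite divff // gt_eqF.
have di0 : 0 < d^-1 by rewrite invr_gt0.
apply: le_trans (_ : (1 + d^-1) * (1 + d * u) <= _); last by rewrite ler_wpM2l //; lra.
rewrite mulrDl mul1r mulrDr mulr1 mulrA [d^-1 * d]mulrC di; nra.
Qed.

(** The bounded function g(x) = x / (1 + |x|) grows fast enough that h / (1 + x^2) <= 4 (g(x + h) -
    g(x - h)), so the sum telescopes. The bound does not depend on the mesh h or the shift v, which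
    makes it a common majorant for all Riemann sums below. The value 16 is 4 times the largest
    variation of [G], which is 4. *)
Lemma rbound_lorentz (h v : R) : 0 < h <= 1 ->
  rbound (fun j : int => h / (1 + (j%:~R * h + v) ^+ 2)) 16.
Proof.
move=> /andP[h0 h1].
pose g (x : R) := x / (1 + `|x|).
have gp x : 0 <= x -> h / (1 + x ^+ 2) <= 4 * (g (x + h) - g x).
  move=> x0; rewrite /g !ger0_norm //; last lra.
  rewrite -subr_ge0.
  have -> : 4 * ((x + h) / (1 + (x + h)) - x / (1 + x)) - h / (1 + x ^+ 2) =
     h * (4 * (1 + x ^+ 2) - (1 + x) * (1 + (x + h))) / ((1 + x) * (1 + (x + h)) * (1 + x ^+ 2)).
    by field; apply/and3P; split; apply: lt0r_neq0; have := sqr_ge0 x; nra.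
  apply: divr_ge0; last by apply: mulr_ge0; have := sqr_ge0 x; nra.
  apply: mulr_ge0; first exact: ltW.
  have : (1 + x) * (1 + (x + h)) <= (1 + x) * (2 + x) by apply: ler_wpM2l; lra.
  have := sqr_ge0 (2 * x - 1); nra.
have gN x : g (- x) = - g x by rewrite /g normrN mulNr.
have gmono x : g x <= g (x + h).
  have [x0|x0] := leP 0 x.
    have := gp x x0; have : 0 <= h / (1 + x ^+ 2).
      by apply: divr_ge0; [exact: ltW | have := sqr_ge0 x; lra].
    lra.
  have [x1|x1] := leP 0 (x + h).
    apply: (@le_trans _ _ 0); rewrite /g; first by apply: mulr_le0_ge0; [exact: ltW | rewrite invr_ge0 addr_ge0].
    by rewrite divr_ge0 // addr_ge0.
  have := gp (- (x + h)) (ltac:(by lra)); have -> : - (x + h) + h = - x by ring.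
  rewrite !gN; have : 0 <= h / (1 + (- (x + h)) ^+ 2).
    by apply: divr_ge0; [exact: ltW | have := sqr_ge0 (- (x + h)); lra].
  lra.
have key x : h / (1 + x ^+ 2) <= 4 * (g (x + h) - g (x - h)).
  have [x0|x0] := leP 0 x; first by have := gp x x0; have := gmono (x - h); rewrite subrK; lra.
  have := gp (- x) (ltac:(by lra)); have := gmono x; rewrite sqrrN !gN.
  by rewrite (_ : - x + h = - (x - h)) ?gN; [lra | ring].
have gb x : -1 <= g x <= 1.
  rewrite /g -ler_norml normrM normfV [`|1 + _|]ger0_norm ?addr_ge0 //.
  by rewrite ler_pdivrMr ?mul1r ?lerDr //; have := normr_ge0 x; lra.
move=> s us.
pose M := \max_(j <- s) `|j|%N.
pose t := symrange M; have ut := symrange_uniq M.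
have st : {subset s <= t} by move=> j js; rewrite mem_symrange /M (big_rem j) //= leq_maxl.
apply: le_trans (_ : \sum_(j <- t) h / (1 + (j%:~R * h + v) ^+ 2) <= _).
  apply: sum_le_subset => // j; apply: divr_ge0; first exact: ltW.
  by have := sqr_ge0 (j%:~R * h + v); lra.
pose G (k : nat) := g ((k%:Z - M%:Z)%:~R * h + v) + g ((k%:Z - M%:Z)%:~R * h + v - h).
apply: le_trans (_ : \sum_(k <- iota 0 (M + M).+1) 4 * (G k.+1 - G k) <= _).
  rewrite big_map; apply: ler_sum => k _; apply: le_trans (key _) _.
  rewrite /G; have -> : (k.+1%:Z - M%:Z)%:~R * h + v = (k%:Z - M%:Z)%:~R * h + v + h.
    by rewrite -addn1 PoszD !intrD; ring.
  by rewrite addrK; lra.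
rewrite -mulr_sumr -[iota _ _]/(index_iota 0 (M + M).+1) telescope_sumr //.
have := gb ((((M + M).+1)%:Z - M%:Z)%:~R * h + v); have := gb ((((M + M).+1)%:Z - M%:Z)%:~R * h + v - h).
have := gb ((0%:Z - M%:Z)%:~R * h + v); have := gb ((0%:Z - M%:Z)%:~R * h + v - h).
rewrite /G; move=> /andP[? ?] /andP[? ?] /andP[? ?] /andP[? ?]; lra.
Qed.

End ComplexExp.

(** * Poisson summation in dimension one *)

Section PoissonOneDim.
Variable R : realType.
Local Notation C := R[i].
Implicit Types (al be ga ze lam w v : C) (x h e : R) (N : nat) (j k m : int).

Definition gauss (z : C) : C := cexp (- pi%:C * z ^+ 2).

Lemma pi4 : 0 < (pi : R) <= 4.
Proof. by rewrite pi_gt0 pi_le4. Qed.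

(* The first-order term is symmetric under exchanging [al] and [ga]: moving the parameter [lam]
   and translating the grid cancel to first order, so Riemann sums telescope along a path. *)
Lemma gauss_taylor al be ga ze e (Q y : R) : 0 <= e <= 1 -> 1 <= Q -> 1 <= y ->
  cn al <= Q * y -> cn be <= Q * y -> cn ga <= Q * y -> cn ze <= Q * y ->
  cn ((al + e%:C * be) * gauss (ze + e%:C * ga) - al * gauss ze
      - e%:C * (be - 2 * pi%:C * ze * al * ga) * gauss ze) <=
  e ^+ 2 * (cn (gauss ze) * expR (e * (12 * Q ^+ 2 * y ^+ 2)) * (10 ^+ 3 * Q ^+ 5 * y ^+ 5)).
Proof.
move=> /andP[e0 e1] Q1 y1 ha hb hg hz; have /andP[p0 p4] := pi4.
pose k := - (2 * pi%:C * e%:C * ze * ga) - pi%:C * e%:C ^+ 2 * ga ^+ 2.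
pose M := 12 * Q ^+ 2 * y ^+ 2.
have Qy1 : 1 <= Q * y by nra.
have M1 : 1 <= M by rewrite /M -mulrA -exprMn; nra.
have cnpi : cn (pi%:C : C) = pi by rewrite cn_real ger0_norm ?ltW.
have cne : cn (e%:C : C) = e by rewrite cn_real ger0_norm.
have cn2 : cn (2 : C) = 2 := cn_nat R 2.
have zg : cn ze * cn ga <= (Q * y) ^+ 2 by rewrite expr2; apply: ler_pM; rewrite ?cn_ge0.
have gg : cn ga ^+ 2 <= (Q * y) ^+ 2 by rewrite ler_pXn2r ?nnegrE ?cn_ge0 //; lra.
have gg0 := sqr_ge0 (cn ga).
have hk : cn k <= e * M.
  rewrite /k; apply: le_trans (cnB _ _) _; rewrite cnN !cnM cnpi cne cn2 -!expr2.
  have e2 : e ^+ 2 <= e by rewrite expr2; nra.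
  have q1 : 2 * pi * e * cn ze * cn ga <= e * (8 * (Q * y) ^+ 2).
    rewrite [X in X <= _](_ : _ = e * (2 * pi * (cn ze * cn ga))); last by ring.
    apply: ler_wpM2l => //.
    by apply: ler_pM => //; [lra | apply: mulr_ge0; exact: cn_ge0 | lra].
  have q2 : pi * e ^+ 2 * cn ga ^+ 2 <= e * (4 * (Q * y) ^+ 2).
    rewrite [X in X <= _](_ : _ = e ^+ 2 * (pi * cn ga ^+ 2)); last by ring.
    apply: ler_pM => //; first exact: sqr_ge0.
      by apply: mulr_ge0 => //; exact: ltW.
    by apply: ler_pM => //; exact: ltW.
  apply: le_trans (lerD q1 q2) _; rewrite /M exprMn; lra.
have gk : gauss (ze + e%:C * ga) = gauss ze * cexp k.
  by rewrite /gauss -cexpD; congr cexp; rewrite /k; ring.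
have -> : (al + e%:C * be) * gauss (ze + e%:C * ga) - al * gauss ze
      - e%:C * (be - 2 * pi%:C * ze * al * ga) * gauss ze =
   gauss ze * (al * (cexp k - 1 - k) - al * (pi%:C * e%:C ^+ 2 * ga ^+ 2)
               + e%:C * be * (cexp k - 1)).
  by rewrite gk /k; ring.
rewrite cnM [X in _ <= X](_ : _ = cn (gauss ze) * (e ^+ 2 *
  (expR (e * (12 * Q ^+ 2 * y ^+ 2)) * (10 ^+ 3 * Q ^+ 5 * y ^+ 5)))); last by ring.
apply: ler_wpM2l; first exact: cn_ge0.
have ek : expR (cn k) <= expR (e * M) by rewrite ler_expR.
have k0 := cn_ge0 k; have E1 : 1 <= expR (e * M) by apply: le_trans ek; rewrite -expR0 ler_expR.
have E0 := expR_gt0 (cn k); have a0 := cn_ge0 al; have b0 := cn_ge0 be.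
have t1 : cn (al * (cexp k - 1 - k)) <= (Q * y) * (4 * (e * M) ^+ 2 * expR (e * M)).
  rewrite cnM; apply: ler_pM; rewrite ?cn_ge0 //; apply: le_trans (cn_cexp_sub1B _) _.
  apply: ler_pM => //; [by apply: mulr_ge0; rewrite ?sqr_ge0 | exact: ltW |].
  by rewrite ler_wpM2l // ler_pXn2r ?nnegrE // mulr_ge0 //; lra.
have t2 : cn (al * (pi%:C * e%:C ^+ 2 * ga ^+ 2)) <= (Q * y) * (e ^+ 2 * M * expR (e * M)).
  rewrite cnM; apply: ler_pM; rewrite ?cn_ge0 // !cnM cnpi cne -!expr2.
  apply: le_trans (_ : e ^+ 2 * M <= _); last by rewrite ler_peMr // mulr_ge0 ?sqr_ge0 //; lra.
  rewrite (mulrC pi) -mulrA; apply: ler_wpM2l; first exact: sqr_ge0.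
  apply: le_trans (_ : 4 * (Q * y) ^+ 2 <= _); first by apply: ler_pM => //; exact: ltW.
  by rewrite /M exprMn; have := sqr_ge0 (Q * y); rewrite exprMn; lra.
have t3 : cn (e%:C * be * (cexp k - 1)) <= e * (Q * y) * (2 * (e * M) * expR (e * M)).
  rewrite cnM; apply: ler_pM; rewrite ?cn_ge0 //; first by rewrite cnM cne ler_wpM2l.
  apply: le_trans (cn_cexp_sub1 _) _; apply: ler_pM => //; [lra | exact: ltW | lra].
apply: le_trans (cnD _ _) _; apply: le_trans (lerD (cnB _ _) (lexx _)) _.
apply: le_trans (lerD (lerD t1 t2) t3) _.
rewrite [X in X <= _](_ : _ = e ^+ 2 * (expR (e * M) * ((Q * y) * (4 * M ^+ 2 + M + 2 * M)))); last by ring.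
apply: ler_wpM2l; first exact: sqr_ge0.
rewrite -/M; apply: ler_wpM2l; first lra.
rewrite (_ : 10 ^+ 3 * Q ^+ 5 * y ^+ 5 = (Q * y) * (10 ^+ 3 * (Q * y) ^+ 4)); last by ring.
apply: ler_wpM2l; first lra.
have -> : (Q * y) ^+ 4 = M ^+ 2 / 144 by rewrite /M; field.
have M12 : 12 <= M by rewrite /M -mulrA -exprMn; nra.
have : 12 * M <= M ^+ 2 by rewrite expr2 ler_wpM2r //; lra.
lra.
Qed.

(** The linear term 2 Re (lam w) x is absorbed into half of the quadratic term by completing a
    square; since pi > 2, the full rate c still remains. *)
Lemma gauss_decay (Q c : R) : 0 < c -> 1 <= Q -> exists2 K : R, 0 < K &
  forall lam w x, cn lam <= Q -> cn w <= Q -> c <= Re (lam ^+ 2) ->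
    cn (gauss (lam * x%:C + w)) <= K * expR (- c * x ^+ 2).
Proof.
move=> c0 Q1; have /andP[p0 p4] := pi4.
exists (expR (8 * (Q ^+ 4 / c) + 4 * Q ^+ 2)) => [|lam w x hl hw hc]; first exact: expR_gt0.
rewrite /gauss cn_cexp -expRD ler_expR.
have -> : Re (- pi%:C * (lam * x%:C + w) ^+ 2) =
    - pi * (Re (lam ^+ 2) * x ^+ 2 + 2 * Re (lam * w) * x + Re (w ^+ 2)).
  case: (lam) (w) => [a b] [u t].
  by rewrite !expr2 !(cReM, cReD, cImM, cImD, cReN, cImN) /=; ring.
have h1 : `|Re (lam * w)| <= Q ^+ 2.
  by apply: le_trans (abs_Re_le _) _; rewrite cnM expr2; apply: ler_pM; rewrite ?cn_ge0.
have h2 : `|Re (w ^+ 2)| <= Q ^+ 2.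
  by apply: le_trans (abs_Re_le _) _; rewrite cnX ler_pXn2r ?nnegrE ?cn_ge0 //; lra.
set A := Re (lam ^+ 2) in hc *; set B := Re (lam * w) in h1 *; set D := Re (w ^+ 2) in h2 *.
move: h1 h2; rewrite !ler_norml => /andP[b1 b2] /andP[d1 d2].
have p3 := @pi_ge312 R.
have x2 := sqr_ge0 x.
have key : 2 * B * x >= - (c / 2 * x ^+ 2) - 2 * (Q ^+ 4 / c).
  have := sqr_ge0 (c * x + 2 * B).
  have BQ : B ^+ 2 <= Q ^+ 4 by rewrite (_ : Q ^+ 4 = (Q ^+ 2) ^+ 2); [nra | ring].
  have -> : Q ^+ 4 = c * (Q ^+ 4 / c) by field; exact: lt0r_neq0.
  move: BQ; rewrite {1}(_ : Q ^+ 4 = c * (Q ^+ 4 / c)); last by field; exact: lt0r_neq0.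
  rewrite (_ : c * (Q ^+ 4 / c) / c = Q ^+ 4 / c); last by field; exact: lt0r_neq0.
  set q := Q ^+ 4 / c => BQ h.
  have : 0 <= c * (c * x ^+ 2 + 4 * B * x + 4 * q) by nra.
  rewrite pmulr_rge0 //; lra.
have Ax : c * x ^+ 2 <= A * x ^+ 2 by apply: ler_wpM2r.
have q0 : 0 <= Q ^+ 4 / c by apply: divr_ge0; [apply: exprn_ge0; lra | exact: ltW].
have cx : 0 <= c * x ^+ 2 by apply: mulr_ge0 => //; exact: ltW.
have Q20 := sqr_ge0 Q.
set T := A * x ^+ 2 + 2 * B * x + D.
have T1 : c / 2 * x ^+ 2 - 2 * (Q ^+ 4 / c) - Q ^+ 2 <= T by rewrite /T; lra.
have : pi * (c / 2 * x ^+ 2 - 2 * (Q ^+ 4 / c) - Q ^+ 2) <= pi * T by rewrite ler_pM2l.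
set q := Q ^+ 4 / c in q0 *.
have f1 : 2 * (c * x ^+ 2) <= pi * (c * x ^+ 2) by apply: ler_wpM2r => //; lra.
have f2 : pi * q <= 4 * q by apply: ler_wpM2r.
have f3 : pi * Q ^+ 2 <= 4 * Q ^+ 2 by apply: ler_wpM2r.
lra.
Qed.

(** The cone |Im| < Re is convex: along the segment from 1 to lam both Re - |Im| and Re + |Im| stay
    above the smaller end value [d] of Re - |Im|, and their product is the real part of the
    square. *)
Lemma path_decay lam w : `|Im lam| < Re lam -> exists Q c : R, [/\ 1 <= Q, 0 < c &
  forall s, 0 <= s <= 1 -> [/\ cn (1 + s%:C * (lam - 1)) <= Q, cn (s%:C * w) <= Q,
    cn (lam - 1) <= Q, cn w <= Q & c <= Re ((1 + s%:C * (lam - 1)) ^+ 2)]].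
Proof.
move=> hl; pose d := Num.min 1 (Re lam - `|Im lam|).
have d0 : 0 < d by rewrite lt_min ltr01 subr_gt0.
exists (1 + cn (lam - 1) + cn w), (d ^+ 2); split.
- by have := cn_ge0 (lam - 1); have := cn_ge0 w; lra.
- by rewrite exprn_gt0.
move=> s /andP[s0 s1].
have c1 := cn_ge0 (lam - 1); have c2 := cn_ge0 w.
have cs z : cn (s%:C * z) <= cn z by rewrite cnM cn_real ger0_norm //; have := cn_ge0 z; nra.
split; try lra.
- by apply: le_trans (cnD _ _) _; rewrite cn1; have := cs (lam - 1); lra.
- by have := cs w; lra.
have r1 : d <= 1 by rewrite ge_min lexx.
have r2 : d <= Re lam - `|Im lam| by rewrite ge_min lexx orbT.
move: d d0 r1 r2 => d d0 r1 r2; case: lam hl c1 r2 {cs} => a b /= hl c1 r2.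
rewrite [X in _ <= X](_ : _ = (1 + s * (a - 1)) ^+ 2 - (s * b) ^+ 2); last by ring.
have b2 : (s * b) ^+ 2 = (s * `|b|) ^+ 2 by rewrite !exprMn real_normK ?num_real.
rewrite b2 subr_sqr; have b0 := normr_ge0 b.
have u1 : d <= 1 + s * (a - 1) - s * `|b| by nra.
have u2 : d <= 1 + s * (a - 1) + s * `|b| by nra.
by rewrite expr2; apply: ler_pM => //; exact: ltW.
Qed.

(** Turns the pointwise second-order estimate into one with a summable majorant. The choice of [e0]
    makes e M <= c / 2, so the exponential loss in the Taylor error costs half of the Gaussian
    decay. *)
Lemma gauss_env (Q c : R) : 0 < c -> 1 <= Q -> exists K e0 : R, [/\ 0 < K, 0 < e0 <= 1 &
  forall al be ga lam w x e, 0 <= e <= e0 ->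
    cn lam <= Q -> cn w <= Q -> c <= Re (lam ^+ 2) ->
    cn al <= Q * (1 + `|x|) -> cn be <= Q * (1 + `|x|) -> cn ga <= Q * (1 + `|x|) ->
  cn ((al + e%:C * be) * gauss (lam * x%:C + w + e%:C * ga) - al * gauss (lam * x%:C + w)
      - e%:C * (be - 2 * pi%:C * (lam * x%:C + w) * al * ga) * gauss (lam * x%:C + w)) <=
  e ^+ 2 * (K / (1 + x ^+ 2))].
Proof.
move=> c0 Q1; have [K1 K10 hK1] := gauss_decay c0 Q1.
(* Five powers of 1 + x^2 come from y^5, the sixth from the denominator 1 + x^2. *)
have [K2 K20 hK2] := @poly_le_exp R (c / 2) 6 (ltac:(by lra)).
pose M := 24 * Q ^+ 2; have M0 : 0 < M by rewrite /M; nra.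
pose e0 := Num.min 1 (c / (2 * M)).
have e00 : 0 < e0 by rewrite lt_min ltr01 divr_gt0 //; lra.
exists (K1 * K2 * expR (c / 2) * (32 * 10 ^+ 3 * Q ^+ 5)), e0; split.
- by rewrite !mulr_gt0 ?expR_gt0 //; lra.
- by rewrite e00 ge_min lexx.
move=> al be ga lam w x e /andP[ee0 ee1] hl hw hc ha hb hg.
have e1 : e <= 1 by apply: le_trans ee1 _; rewrite ge_min lexx.
have eM : e * M <= c / 2.
  have : e <= c / (2 * M) by apply: le_trans ee1 _; rewrite ge_min lexx orbT.
  rewrite ler_pdivlMr; last lra.
  by lra.
set y := 1 + `|x|; have y1 : 1 <= y by rewrite /y lerDl.
have x0 := normr_ge0 x.
have y2 : y ^+ 2 <= 2 * (1 + x ^+ 2).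
  by rewrite /y; have := sqr_ge0 (1 - `|x|); have := real_normK (num_real x); nra.
have x2 := sqr_ge0 x.
have hz : cn (lam * x%:C + w) <= Q * y.
  apply: le_trans (cnD _ _) _; rewrite cnM cn_real /y.
  have : cn lam * `|x| <= Q * `|x| by apply: ler_wpM2r.
  lra.
apply: le_trans (gauss_taylor (e := e) _ Q1 y1 ha hb hg hz) _; first by rewrite ee0.
apply: ler_wpM2l; first exact: sqr_ge0.
have g1 := hK1 lam w x hl hw hc.
have g2 : expR (e * (12 * Q ^+ 2 * y ^+ 2)) <= expR (c / 2) * expR (c / 2 * x ^+ 2).
  rewrite -expRD ler_expR.
  apply: le_trans (_ : e * M * (1 + x ^+ 2) <= _); last by nra.
  rewrite /M -!mulrA; apply: ler_wpM2l => //; have Q2 := sqr_ge0 Q; nra.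
have g3 : y ^+ 5 <= 32 * (1 + x ^+ 2) ^+ 5.
  apply: le_trans (_ : (2 * (1 + x ^+ 2)) ^+ 5 <= _); last by rewrite exprMn; lra.
  rewrite ler_pXn2r // ?nnegrE; [|exact: le_trans ler01 y1|by rewrite mulr_ge0 // addr_ge0].
  by apply: le_trans y2; rewrite expr2; nra.
have g4 := hK2 (x ^+ 2) x2.
have E1 := expR_gt0 (c / 2); have E2 := expR_gt0 (c / 2 * x ^+ 2).
have E3 := expR_gt0 (- c * x ^+ 2).
have Q0 : 0 <= Q := le_trans ler01 Q1; have y0 : 0 <= y := le_trans ler01 y1.
have s1 : cn (gauss (lam * x%:C + w)) * expR (e * (12 * Q ^+ 2 * y ^+ 2)) <=
   K1 * expR (c / 2) * expR (- (c / 2) * x ^+ 2).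
  apply: le_trans (ler_pM (cn_ge0 _) (expR_ge0 _) g1 g2) _.
  rewrite [X in X <= _](_ : _ = K1 * expR (c / 2) * (expR (- c * x ^+ 2) * expR (c / 2 * x ^+ 2))); last by ring.
  rewrite -expRD ler_wpM2l //; first by rewrite mulr_ge0 // ltW.
  by rewrite ler_expR; lra.
have s2 : 10 ^+ 3 * Q ^+ 5 * y ^+ 5 <= 32 * 10 ^+ 3 * Q ^+ 5 * (1 + x ^+ 2) ^+ 5.
  apply: le_trans (_ : 10 ^+ 3 * Q ^+ 5 * (32 * (1 + x ^+ 2) ^+ 5) <= _).
    by apply: ler_wpM2l => //; rewrite mulr_ge0 ?exprn_ge0.
  by rewrite le_eqVlt; apply/orP; left; apply/eqP; ring.
apply: le_trans (ler_pM _ _ s1 s2) _; first by rewrite mulr_ge0 ?cn_ge0 ?expR_ge0.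
  by rewrite !mulr_ge0 ?exprn_ge0.
rewrite ler_pdivlMr; last by rewrite ltr_pwDl.
rewrite [X in X <= _](_ : _ = K1 * expR (c / 2) * (32 * 10 ^+ 3 * Q ^+ 5) *
   (expR (- (c / 2) * x ^+ 2) * (1 + x ^+ 2) ^+ 6)); last by ring.
rewrite [X in _ <= X](_ : _ = K1 * expR (c / 2) * (32 * 10 ^+ 3 * Q ^+ 5) * K2); last by ring.
apply: ler_wpM2l; first by apply: mulr_ge0; [apply: mulr_ge0; exact: ltW | by rewrite !mulr_ge0 ?exprn_ge0].
rewrite mulNr expRN -ler_pdivlMl ?invr_gt0 ?expR_gt0 // invrK mulrC; exact: g4.
Qed.

End PoissonOneDim.

Section PoissonOneDim2.
Variable R : realType.
Local Notation C := R[i].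
Implicit Types (lam w v : C) (x h e : R) (N M : nat) (j m : int).

Lemma csum_env h (v K : R) (u : int -> C) : 0 < h <= 1 -> 0 <= K ->
  (forall j, cn (u j) <= K / (1 + (j%:~R * h + v) ^+ 2)) ->
  summ u /\ cn (h%:C * csum u) <= 16 * K.
Proof.
move=> h01 K0 hu; have /andP[h0 _] := h01; have hb := rbound_lorentz v h01.
have hb' : rbound (fun j : int => K / (1 + (j%:~R * h + v) ^+ 2)) (16 * K / h).
  move=> s us; rewrite (eq_bigr (fun j : int => K / h * (h / (1 + (j%:~R * h + v) ^+ 2)))).
    rewrite -mulr_sumr (_ : 16 * K / h = K / h * 16); last by ring.
    by apply: ler_wpM2l; [apply: divr_ge0 => //; exact: ltW | exact: hb].
  move=> j _; rewrite mulrA divfK //; exact: lt0r_neq0.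
have su := summ_le hb' hu; split=> //.
rewrite cnM cn_real (ger0_norm (ltW h0)) mulrC -ler_pdivlMr //.
apply: cn_csum_le => s us; apply: le_trans (hb' s us).
by apply: ler_sum => j _.
Qed.

Lemma gauss_lorentz (Q c : R) : 0 < c -> 1 <= Q -> exists2 K : R, 0 < K &
  forall lam w x, cn lam <= Q -> cn w <= Q -> c <= Re (lam ^+ 2) ->
    cn (gauss (lam * x%:C + w)) * (1 + `|x|) <= K / (1 + x ^+ 2).
Proof.
move=> c0 Q1; have [K1 K10 hK1] := gauss_decay c0 Q1.
have [K2 K20 hK2] := @poly_le_exp R c 2 c0.
exists (2 * K1 * K2); first by rewrite !mulr_gt0.
move=> lam w x hl hw hc; have x2 := sqr_ge0 x.
rewrite ler_pdivlMr; last lra.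
have a1 : 1 + `|x| <= 2 * (1 + x ^+ 2).
  by have := sqr_ge0 (`|x| - 1 / 2); have := real_normK (num_real x); nra.
have g1 := hK1 lam w x hl hw hc; have g2 := hK2 _ x2.
apply: le_trans (_ : K1 * expR (- c * x ^+ 2) * (2 * (1 + x ^+ 2)) * (1 + x ^+ 2) <= _).
  apply: ler_wpM2r; first lra.
  by apply: ler_pM => //; [exact: cn_ge0 | have := normr_ge0 x; lra].
rewrite mulNr expRN [X in X <= _](_ : _ = 2 * K1 * ((expR (c * x ^+ 2))^-1 * (1 + x ^+ 2) ^+ 2)); last by ring.
apply: ler_wpM2l; first by rewrite mulr_ge0 // ltW.
by rewrite -ler_pdivlMl ?invr_gt0 ?expR_gt0 // invrK mulrC.
Qed.

(** Riemann sum of mesh 1/N for the integral of exp (- pi (lam x + w)^2), whose exact value is 1/lam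
    for every w. *)
Definition gsum N lam w : C := (N%:R^-1)%:C * csum (fun j : int => gauss (lam * (j%:~R / N%:R)%:C + w)).

Definition lpath N lam (k : nat) : C := 1 + (k%:R / N%:R)%:C * (lam - 1).
Definition tpath N w (k : nat) : C := (k%:R / N%:R)%:C * w.

(** The derivative of lam_s gauss (lam_s x + t_s) along the path equals the x-derivative of ((lam -
    1) x + w) gauss (lam_s x + t_s), the function [psi]. One step of the path is therefore matched,
    up to O(1/N^2), by the difference of [psi] at neighbouring grid points, and these differences
    sum to zero over the whole grid. *)
Lemma gsum_step lam w : `|Im lam| < Re lam -> exists K e0 : R, [/\ 0 < K, 0 < e0 <= 1 &
  forall N, (0 < N)%N -> N%:R^-1 <= e0 -> forall i, (i < N)%N ->
   cn (lpath N lam i.+1 * gsum N (lpath N lam i.+1) (tpath N w i.+1) -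
       lpath N lam i * gsum N (lpath N lam i) (tpath N w i)) <= K / N%:R ^+ 2].
Proof.
move=> hl; have [Q [c [Q1 c0 hQ]]] := path_decay w hl.
have [K [e0 [K0 e00 hK]]] := gauss_env c0 (ltac:(by lra) : 1 <= 2 * Q).
have [K1 K10 hK1] := gauss_lorentz c0 Q1.
have Q2 : Q <= 2 * Q by lra.
have Q20 : 0 <= 2 * Q by lra.
exists (32 * K), e0; split=> //; first by lra.
move=> N N0 Ne0 i iN; pose l := lpath N lam; pose t := tpath N w.
rewrite -/(l i) -/(l i.+1) -/(t i) -/(t i.+1).
pose h : R := N%:R^-1; have h0 : 0 < h by rewrite invr_gt0 ltr0n.
have /andP[_ e01] := e00.
have h1 : 0 < h <= 1 by rewrite h0 /= (le_trans Ne0).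
have hin k : (k <= N)%N -> 0 <= (k%:R / N%:R : R) <= 1.
  move=> kN; rewrite divr_ge0 //= ler_pdivrMr ?ltr0n // mul1r ler_nat //.
have [l1 t1 d1 w1 c1] := hQ _ (hin i (ltnW iN)).
have [l2 t2 _ _ c2] := hQ _ (hin i.+1 iN).
have {}l1 : cn (l i) <= Q := l1; have {}t1 : cn (t i) <= Q := t1.
have {}l2 : cn (l i.+1) <= Q := l2; have {}t2 : cn (t i.+1) <= Q := t2.
have {}c1 : c <= Re (l i ^+ 2) := c1; have {}c2 : c <= Re (l i.+1 ^+ 2) := c2.
pose x j : R := j%:~R / N%:R.
have xE j : x j = j%:~R * h + 0 by rewrite addr0.
pose g k j := l k * gauss (l k * (x j)%:C + t k).
pose psi j := ((lam - 1) * (x j)%:C + w) * gauss (l i * (x j)%:C + t i).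
have lin j : cn ((lam - 1) * (x j)%:C + w) <= Q * (1 + `|x j|).
  apply: le_trans (cnD _ _) _; rewrite cnM cn_real.
  have : cn (lam - 1) * `|x j| <= Q * `|x j| by apply: ler_wpM2r.
  lra.
have sg k : cn (l k) <= Q -> cn (t k) <= Q -> c <= Re (l k ^+ 2) -> summ (g k).
  move=> a1 a2 a3; have [||//] := @csum_env h 0 (Q * K1) (g k) h1.
    by apply: mulr_ge0; [lra | exact: ltW].
  move=> j; rewrite -xE /g cnM -mulrA; apply: ler_pM; rewrite ?cn_ge0 //.
  apply: le_trans (hK1 _ _ (x j) a1 a2 a3).
  by rewrite ler_peMr ?cn_ge0 // lerDl.
have spsi : summ psi.
  have [||//] := @csum_env h 0 (Q * K1) psi h1.
    by apply: mulr_ge0; [lra | exact: ltW].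
  move=> j; rewrite -xE /psi cnM -mulrA.
  apply: le_trans (_ : Q * (cn (gauss (l i * (x j)%:C + t i)) * (1 + `|x j|)) <= _).
    rewrite [X in _ <= X](_ : _ = Q * (1 + `|x j|) * cn (gauss (l i * (x j)%:C + t i))); last by ring.
    by rewrite ler_wpM2r ?cn_ge0.
  by apply: ler_wpM2l; [lra | exact: hK1].
have [E1 E2] := @csum_reindex _ _ _ (fun j : int => j + 1) (fun j => j - 1) psi
  (fun j => addrK 1 j) (fun j => subrK 1 j).
have spsi' : summ (fun j => psi (j + 1)) by exact: E1.1 spsi.
pose u j := g i.+1 j - g i j - (psi (j + 1) - psi j).
have sg1 := sg i.+1 l2 t2 c2; have sg0 := sg i l1 t1 c1.
have su : csum u = csum (g i.+1) - csum (g i).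
  have -> : csum u = csum (fun j => g i.+1 j - g i j) - csum (fun j => psi (j + 1) - psi j).
    exact: (csumB (summB sg1 sg0) (summB spsi' spsi)).
  by rewrite (csumB sg1 sg0) (csumB spsi' spsi) [csum psi](E2 spsi) subrr subr0.
have hu j : cn (u j) <= (2 * K * h ^+ 2) / (1 + (j%:~R * h + 0) ^+ 2).
  rewrite -xE.
  pose ze := l i * (x j)%:C + t i; pose ga := (lam - 1) * (x j)%:C + w.
  have Qx : Q <= 2 * Q * (1 + `|x j|).
    by apply: (le_trans Q2); rewrite ler_peMr // lerDl.
  have lin2 := lin j; have y1 : 1 <= 1 + `|x j| by rewrite lerDl.
  have Qy : Q * (1 + `|x j|) <= 2 * Q * (1 + `|x j|) by apply: ler_wpM2r => //; apply: le_trans y1.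
  have hyp : 0 <= h <= e0 by rewrite ltW.
  have T1 := hK (l i) (lam - 1) ga (l i) (t i) (x j) h hyp (le_trans l1 Q2) (le_trans t1 Q2) c1
    (le_trans l1 Qx) (le_trans d1 Qx) (le_trans lin2 Qy).
  have T2 := hK ga (lam - 1) (l i) (l i) (t i) (x j) h hyp (le_trans l1 Q2) (le_trans t1 Q2) c1
    (le_trans lin2 Qy) (le_trans d1 Qx) (le_trans l1 Qx).
  have Si : (i.+1%:R / N%:R)%:C = (i%:R / N%:R)%:C + h%:C :> C.
    by rewrite -rmorphD /= -natr1 mulrDl mul1r.
  have Sx : (x (j + 1))%:C = (x j)%:C + h%:C :> C.
    by rewrite -rmorphD /= /x intrD mulrDl mul1r.
  have -> : u j = ((l i + h%:C * (lam - 1)) * gauss (ze + h%:C * ga) - l i * gauss ze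
      - h%:C * (lam - 1 - 2 * pi%:C * ze * l i * ga) * gauss ze)
    - ((ga + h%:C * (lam - 1)) * gauss (ze + h%:C * l i) - ga * gauss ze
      - h%:C * (lam - 1 - 2 * pi%:C * ze * ga * l i) * gauss ze).
    rewrite /u /g /psi Sx -/ga -/ze.
    have -> : l i.+1 = l i + h%:C * (lam - 1) by rewrite /l /lpath Si; ring.
    have -> : (l i + h%:C * (lam - 1)) * (x j)%:C + t i.+1 = ze + h%:C * ga.
      by rewrite /ze /ga /t /tpath Si; ring.
    have -> : (lam - 1) * ((x j)%:C + h%:C) + w = ga + h%:C * (lam - 1) by rewrite /ga; ring.
    have -> : l i * ((x j)%:C + h%:C) + t i = ze + h%:C * l i by rewrite /ze; ring.
    by ring.
  apply: le_trans (cnB _ _) _; apply: le_trans (lerD T1 T2) _.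
  by rewrite le_eqVlt; apply/orP; left; apply/eqP; ring.
have kk : 0 <= 2 * K * h ^+ 2 by rewrite !mulr_ge0 ?sqr_ge0 // ltW.
have [_ fin] := csum_env h1 kk hu.
move: fin; rewrite su.
have gE k : l k * gsum N (l k) (t k) = h%:C * (l k * csum (fun j => gauss (l k * (x j)%:C + t k))).
  by rewrite /gsum mulrCA.
have gE2 k : cn (l k) <= Q -> cn (t k) <= Q -> c <= Re (l k ^+ 2) ->
    l k * csum (fun j => gauss (l k * (x j)%:C + t k)) = csum (g k).
  move=> a1 a2 a3; rewrite -csumZ //.
  have [||//] := @csum_env h 0 K1 (fun j => gauss (l k * (x j)%:C + t k)) h1; first exact: ltW.
  move=> j; rewrite -xE; apply: le_trans (hK1 _ _ (x j) a1 a2 a3).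
  by rewrite ler_peMr ?cn_ge0 // lerDl.
rewrite !gE !gE2 // -mulrBr => H; apply: le_trans H _.
by rewrite le_eqVlt; apply/orP; left; apply/eqP; rewrite /h exprVn; ring.
Qed.

(** N steps with an error O(1/N^2) each: a discrete form of the independence of the Gaussian
    integral from the contour. *)
Lemma gsum_path lam w : `|Im lam| < Re lam -> exists K : R, exists N0 : nat, 0 < K /\
  forall N, (N0 <= N)%N -> cn (lam * gsum N lam w - gsum N 1 0) <= K / N%:R.
Proof.
move=> hl; have [K [e0 [K0 /andP[e00 e01] hK]]] := gsum_step w hl.
exists K, (Num.bound e0^-1).+1; split=> // N hN.
have N0 : (0 < N)%N by apply: leq_trans hN.
have Ne : N%:R^-1 <= e0.
  rewrite invf_ple ?posrE ?ltr0n //; apply: ltW.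
  apply: lt_le_trans (archi_boundP _) _; first by rewrite invr_ge0 ltW.
  by rewrite ler_nat (leq_trans _ hN).
pose l := lpath N lam; pose t := tpath N w.
pose E k := l k * gsum N (l k) (t k).
have h i : (i < N)%N -> cn (E i.+1 - E i) <= K / N%:R ^+ 2 by exact: hK.
have N00 : N%:R != 0 :> R by rewrite pnatr_eq0 -lt0n.
have EN : E N = lam * gsum N lam w.
  rewrite /E /l /t /lpath /tpath divff // !mul1r; congr (_ * gsum _ _ _); ring.
have E0 : E 0%N = gsum N 1 0 by rewrite /E /l /t /lpath /tpath !mul0r addr0 mul1r.
rewrite -EN -E0 -(telescope_sumr E (leq0n N)).
apply: le_trans (cn_sum _ _ _) _.
apply: le_trans (_ : \sum_(0 <= k < N) K / N%:R ^+ 2 <= _).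
  by rewrite !big_nat; apply: ler_sum => i /andP[_ iN]; exact: h.
rewrite sumr_const_nat subn0 -mulr_natr le_eqVlt; apply/orP; left; apply/eqP.
by field.
Qed.

Lemma ce_neq1 (x : R) : 0 < x < 1 -> ce x != 1.
Proof.
move=> /andP[x0 x1]; rewrite ceE; apply/negP => /eqP [hc _].
have p0 := @pi_gt0 R.
have [h|h] := leP (2 * pi * x) pi.
  have := @one_sub_cos_ge R (2 * pi * x); rewrite hc subrr h andbT.
  have y0 : 0 < 2 * pi * x by rewrite !mulr_gt0.
  by move=> /(_ (ltW y0)); have := exprn_gt0 2 y0; lra.
have := @one_sub_cos_ge R (2 * pi - 2 * pi * x).
have -> : cos (2 * pi - 2 * pi * x) = 1.
  by rewrite cosB mulr_natl cos2pi sin2pi -mulr_natl hc; lra.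
have y0 : 0 < 2 * pi - 2 * pi * x by rewrite -{1}[2 * pi]mulr1 -mulrBr !mulr_gt0 // subr_gt0.
rewrite subrr (ltW y0) /= => /(_ (ltac:(by lra))); have := exprn_gt0 2 y0; lra.
Qed.

Lemma ce_eq1_dvd N j : (0 < N)%N -> ce (j%:~R / N%:R : R) = 1 -> (N %| `|j|)%N.
Proof.
move=> N0; have NN : N%:R != 0 :> R by rewrite pnatr_eq0 -lt0n.
have N0z : (N : int) != 0 by rewrite -lt0n.
rewrite {1}(divz_eq j N) intrD intrM mulrDl.
rewrite (_ : N%:~R = N%:R) // mulfK // ceD ce_int mul1r.
have r0 := modz_ge0 j N0z; have r1 := ltz_mod j N0z.
have [r|rp] := eqVneq (j %% N)%Z 0.
  move=> _; have : (N%:Z %| j)%Z by apply/dvdzP; exists (j %/ N)%Z; rewrite {1}(divz_eq j N) r addr0.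
  by rewrite dvdzE.

move=> /eqP; apply: contraTT => _; apply: ce_neq1; apply/andP; split.
  by rewrite divr_gt0 ?ltr0n // ltr0z lt_neqAle eq_sym rp.
rewrite ltr_pdivrMr ?ltr0n // mul1r (_ : N%:R = (N : int)%:~R) // ltr_int.
exact: r1.
Qed.

Lemma root_unity_sum N j : (0 < N)%N ->
  \sum_(k < N) ce (k%:R * (j%:~R / N%:R) : R) = if (N %| `|j|)%N then N%:R else 0.
Proof.
move=> N0; have NN : N%:R != 0 :> R by rewrite pnatr_eq0 -lt0n.
set z := ce (j%:~R / N%:R : R).
have E : \sum_(k < N) ce (k%:R * (j%:~R / N%:R) : R) = \sum_(k < N) z ^+ k.
  by apply: eq_bigr => k _; rewrite ceMn.
have zN : z ^+ N = 1 by rewrite /z -ceMn mulrC divfK // ce_int.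
case: ifPn => h.
  have [q jq] : exists q : int, j = q * N by exists (j %/ N)%Z; rewrite divzK.
  have z1 : z = 1 by rewrite /z jq intrM (_ : N%:~R = N%:R) // mulfK // ce_int.
  by rewrite E (eq_bigr (fun=> 1)) ?sumr_const ?card_ord // => k _; rewrite z1 expr1n.
have z1 : z - 1 != 0 by rewrite subr_eq0; apply: contra h => /eqP /(ce_eq1_dvd N0).
apply: (mulfI z1); rewrite E -subrX1 zN subrr mulr0 //.
Qed.

End PoissonOneDim2.

Section PoissonOneDim3.
Variable R : realType.
Local Notation C := R[i].
Implicit Types (lam w v : C) (x h e : R) (N M : nat) (j m : int).

Definition dft N lam w m : C := (N%:R^-1)%:C *
  csum (fun j : int => gauss (lam * (j%:~R / N%:R)%:C + w) * ce (- (m%:~R * (j%:~R / N%:R)))).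

Lemma Re_sqr_gt0 lam : `|Im lam| < Re lam -> 0 < Re (lam ^+ 2).
Proof.
case: lam => a b; rewrite [_ ^+ 2]expr2 cReM /= -!expr2 subr_gt0 => h.
rewrite -(real_normK (num_real b)) ltr_pXn2r ?nnegrE //.
by apply: le_trans (ltW h).
Qed.

Lemma gauss_summ lam w N : (0 < N)%N -> 0 < Re (lam ^+ 2) ->
  summ (fun j : int => gauss (lam * (j%:~R / N%:R)%:C + w)).
Proof.
move=> N0 hl; pose Q := 1 + cn lam + cn w.
have [c1 c2] : 0 <= cn lam /\ 0 <= cn w by rewrite !cn_ge0.
have [K1 K10 hK1] := gauss_lorentz hl (ltac:(by rewrite /Q; lra) : 1 <= Q).
have N1 : 0 < (N%:R : R)^-1 <= 1 by rewrite invr_gt0 ltr0n N0 invf_le1 ?ler1n ?ltr0n.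
have H (j : int) : cn (gauss (lam * (j%:~R / N%:R)%:C + w)) <= K1 / (1 + (j%:~R * N%:R^-1 + 0) ^+ 2).
  rewrite addr0; apply: le_trans (hK1 lam w (j%:~R / N%:R) _ _ _) => //; try (rewrite /Q; lra).
  by rewrite ler_peMr ?cn_ge0 // lerDl.
by have [] := csum_env N1 (ltW K10) H.
Qed.

Lemma gauss_summ1 lam w : 0 < Re (lam ^+ 2) ->
  summ (fun j : int => gauss (lam * j%:~R + w)).
Proof.
move=> /(gauss_summ w (isT : (0 < 1)%N)); congr summ; apply: funext => j.
by rewrite divr1 intC.
Qed.

(** Exact at every finite N: summing over a full period of frequencies keeps the grid points j / N
    with N dividing j, that is, the integers. N is odd so that the frequencies are symmetric about
    0. *)
Lemma dft_sum lam w M : 0 < Re (lam ^+ 2) -> let N := (M + M).+1 in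
  \sum_(k <- iota 0 N) dft N lam w (k%:Z - M%:Z) = csum (fun j : int => gauss (lam * j%:~R + w)).
Proof.
move=> hl N; have N0 : (0 < N)%N by []; have sg := gauss_summ w N0 hl.
have NR : N%:R != 0 :> R by rewrite pnatr_eq0.
pose g j := gauss (lam * (j%:~R / N%:R)%:C + w).
pose F (k : nat) j := g j * ce (- ((k%:Z - M%:Z)%:~R * (j%:~R / N%:R))).
have sF k : summ (F k) by apply: (summ_dom sg) => j; rewrite /F cnM cn_ce mulr1.
rewrite -mulr_sumr; have [_ <-] := csum_sum (iota 0 N) sF.
have E j : \sum_(k <- iota 0 N) F k j = N%:R * (if (N %| `|j|)%N then g j else 0).
  rewrite /F -mulr_sumr (eq_bigr (fun k : nat =>
     ce (M%:R * (j%:~R / N%:R)) * ce (k%:R * ((- j)%:~R / N%:R)))); last first.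
    by move=> k _; rewrite -ceD; congr ce; rewrite intrB mulrNz -!pmulrn; ring.
  rewrite -mulr_sumr -[iota 0 N]/(index_iota 0 N) big_mkord root_unity_sum // abszN.
  case: ifP => [/dvdnP[q jq]|_]; last by rewrite !mulr0.
  suff -> : ce (M%:R * (j%:~R / N%:R)) = 1 :> C by rewrite mul1r mulrC.
  have [q' jq'] : exists q' : int, j = q' * N.
    by exists (j %/ N)%Z; rewrite divzK // dvdzE /= jq dvdn_mull.
  rewrite jq' intrM (_ : (N%:Z)%:~R = N%:R) // mulfK //.
  exact: (@ce_int_mul R M%:Z q').
rewrite (eq_csum E) csumZ; last first.
  by apply: (summ_dom sg) => j; case: ifP => //; rewrite cn0 cn_ge0.
rewrite mulrA natC -rmorphM /= mulVf // mul1r.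
have [|j hj|_ ->] := @csum_inj R _ _ (fun k : int => k * N) (fun j => if (N %| `|j|)%N then g j else 0).
- by move=> a b /(mulIf (_ : N%:Z != 0)); exact.
- case: ifP => // /dvdnP[q jq]; case: (hj (j %/ N)%Z).
  by rewrite divzK // dvdzE /= jq dvdn_mull.
- apply: eq_csum => j /=; rewrite abszM dvdn_mull // /g intrM (_ : (N%:Z)%:~R = N%:R) // mulfK //.
  by rewrite intC.
- by apply: (summ_dom sg) => j; case: ifP => //; rewrite cn0 cn_ge0.
Qed.

(** A second difference of the Gaussian is O(h^2) with a summable majorant, while on the transform
    it acts as multiplication by 2 cos (2 pi m / N) - 2, of size at least (m / N)^2 as long as 2 |m|
    <= N. The quotient is O(1 / m^2), uniformly in N. *)
Lemma dft_bound lam w : 0 < Re (lam ^+ 2) -> exists K e0 : R, [/\ 0 < K, 0 < e0 &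
  forall N m, (0 < N)%N -> N%:R^-1 <= e0 -> (2 * `|m| <= N)%N ->
    cn (dft N lam w m) <= K / (1 + m%:~R ^+ 2)].
Proof.
move=> hl; pose Q := 1 + cn lam + cn w.
have [c1 c2] : 0 <= cn lam /\ 0 <= cn w by rewrite !cn_ge0.
have Q1 : 1 <= Q by rewrite /Q; lra.
have hlam : cn lam <= Q by rewrite /Q; lra.
have hw : cn w <= Q by rewrite /Q; lra.
have [K1 K10 hK1] := gauss_lorentz hl Q1.
have [K [e0 [K0 /andP[e00 e01] hK]]] := gauss_env hl Q1.
exists (64 * K + 16 * K1), e0; split=> //; first by lra.
move=> N m N0 Ne0 hm.
pose h : R := N%:R^-1; have h0 : 0 < h by rewrite invr_gt0 ltr0n.
have h1 : 0 < h <= 1 by rewrite h0 (le_trans Ne0).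
pose x j : R := j%:~R / N%:R.
have xE j : x j = j%:~R * h + 0 by rewrite addr0.
pose g j := gauss (lam * (x j)%:C + w); pose ee j := ce (- (m%:~R * x j)).
have sg : summ g := gauss_summ w N0 hl.
have m2 := sqr_ge0 (m%:~R : R).
have [m0|m0] := eqVneq m 0.
  have H0 j : cn (g j * ee j) <= K1 / (1 + (j%:~R * h + 0) ^+ 2).
    rewrite -xE cnM [cn (ee j)]cn_ce mulr1; apply: le_trans (hK1 lam w (x j) hlam hw (lexx _)).
    by rewrite ler_peMr ?cn_ge0 // lerDl.
  have [_ H] := csum_env h1 (ltW K10) H0.
  by apply: le_trans H _; rewrite m0 expr0n addr0 divr1; lra.
pose z := ce (m%:~R * h).
pose u j := (g (j + 1) + g (j - 1) - 2 * g j) * ee j.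
have x1 j : x (j + 1) = x j + h by rewrite /x intrD mulrDl mul1r.
have x2 j : x (j - 1) = x j - h by rewrite /x intrD mulrDl mulN1r.
have eeS j : ee (j - 1) = ee j * z by rewrite /ee x2 /z -ceD; congr ce; ring.
have eeP j : ee (j + 1) = ee j * z^-1 by rewrite /ee x1 /z -ceN -ceD; congr ce; ring.
have se (f : int -> int) : injective f -> summ (fun j => g (f j) * ee j).
  move=> fi; have [B hB] := sg; exists B => s us.
  have := hB (map f s); rewrite map_inj_uniq // big_map => /(_ us).
  rewrite [X in _ -> X <= _](eq_bigr (fun j => cn (g (f j)))) // => j _.
  by rewrite cnM [cn (ee j)]cn_ce mulr1.
have i1 : injective (fun j : int => j + 1) by move=> a b /addIr.
have i2 : injective (fun j : int => j - 1) by move=> a b /addIr.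
have sid : summ (fun j => g j * ee j) by apply: (se id).
have D1 : csum (fun j => g (j + 1) * ee j) = csum (fun j => g j * ee j) * z.
  have [E1 E2] := @csum_reindex R _ _ (fun j : int => j + 1) (fun j => j - 1)
    (fun j => g j * ee (j - 1)) (fun j => addrK 1 j) (fun j => subrK 1 j).
  transitivity (csum ((fun j => g j * ee (j - 1)) \o (fun j : int => j + 1))).
    by apply: eq_csum => j /=; rewrite addrK.
  rewrite -E2; last by apply/E1; have := se _ i1; congr summ; apply: funext => j /=; rewrite addrK.
  rewrite mulrC -csumZ //; apply: eq_csum => j; rewrite eeS; ring.
have D2 : csum (fun j => g (j - 1) * ee j) = csum (fun j => g j * ee j) * z^-1.
  have [E1 E2] := @csum_reindex R _ _ (fun j : int => j - 1) (fun j => j + 1)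
    (fun j => g j * ee (j + 1)) (fun j => subrK 1 j) (fun j => addrK 1 j).
  transitivity (csum ((fun j => g j * ee (j + 1)) \o (fun j : int => j - 1))).
    by apply: eq_csum => j /=; rewrite subrK.
  rewrite -E2; last by apply/E1; have := se _ i2; congr summ; apply: funext => j /=; rewrite subrK.
  rewrite mulrC -csumZ //; apply: eq_csum => j; rewrite eeP; ring.
have Du : h%:C * csum u = (z + z^-1 - 2) * dft N lam w m.
  have -> : u = (fun j => g (j + 1) * ee j + g (j - 1) * ee j - 2 * (g j * ee j)).
    by apply: funext => j; rewrite /u; ring.
  have s1 := se _ i1; have s2 := se _ i2.
  rewrite (csumB (summD s1 s2) (summZ 2 sid)) (csumD s1 s2) (csumZ 2 sid) D1 D2 /dft -/h; ring.
have hu j : cn (u j) <= (2 * K * h ^+ 2) / (1 + (j%:~R * h + 0) ^+ 2).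
  rewrite -xE /u cnM [cn (ee j)]cn_ce mulr1.
  have y1 : 1 <= 1 + `|x j| by rewrite lerDl.
  have hyp : 0 <= h <= e0 by rewrite ltW.
  have Qy : Q <= Q * (1 + `|x j|) by rewrite ler_peMr //; lra.
  have c1Q : cn (1 : C) <= Q * (1 + `|x j|) by rewrite cn1; apply: le_trans Qy.
  have c0Q : cn (0 : C) <= Q * (1 + `|x j|) by rewrite cn0; apply: le_trans c1Q; exact: cn_ge0.
  have T1 := hK 1 0 lam lam w (x j) h hyp hlam hw (lexx _)
    c1Q c0Q (le_trans hlam Qy).
  have T2 := hK 1 0 (- lam) lam w (x j) h hyp hlam hw (lexx _)
    c1Q c0Q (ltac:(by rewrite cnN; apply: le_trans Qy)).
  set ze := lam * (x j)%:C + w in T1 T2.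
  (* The expansions in the directions lam and -lam have opposite first-order terms, so an error of
     order h^2 is all that is left. *)
  have -> : g (j + 1) + g (j - 1) - 2 * g j =
     ((1 + h%:C * 0) * gauss (ze + h%:C * lam) - 1 * gauss ze
      - h%:C * (0 - 2 * pi%:C * ze * 1 * lam) * gauss ze)
    + ((1 + h%:C * 0) * gauss (ze + h%:C * - lam) - 1 * gauss ze
      - h%:C * (0 - 2 * pi%:C * ze * 1 * - lam) * gauss ze).
    rewrite /g x1 x2 rmorphD rmorphB /=.
    have -> : lam * ((x j)%:C + h%:C) + w = ze + h%:C * lam by rewrite /ze; ring.
    have -> : lam * ((x j)%:C - h%:C) + w = ze + h%:C * - lam by rewrite /ze; ring.
    by rewrite -/ze; ring.
  apply: le_trans (cnD _ _) _; apply: le_trans (lerD T1 T2) _.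
  by rewrite le_eqVlt; apply/orP; left; apply/eqP; ring.
have kk : 0 <= 2 * K * h ^+ 2 by rewrite !mulr_ge0 ?sqr_ge0 // ltW.
have [_ H] := csum_env h1 kk hu.
move: H; rewrite Du cnM.
pose y : R := 2 * pi * (`|m|%:R * h).
have p0 := @pi_gt0 R; have p3 := @pi_ge312 R.
have yb : 0 <= y <= pi.
  rewrite /y; apply/andP; split; first by rewrite !mulr_ge0 // ltW.
  have : `|m|%:R * h * 2 <= 1 :> R.
    by rewrite mulrAC ler_pdivrMr ?ltr0n // mul1r -natrM ler_nat mulnC.
  nra.
have cz : z + z^-1 - 2 = (2 * cos y - 2)%:C.
  rewrite /z -ceN !ceE.
  have cy : cos (2 * pi * (m%:~R * h)) = cos y.
    rewrite /y -cos_norm !normrM (ger0_norm (ltW h0)) !(ger0_norm (ltW p0)) normr_nat.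
    by congr cos; rewrite -intr_norm; case: (m).
  rewrite mulrN cosN sinN cy (natC R 2); apply: complex_eqP; rewrite !(cReD, cImD, cReN, cImN) /=; ring.
have mh : `|m|%:R * h = `|m%:~R * h| :> R.
  by rewrite normrM (ger0_norm (ltW h0)) -intr_norm; case: (m).
have yy : y ^+ 2 = 4 * pi ^+ 2 * (m%:~R ^+ 2 * h ^+ 2).
  by rewrite /y exprMn mh real_normK ?num_real //; ring.
rewrite cz cn_real; have oc := one_sub_cos_ge yb.
have mh2 : 0 < m%:~R ^+ 2 * h ^+ 2 by apply: mulr_gt0; [rewrite lt0r sqrf_eq0 intr_eq0 m0 sqr_ge0 | exact: exprn_gt0].
have lb : m%:~R ^+ 2 * h ^+ 2 <= `|2 * cos y - 2|.
  rewrite ler0_norm; last by have := cos_le1 y; lra.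
  have : 9 <= pi ^+ 2 :> R by rewrite expr2; nra.
  move: oc; rewrite yy; nra.
move=> H; have H2 : m%:~R ^+ 2 * h ^+ 2 * cn (dft N lam w m) <= 16 * (2 * K * h ^+ 2).
  by apply: le_trans H; apply: ler_wpM2r => //; exact: cn_ge0.
have H3 : m%:~R ^+ 2 * cn (dft N lam w m) <= 32 * K.
  have h2 : 0 < h ^+ 2 by rewrite exprn_gt0.
  by rewrite -(ler_pM2r h2); apply: le_trans (_ : 16 * (2 * K * h ^+ 2) <= _); [rewrite mulrAC | lra].
have m1 : 1 <= m%:~R ^+ 2 :> R.
  rewrite -rmorphXn /= (_ : 1 = 1%:~R) // ler_int.
  by rewrite -gtz0_ge1 lt0r sqrf_eq0 m0 sqr_ge0.
rewrite ler_pdivlMr; last lra.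
have := cn_ge0 (dft N lam w m); nra.
Qed.

(** The Fourier transform of x -> gauss (lam (x + v)) at the frequency m, without its factor
    1/lam. *)
Definition psi lam v m : C := cexp (- pi%:C * (m%:~R / lam) ^+ 2 + 2 * pi%:C * 'i * m%:~R * v).

Lemma psi_gauss lam v m : lam != 0 ->
  psi lam v m = cexp (- pi%:C * (lam * v) ^+ 2) * gauss (lam^-1 * m%:~R - 'i * lam * v).
Proof.
move=> l0; rewrite /psi /gauss -cexpD; congr cexp.
have i2 : 'i ^+ 2 = -1 :> C by exact: sqr_i.
by field: i2.
Qed.

Lemma psi_summ lam v : `|Im lam| < Re lam -> summ (psi lam v).
Proof.
move=> hl; have hr := Re_sqr_gt0 hl.
have l0 : lam != 0 by apply/eqP => e; move: hl; rewrite e /= normr0 ltxx.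
have hi : 0 < Re (lam^-1 ^+ 2).
  rewrite exprVn; case: (lam ^+ 2) hr => a b /= a0.
  by rewrite divr_gt0 // ltr_pwDl ?exprn_gt0 ?sqr_ge0.
apply: (summ_dom (summZ (cexp (- pi%:C * (lam * v) ^+ 2)) (gauss_summ1 (- ('i * lam * v)) hi))).
by move=> m; rewrite psi_gauss.
Qed.

(** Completing the square turns the character of frequency m into a complex shift i m / lam of the
    Gaussian, so every frequency reduces to a Riemann sum [gsum]. *)
Lemma dft_gauss lam v N m : lam != 0 -> 0 < Re (lam ^+ 2) -> (0 < N)%N ->
  dft N lam (lam * v) m = psi lam v m * gsum N lam (lam * v + 'i * m%:~R / lam).
Proof.
move=> l0 hl N0; rewrite /dft /gsum mulrCA; congr (_ * _).
rewrite -csumZ; last exact: gauss_summ.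
apply: eq_csum => j; rewrite /psi /gauss /ce -!cexpD; congr cexp.
move: (j%:~R / N%:R : R) => X; rewrite !(rmorphN, rmorphM, rmorph_int, rmorph_nat) /=.
have i2 : 'i ^+ 2 = -1 :> C by exact: sqr_i.
by field: i2.
Qed.

(* Everything but the value of the Gaussian integral, here the limit of [gsum N 1 0]. *)
Lemma poisson1_approx lam v e : `|Im lam| < Re lam -> 0 < e -> exists M0, forall M, (M0 <= M)%N ->
  cn (csum (fun j : int => gauss (lam * j%:~R + lam * v)) -
      lam^-1 * gsum (M + M).+1 1 0 * csum (psi lam v)) <= e.
Proof.
move=> hl e0; have hr := Re_sqr_gt0 hl; have sp := psi_summ v hl.
have l0 : lam != 0 by apply/eqP => el; move: hl; rewrite el /= normr0 ltxx.
have [K [d0 [K0 d00 hK]]] := dft_bound (lam * v) hr.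
have c11 : 0 < Re ((1 : C) ^+ 2) by rewrite expr1n.
have [G G0 hG] : exists2 G : R, 0 < G & forall N, (0 < N)%N -> cn (gsum N 1 0) <= G.
  have [K1 K10 hK1] := gauss_lorentz c11 (lexx 1).
  exists (16 * K1) => [|N N0]; first lra.
  have N1 : 0 < (N%:R : R)^-1 <= 1 by rewrite invr_gt0 ltr0n N0 invf_le1 ?ler1n ?ltr0n.
  have H (j : int) : cn (gauss (1 * (j%:~R / N%:R)%:C + 0)) <= K1 / (1 + (j%:~R * N%:R^-1 + 0) ^+ 2).
    rewrite [_ / _ + 0]addr0; apply: le_trans (hK1 1 0 (j%:~R / N%:R) _ _ _); rewrite ?cn1 ?cn0 //.
    by rewrite ler_peMr ?cn_ge0 // lerDl.
  by have [] := csum_env N1 (ltW K10) H.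
pose a := cn lam^-1; have a0 : 0 <= a by exact: cn_ge0.
pose b m : C := (K / (1 + m%:~R ^+ 2))%:C.
have sb : summ b.
  have H j : cn (b j) <= K / (1 + (j%:~R * 1 + 0) ^+ 2).
    rewrite mulr1 addr0 /b cn_real ger0_norm // divr_ge0 ?ltW //.
    by have := sqr_ge0 (j%:~R : R); lra.
  by have [] := csum_env (_ : 0 < 1 <= 1) (ltW K0) H; rewrite ?ltr01 ?lexx.
have [s1 [u1 t1]] := csum_tail sb (ltac:(by lra) : 0 < e / 3).
have ee0 : 0 < e / 3 / (a * G + 1).
  by apply: divr_gt0; [lra | have := mulr_ge0 a0 (ltW G0); lra].
have [s2 [u2 t2]] := csum_tail sp ee0.
pose s := undup (s1 ++ s2); have us : uniq s by exact: undup_uniq.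
have [tb _] := t1 s us (fun (x : int) hx => ltac:(by rewrite mem_undup mem_cat hx)).
have [_ tp] := t2 s us (fun (x : int) hx => ltac:(by rewrite mem_undup mem_cat hx orbT)).
have [D hD] : exists D : nat, forall N, (D <= N)%N -> (0 < N)%N ->
    \sum_(m <- s) cn (psi lam v m * (gsum N lam (lam * v + 'i * m%:~R / lam) - lam^-1 * gsum N 1 0))
      <= e / 3.
  elim: (s) (e / 3) (ltac:(by lra) : 0 < e / 3) => [|m q IH] d dd0.
    by exists 0%N => N _ _; rewrite big_nil ltW.
  have [D1 h1] := IH (d / 2) (ltac:(by lra)).
  have [K2 [N2 [K20 h2]]] := gsum_path (lam * v + 'i * m%:~R / lam) hl.
  pose B := cn (psi lam v m) * a * K2.
  have B0 : 0 <= B by rewrite !mulr_ge0 ?cn_ge0 // ltW.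
  exists (maxn (maxn D1 N2) (Num.bound (B / (d / 2)))) => N.
  rewrite !geq_max => /andP[/andP[ND1 NN2] NB] N0; rewrite big_cons.
  have := h1 N ND1 N0; have := h2 N NN2; set x := gsum _ lam _; set y := gsum _ 1 0 => hx.
  suff : cn (psi lam v m * (x - lam^-1 * y)) <= d / 2 by lra.
  have -> : x - lam^-1 * y = lam^-1 * (lam * x - y) by field.
  rewrite cnM [cn (lam^-1 * _)]cnM -/a mulrA; apply: le_trans (_ : cn (psi lam v m) * a * (K2 / N%:R) <= _).
    by apply: ler_wpM2l => //; rewrite mulr_ge0 ?cn_ge0.
  rewrite mulrA -/B ler_pdivrMr ?ltr0n // mulrC -ler_pdivrMr; last lra.
  apply: ltW; apply: lt_le_trans (archi_boundP _) _; last by rewrite ler_nat.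
  by apply: divr_ge0 => //; lra.
pose Mx := \max_(m <- s) `|m|%N.
exists (maxn (maxn D Mx) (Num.bound d0^-1)) => M.
rewrite !geq_max => /andP[/andP[MD MM] Md]; set N := (M + M).+1.
have N0 : (0 < N)%N by [].
have MN : (M <= N)%N by rewrite /N leqW // leq_addr.
have Nd : N%:R^-1 <= d0.
  rewrite invf_ple ?posrE ?ltr0n //; apply: ltW.
  apply: lt_le_trans (archi_boundP _) _; first by rewrite invr_ge0 ltW.
  by rewrite ler_nat (leq_trans Md).
rewrite -(dft_sum (lam * v) M hr) -/N.
pose t := symrange M; have ut := symrange_uniq M.
have st : {subset s <= t}.
  move=> j js; rewrite mem_symrange; apply: leq_trans MM.
  by rewrite /Mx (big_rem j) //= leq_maxl.
have -> : \sum_(k <- iota 0 N) dft N lam (lam * v) (k%:Z - M%:Z) = \sum_(m <- t) dft N lam (lam * v) m.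
  by rewrite /t big_map.
rewrite (sum_uniq_split _ us ut st).
set S1 := \sum_(m <- s) _; set S2 := \sum_(m <- [seq _ <- _ | _]) _; set y := gsum N 1 0.
(* Three errors of e/3 each: the Riemann sums on the finite set [s], the remaining frequencies
   through the uniform majorant [b], and the tail of the dual series. *)
have -> : S1 + S2 - lam^-1 * y * csum (psi lam v) =
   \sum_(m <- s) psi lam v m * (gsum N lam (lam * v + 'i * m%:~R / lam) - lam^-1 * y) + S2
   - lam^-1 * y * (csum (psi lam v) - \sum_(m <- s) psi lam v m).
  have -> : S1 = \sum_(m <- s) psi lam v m * gsum N lam (lam * v + 'i * m%:~R / lam).
    by apply: eq_bigr => m _; rewrite dft_gauss.
  under [X in _ = X + _ - _]eq_bigr do rewrite mulrBr.
  rewrite sumrB -mulr_suml; ring.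
have r1 : cn (\sum_(m <- s) psi lam v m * (gsum N lam (lam * v + 'i * m%:~R / lam) - lam^-1 * y)) <= e / 3.
  by apply: le_trans (cn_sum _ _ _) _; apply: hD => //; exact: leq_trans MN.
have r2 : cn S2 <= e / 3.
  apply: le_trans (cn_sum _ _ _) _; apply: le_trans (tb _ (filter_uniq _ ut)).
  rewrite big_seq [X in _ <= X]big_seq; apply: ler_sum => m; rewrite mem_filter => /andP[ms mt].
  rewrite (negbTE ms) /b cn_real; apply: le_trans (ler_norm _); apply: hK => //.
  by move: mt; rewrite mem_symrange /N mul2n -addnn => mM; rewrite leqW // leq_add.
have r3 : cn (lam^-1 * y * (csum (psi lam v) - \sum_(m <- s) psi lam v m)) <= e / 3.
  rewrite cnM [cn (lam^-1 * y)]cnM -/a; have yG : cn y <= G by exact: hG.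
  have aG : 0 <= a * G by rewrite mulr_ge0 // ltW.
  apply: le_trans (_ : (a * G) * (e / 3 / (a * G + 1)) <= _).
    apply: ler_pM => //; rewrite ?mulr_ge0 ?cn_ge0 //.
    by apply: ler_wpM2l.
  rewrite mulrA ler_pdivrMr; last lra.
  rewrite mulrC; apply: ler_wpM2l; lra.
apply: le_trans (cnB _ _) _; apply: le_trans (lerD (cnD _ _) (lexx _)) _.
by apply: le_trans (lerD (lerD r1 r2) r3) _; lra.
Qed.

(** At lam = 1 and v = 0 both sides of the approximate Poisson formula contain the same series T,
    which is nonzero because its terms are positive; T close to [gsum] times T then forces [gsum] to
    tend to 1. This replaces the evaluation of the Gaussian integral. *)
Lemma gsum1_cvg e : 0 < e -> exists M0, forall M, (M0 <= M)%N -> cn (gsum (M + M).+1 1 0 - 1) <= e.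
Proof.
move=> e0; have h1 : `|Im (1 : C)| < Re (1 : C) by rewrite /= normr0 ltr01.
pose T : C := csum (psi 1 0).
have TE : csum (fun j : int => gauss (1 * j%:~R + 1 * 0)) = T.
  by apply: eq_csum => j; rewrite /gauss /psi; congr cexp; field.
have T0 : 0 < cn T.
  have pE : psi 1 0 = (fun m => (expR (- pi * m%:~R ^+ 2))%:C).
    apply: funext => m; rewrite /psi -cexp_real; congr cexp.
    by rewrite !(rmorphM, rmorphN, rmorphXn, rmorph_int) /=; field.
  have s1 : summ (fun m : int => (expR (- pi * m%:~R ^+ 2))%:C : C).
    by rewrite -pE; exact: psi_summ.
  have := @csum_real_ge R _ (fun m : int => expR (- pi * m%:~R ^+ 2)) 0 (fun i => expR_ge0 _) s1.
  rewrite -pE -/T expr0n mulr0 expR0 => h; apply: lt_le_trans (abs_Re_le T).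
  by apply: lt_le_trans (ler_norm _); lra.
have [M0 h] := poisson1_approx 0 h1 (mulr_gt0 e0 T0).
exists M0 => M /h; rewrite TE invr1 mul1r.
rewrite -/T (_ : T - _ * T = - ((gsum (M + M).+1 1 0 - 1) * T)); last by ring.
by rewrite cnN cnM ler_pM2r.
Qed.

Lemma poisson1 lam v : `|Im lam| < Re lam ->
  csum (fun j : int => gauss (lam * (j%:~R + v))) = lam^-1 * csum (psi lam v).
Proof.
move=> hl.
rewrite (eq_csum (v := fun j : int => gauss (lam * j%:~R + lam * v))); last by move=> j; rewrite mulrDr.
apply/eqP; rewrite -subr_eq0; apply/eqP; apply: cn_small_eq0 => e e0.
have [M1 h1] := poisson1_approx v hl (ltac:(by lra) : 0 < e / 2).
set P := csum (psi lam v) in h1 *; pose b := cn (lam^-1 * P).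
have b0 : 0 <= b by exact: cn_ge0.
have ee0 : 0 < e / 2 / (b + 1) by apply: divr_gt0; lra.
have [M2 h2] := gsum1_cvg ee0.
have := h1 _ (leq_maxl M1 M2); have := h2 _ (leq_maxr M1 M2).
set y := gsum _ _ _; set X := csum _ => hy hX.
rewrite (_ : X - lam^-1 * P = (X - lam^-1 * y * P) + (y - 1) * (lam^-1 * P)); last by ring.
apply: le_trans (cnD _ _) _; rewrite [cn (_ * (lam^-1 * P))]cnM -/b.
suff : cn (y - 1) * b <= e / 2 by lra.
apply: le_trans (_ : e / 2 / (b + 1) * b <= _); first by apply: ler_wpM2r.
rewrite mulrAC ler_pdivrMr; last lra.
by apply: ler_wpM2l; lra.
Qed.

End PoissonOneDim3.

(** * Poisson summation for lattices *)

Section PoissonLattice.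
Variable R : realType.
Local Notation C := R[i].
Implicit Types (lam : C).

(** The parameter is a square root of the usual one, lam^2 = - i z, so that lam^-n involves no
    choice of branch. *)
Definition th lam (r : R) : C := cexp (- pi%:C * lam ^+ 2 * r%:C).

Lemma cn_th lam r : cn (th lam r) = expR (- (pi * Re (lam ^+ 2)) * r).
Proof.
rewrite /th cn_cexp; congr expR; case: (lam ^+ 2) => a b.
by rewrite !(cReM, cReN, cImM, cImN) /=; ring.
Qed.

Lemma thD lam r s : th lam (r + s) = th lam r * th lam s.
Proof. by rewrite /th -cexpD; congr cexp; rewrite rmorphD /=; ring. Qed.

(** These are the square roots with positive real part of the numbers with positive real part. *)
Definition half lam := `|Im lam| < Re lam.

Lemma half_neq0 lam : half lam -> lam != 0.
Proof. by move=> h; apply/eqP => e; move: h; rewrite /half e /= normr0 ltxx. Qed.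

Lemma halfV lam : half lam -> half lam^-1.
Proof.
case: lam => a b; rewrite /half /= => h.
have n0 : 0 < a ^+ 2 + b ^+ 2.
  have a0 : 0 < a by apply: le_lt_trans h.
  by apply: ltr_pwDl; rewrite ?exprn_gt0 ?sqr_ge0.
by rewrite normrN normrM normfV (gtr0_norm n0) ltr_pM2r ?invr_gt0.
Qed.

Lemma half_scale lam (a : R) : 0 < a -> half lam -> half (lam * a%:C).
Proof.
case: lam => x y a0; rewrite /half /= !mulr0 subr0 add0r normrM (gtr0_norm a0) => h.
by rewrite ltr_pM2r.
Qed.

(** The scale a goes into L = lam sqrt a, and the character exp (2 pi i k m) into a complex shift v
    together with a constant factor, which reduces the identity to [poisson1]. *)
Lemma poisson1m lam (a s m : R) : half lam -> 0 < a ->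
  csum (fun k : int => th lam (a * (k%:~R + s) ^+ 2) * ce (k%:~R * m)) =
  lam^-1 * ((Num.sqrt a)^-1)%:C *
  csum (fun l : int => th lam^-1 ((l%:~R - m) ^+ 2 / a) * ce ((l%:~R - m) * s)).
Proof.
move=> hl a0; pose r := Num.sqrt a; have r0 : 0 < r by rewrite sqrtr_gt0.
have ra : a = r ^+ 2 by rewrite sqr_sqrtr // ltW.
pose L := lam * r%:C; have hL : half L by exact: half_scale.
have l0 := half_neq0 hl; have rc0 : r%:C != 0 :> C by rewrite -cn_eq0 cn_real normr_eq0 gt_eqF.
have i2 : 'i ^+ 2 = -1 :> C by exact: sqr_i.
pose v := s%:C - 'i * m%:C / L ^+ 2.
pose K := cexp (- pi%:C * m%:C ^+ 2 / L ^+ 2 - 2 * pi%:C * 'i * s%:C * m%:C).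
have hL0 : L != 0 by rewrite mulf_neq0.
have e1 k : th lam (a * (k%:~R + s) ^+ 2) * ce (k%:~R * m) = K * gauss (L * (k%:~R + v)).
  rewrite /th /ce /K /gauss -!cexpD; congr cexp; rewrite /v /L intC ra.
  rewrite !(rmorphM, rmorphD, rmorphXn, rmorph_int, rmorph_nat) /=.
  by field: i2; rewrite l0 rc0.
have e2 l : th lam^-1 ((l%:~R - m) ^+ 2 / a) * ce ((l%:~R - m) * s) = K * psi L v l.
  rewrite /th /ce /K /psi -!cexpD; congr cexp; rewrite /v /L intC ra.
  rewrite !(rmorphM, rmorphD, rmorphB, rmorphXn, rmorph_int, rmorph_nat, fmorphV) /=.
  by field: i2; rewrite l0 rc0.
have sg : summ (fun k : int => gauss (L * (k%:~R + v))).
  have := gauss_summ1 (L * v) (Re_sqr_gt0 hL); congr summ.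
  by apply: funext => k; congr gauss; ring.
rewrite (eq_csum e1) (eq_csum e2) !csumZ //; last exact: psi_summ.
by rewrite poisson1 // -/r /L invfM fmorphV /=; ring.
Qed.

(** Relates a positive definite form and its inverse form by successive completion of squares. Each
    constructor strips one variable from both forms at once, in the shape on which one-dimensional
    Poisson summation acts. *)
Inductive dual_forms : forall n : nat, ('rV[R]_n -> R) -> ('rV[R]_n -> R) -> Prop :=
| DF0 (q q' : 'rV[R]_0 -> R) : (forall x, q x = 0) -> (forall x, q' x = 0) ->
    dual_forms q q'
| DFS n (q q' : 'rV[R]_n -> R) (a : R) (rho : 'rV[R]_n) (Q Q' : 'rV[R]_(1 + n) -> R) :
    0 < a -> dual_forms q q' ->
    (forall (x : R) (y : 'rV_n), Q (row_mx x%:M y) = a * (x + dotv rho y) ^+ 2 + q y) ->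
    (forall (x : R) (y : 'rV_n), Q' (row_mx x%:M y) = x ^+ 2 / a + q' (y - x *: rho)) ->
    dual_forms Q Q'.

Definition zr n (z : 'rV[int]_n) : 'rV[R]_n := map_mx (fun a : int => a%:~R) z.

Lemma zr_row n (k : int) (z : 'rV[int]_n) :
  zr (row_mx k%:M z : 'rV_(1 + n)) = row_mx (k%:~R)%:M (zr z).
Proof. by rewrite /zr map_row_mx; congr row_mx; apply/matrixP => i j; rewrite !mxE rmorphMn. Qed.

Lemma rV_split (T : pzRingType) n (x : 'rV[T]_(1 + n)) : x = row_mx (x 0 0)%:M (rsubmx x).
Proof.
rewrite -{1}[x]hsubmxK; congr row_mx; apply/matrixP => i j; rewrite !mxE !ord1 eqxx mulr1n.
by congr (x _ _); apply: val_inj.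
Qed.

Lemma dotv_row n (a b : R) (x y : 'rV[R]_n) :
  dotv (row_mx a%:M x : 'rV_(1 + n)) (row_mx b%:M y) = a * b + dotv x y.
Proof.
rewrite /dotv big_split_ord /= big_ord1 !row_mxEl !mxE eqxx !mulr1n; congr (_ + _).
by apply: eq_bigr => i _; rewrite !row_mxEr.
Qed.

Lemma row_scalarD n (a b : R) (x y : 'rV[R]_n) :
  row_mx a%:M x + row_mx b%:M y = row_mx (a + b)%:M (x + y) :> 'rV_(1 + n).
Proof. by rewrite add_row_mx raddfD. Qed.

Lemma row_scalarB n (a b : R) (x y : 'rV[R]_n) :
  row_mx a%:M x - row_mx b%:M y = row_mx (a - b)%:M (x - y) :> 'rV_(1 + n).
Proof. by rewrite opp_row_mx add_row_mx raddfB. Qed.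

Lemma dotvDl n (x y z : 'rV[R]_n) : dotv (x + y) z = dotv x z + dotv y z.
Proof. by rewrite /dotv -big_split; apply: eq_bigr => i _; rewrite !mxE mulrDl. Qed.

Lemma dotvC n (x y : 'rV[R]_n) : dotv x y = dotv y x.
Proof. by rewrite /dotv; apply: eq_bigr => i _; rewrite mulrC. Qed.

Lemma dotvDr n (x y z : 'rV[R]_n) : dotv x (y + z) = dotv x y + dotv x z.
Proof. by rewrite dotvC dotvDl !(dotvC x). Qed.

Lemma dotvZl n c (x y : 'rV[R]_n) : dotv (c *: x) y = c * dotv x y.
Proof. by rewrite /dotv mulr_sumr; apply: eq_bigr => i _; rewrite !mxE mulrA. Qed.

Lemma dotvZr n c (x y : 'rV[R]_n) : dotv x (c *: y) = c * dotv x y.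
Proof. by rewrite dotvC dotvZl dotvC. Qed.

Lemma dotvNl n (x y : 'rV[R]_n) : dotv (- x) y = - dotv x y.
Proof. by rewrite -scaleN1r dotvZl mulN1r. Qed.

Lemma dotvNr n (x y : 'rV[R]_n) : dotv x (- y) = - dotv x y.
Proof. by rewrite dotvC dotvNl dotvC. Qed.

Lemma rbound_gauss1 (c : R) : 0 < c -> exists2 B : R, 0 <= B &
  forall s : R, rbound (fun k : int => expR (- c * (k%:~R + s) ^+ 2)) B.
Proof.
move=> c0; exists (16 * (1 + c^-1)) => [|s].
  by rewrite mulr_ge0 // addr_ge0 // invr_ge0 ltW.
have h01 : 0 < (1 : R) <= 1 by rewrite ltr01 lexx.
have h := rbound_lorentz s h01.
move=> t ut; apply: le_trans (_ : \sum_(k <- t) (1 + c^-1) * (1 / (1 + (k%:~R * 1 + s) ^+ 2)) <= _).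
  apply: ler_sum => k _; rewrite mulr1; set x := (_ + s) ^+ 2.
  have x0 : 0 <= x by exact: sqr_ge0.
  rewrite mul1r ler_pdivlMr; last lra.
  rewrite mulNr expRN -ler_pdivlMl ?invr_gt0 ?expR_gt0 // invrK.
  have := expR_ge1Dx (c * x); have := expR_gt0 (c * x).
  have ci : 0 < c^-1 by rewrite invr_gt0.
  have cc : c^-1 * c = 1 by rewrite mulVf // gt_eqF.
  move=> e0 e1; apply: le_trans (_ : (1 + c * x) * (1 + c^-1) <= _).
    rewrite (_ : (1 + c * x) * (1 + c^-1) = 1 + c^-1 + c * x + c^-1 * c * x); last by ring.
    by rewrite cc; have := mulr_ge0 (ltW c0) x0; lra.
  by apply: ler_wpM2r => //; lra.
by rewrite -mulr_sumr mulrC ler_wpM2r ?h // addr_ge0 // invr_ge0 ltW.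
Qed.

Definition zpair n (p : 'rV[int]_n * int) : 'rV[int]_(1 + n) := row_mx p.2%:M p.1.
Definition zunpair n (z : 'rV[int]_(1 + n)) : 'rV[int]_n * int := (rsubmx z, z 0 0).

Lemma zpairK n : cancel (@zpair n) (@zunpair n).
Proof.
move=> [z k]; rewrite /zpair /zunpair row_mxKr; congr pair.
rewrite (_ : 0 = lshift n (0 : 'I_1)); last by apply: val_inj.
by rewrite row_mxEl mxE eqxx mulr1n.
Qed.

Lemma zunpairK n : cancel (@zunpair n) (@zpair n).
Proof. by move=> z; rewrite /zpair /zunpair -rV_split. Qed.

Lemma rbound_reindex (I J : eqType) (f : I -> J) (g : J -> I) (b : J -> R) B :
  cancel f g -> cancel g f -> rbound (b \o f) B -> rbound b B.
Proof.
move=> fg gf h s us; have := h (map g s); rewrite big_map map_inj_uniq ?us; last exact: can_inj gf.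
by move=> /(_ isT); under eq_bigr do rewrite /= gf.
Qed.

(** Uniformity in the shift carries the induction, since fixing some coordinates shifts the others.
    The dual form is summed in the opposite order, because there the shift of the remaining
    variables depends on the first one. *)
Lemma rbound_forms n (q q' : 'rV[R]_n -> R) (c : R) : dual_forms q q' -> 0 < c ->
  (exists2 B : R, 0 <= B & forall v, rbound (fun z : 'rV[int]_n => expR (- c * q (zr z + v))) B) /\
  (exists2 B : R, 0 <= B & forall v, rbound (fun z : 'rV[int]_n => expR (- c * q' (zr z + v))) B).
Proof.
move=> + c0; elim=> {n q q'} [q q' hq hq'|n q q' a rho Q Q' a0 df [[B1 B10 h1] [B2 B20 h2]] hQ hQ'].
  have one (s : seq 'rV[int]_0) : uniq s -> \sum_(z <- s) (1 : R) <= 1 :> R.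
    move=> us; rewrite big_const_seq count_predT iter_addr_0.
    apply: (@le_trans _ _ (1 *+ 1)) => //; apply: ler_wpMn2l => //.
    have : (size s <= size [:: (0%R : 'rV[int]_0)])%N.
      by apply: uniq_leq_size => // x _; rewrite inE; apply/eqP/matrixP => i [].
    by [].
  by split; exists 1 => // v s us; under eq_bigr do rewrite ?hq ?hq' mulr0 expR0; exact: one.
have ca : 0 < c * a by exact: mulr_gt0.
have ca' : 0 < c / a by exact: divr_gt0.
have [A1 A10 g1] := rbound_gauss1 ca; have [A2 A20 g2] := rbound_gauss1 ca'.
split.
  exists (A1 * B1) => [|v]; first exact: mulr_ge0.
  apply: (rbound_reindex (@zpairK n) (@zunpairK n)).
  apply: (@rbound2 R _ _ (fun z => A1 * expR (- c * q (zr z + rsubmx v)))) => [p|z s us|s us].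
  - exact: expR_ge0.
  - rewrite /= mulrC; rewrite (eq_bigr (fun k : int => expR (- c * q (zr z + rsubmx v)) *
       expR (- (c * a) * (k%:~R + (v 0 0 + dotv rho (zr z + rsubmx v))) ^+ 2))).
      by rewrite -mulr_sumr ler_wpM2l ?expR_ge0 // g1.
    move=> k _; rewrite -expRD; congr expR; rewrite /zpair /= zr_row {1}(rV_split v) row_scalarD.
    by rewrite hQ; ring.
  - by rewrite -mulr_sumr ler_wpM2l // h1.
exists (B2 * A2) => [|v]; first exact: mulr_ge0.
pose sw (p : int * 'rV[int]_n) := (p.2, p.1); pose sw' (p : 'rV[int]_n * int) := (p.2, p.1).
apply: (rbound_reindex (@zpairK n) (@zunpairK n)).
apply: (@rbound_reindex _ _ sw sw'); try by case.
apply: (@rbound2 R _ _ (fun k : int => B2 * expR (- (c / a) * (k%:~R + v 0 0) ^+ 2))) => [p|k s us|s us].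
- exact: expR_ge0.
- rewrite mulrC; rewrite (eq_bigr (fun z => expR (- (c / a) * (k%:~R + v 0 0) ^+ 2) *
       expR (- c * q' (zr z + (rsubmx v - (k%:~R + v 0 0) *: rho))))).
    by rewrite -mulr_sumr ler_wpM2l ?expR_ge0 // h2.
  move=> z _; rewrite -expRD; congr expR; rewrite /zpair /= zr_row {1}(rV_split v) row_scalarD.
  by rewrite hQ' addrA; ring.
- by rewrite -mulr_sumr ler_wpM2l // g2.
Qed.

Lemma summ_forms n (q q' : 'rV[R]_n -> R) lam v (e : 'rV[int]_n -> R) : dual_forms q q' -> half lam ->
  summ (fun z => th lam (q (zr z + v)) * ce (e z)) /\
  summ (fun z => th lam (q' (zr z + v)) * ce (e z)).
Proof.
move=> df hl; have c0 : 0 < pi * Re (lam ^+ 2) by rewrite mulr_gt0 ?pi_gt0 ?Re_sqr_gt0.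
have [[B1 _ h1] [B2 _ h2]] := rbound_forms df c0; split.
  by apply: (summ_le (h1 v)) => z; rewrite cnM cn_ce mulr1 cn_th.
by apply: (summ_le (h2 v)) => z; rewrite cnM cn_ce mulr1 cn_th.
Qed.

(** Summation in the first coordinate turns the shift by rho . (z + v') into a character of the
    other coordinates, replacing mu' by mu' + (l - m) rho; the induction hypothesis then produces
    the term q' (y - x rho) of the dual form. This is why the statement carries an arbitrary
    character mu. *)
Lemma poisson_forms n (q q' : 'rV[R]_n -> R) : dual_forms q q' ->
  exists K : R, forall lam v mu, half lam ->
  csum (fun z : 'rV[int]_n => th lam (q (zr z + v)) * ce (dotv (zr z) mu)) =
  lam^-1 ^+ n * K%:C *
  csum (fun w : 'rV[int]_n => th lam^-1 (q' (zr w - mu)) * ce (dotv (zr w - mu) v)).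
Proof.
elim=> {n q q'} [q q' hq hq'|n q q' a rho Q Q' a0 df [K IH] hQ hQ'].
  exists 1 => lam v mu hl; rewrite expr0 !mul1r; apply: eq_csum => z.
  by rewrite hq hq' /th !mulr0 /dotv !big_ord0.
have dfQ : dual_forms Q Q' by exact: (DFS a0 df hQ hQ').
exists ((Num.sqrt a)^-1 * K) => lam v mu hl; have hli := halfV hl.
set x := v 0 0; set v' := rsubmx v; set m := mu 0 0; set mu' := rsubmx mu.
have ve : v = row_mx x%:M v' by exact: rV_split.
have mue : mu = row_mx m%:M mu' by exact: rV_split.
pose U (p : 'rV[int]_n * int) := th lam (q (zr p.1 + v')) * ce (dotv (zr p.1) mu') *
  (th lam (a * (p.2%:~R + (x + dotv rho (zr p.1 + v'))) ^+ 2) * ce (p.2%:~R * m)).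
have [E1 E2] := @csum_reindex R _ _ (@zpair n) (@zunpair n)
  (fun z => th lam (Q (zr z + v)) * ce (dotv (zr z) mu)) (@zpairK n) (@zunpairK n).
have sL := (summ_forms v (fun z => dotv (zr z) mu) dfQ hl).1.
have UE : ((fun z => th lam (Q (zr z + v)) * ce (dotv (zr z) mu)) \o @zpair n) = U.
  apply: funext => -[z k] /=; rewrite /zpair /U /= zr_row ve mue row_scalarD hQ dotv_row.
  rewrite thD ceD addrA; ring.
have sU : summ U by rewrite -UE; apply/E1.
rewrite E2 // UE; have [_ ->] := fubini sU.
pose W (z : 'rV[int]_n) (l : int) := th lam (q (zr z + v')) * ce (dotv (zr z) mu') *
  (th lam^-1 ((l%:~R - m) ^+ 2 / a) * ce ((l%:~R - m) * (x + dotv rho (zr z + v')))).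
have S1 : summ (fun z : 'rV[int]_n => th lam (q (zr z + v')) * ce (dotv (zr z) mu')).
  exact: (summ_forms v' (fun z => dotv (zr z) mu') df hl).1.
have S2 s : summ (fun l : int => th lam^-1 ((l%:~R - m) ^+ 2 / a) * ce ((l%:~R - m) * s)).
  have ca : 0 < pi * Re (lam^-1 ^+ 2) / a by rewrite divr_gt0 // mulr_gt0 ?pi_gt0 ?Re_sqr_gt0.
  have [B _ hB] := rbound_gauss1 ca; apply: (summ_le (hB (- m))) => l.
  by rewrite cnM cn_ce mulr1 cn_th le_eqVlt; apply/orP; left; apply/eqP; congr expR; ring.
have S3 s : summ (fun k : int => th lam (a * (k%:~R + s) ^+ 2) * ce (k%:~R * m)).
  have ca : 0 < pi * Re (lam ^+ 2) * a by rewrite mulr_gt0 // mulr_gt0 ?pi_gt0 ?Re_sqr_gt0.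
  have [B _ hB] := rbound_gauss1 ca; apply: (summ_le (hB s)) => k.
  by rewrite cnM cn_ce mulr1 cn_th le_eqVlt; apply/orP; left; apply/eqP; congr expR; ring.
have sW : summ (fun p : 'rV[int]_n * int => W p.1 p.2).
  have [h _] := csum_mul S1 (S2 0); apply: (summ_dom h) => -[z l] /=.
  by rewrite /W !cnM !cn_ce.
transitivity (csum (fun z => lam^-1 * ((Num.sqrt a)^-1)%:C * csum (W z))).
  apply: eq_csum => z; rewrite /U /= csumZ // poisson1m // /W csumZ //; ring.
have [sW1 _] := fubini sW.
rewrite csumZ // (csum_swap sW).
pose V (p : 'rV[int]_n * int) := th lam^-1 (q' (zr p.1 - (mu' + (p.2%:~R - m) *: rho))) *
  ce (dotv (zr p.1 - (mu' + (p.2%:~R - m) *: rho)) v') *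
  (th lam^-1 ((p.2%:~R - m) ^+ 2 / a) * ce ((p.2%:~R - m) * (x + dotv rho v'))).
have step l : csum (fun z => W z l) = lam^-1 ^+ n * K%:C * csum (fun w => V (w, l)).
  pose c := th lam^-1 ((l%:~R - m) ^+ 2 / a) * ce ((l%:~R - m) * (x + dotv rho v')).
  transitivity (c * csum (fun z : 'rV[int]_n => th lam (q (zr z + v')) *
      ce (dotv (zr z) (mu' + (l%:~R - m) *: rho)))).
    rewrite -csumZ; last exact: (summ_forms v' (fun z => dotv (zr z) (mu' + (l%:~R - m) *: rho)) df hl).1.
    apply: eq_csum => z; rewrite /W /c !dotvDr dotvZr (dotvC (zr z) rho).
    rewrite (_ : (l%:~R - m) * (x + (dotv rho (zr z) + dotv rho v')) =
      (l%:~R - m) * (x + dotv rho v') + (l%:~R - m) * dotv rho (zr z)); last by ring.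
    by rewrite !ceD; ring.
  rewrite IH // mulrCA -csumZ; last first.
    have := (summ_forms (- (mu' + (l%:~R - m) *: rho))
      (fun w => dotv (zr w - (mu' + (l%:~R - m) *: rho)) v') df hli).2.
    by [].
  by congr (_ * _); apply: eq_csum => w; rewrite /V /c /= mulrC.
have [F1 F2] := @csum_reindex R _ _ (@zpair n) (@zunpair n)
  (fun w => th lam^-1 (Q' (zr w - mu)) * ce (dotv (zr w - mu) v)) (@zpairK n) (@zunpairK n).
have sR := (summ_forms (- mu) (fun w => dotv (zr w - mu) v) dfQ hli).2.
have VE : ((fun w => th lam^-1 (Q' (zr w - mu)) * ce (dotv (zr w - mu) v)) \o @zpair n) = V.
  apply: funext => -[w l] /=; rewrite /zpair /V /= zr_row ve mue row_scalarB.
  rewrite hQ' dotv_row thD opprD addrA.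
  rewrite !dotvDl !dotvNl dotvZl.
  rewrite (_ : (l%:~R - m) * (x + dotv rho v') = (l%:~R - m) * x + (l%:~R - m) * dotv rho v'); last by ring.
  rewrite !ceD (ceN ((l%:~R - m) * _)).
  have := cn_ce ((l%:~R - m) * dotv rho v'); set c := ce _ => hc.
  have c0 : c != 0 by rewrite -cn_eq0 hc oner_eq0.
  by field.
have sV : summ V by rewrite -VE; apply/F1.
rewrite F2 // VE.
have [G1 G2] := @csum_reindex R _ _ (fun p : int * 'rV[int]_n => (p.2, p.1)) (fun p => (p.2, p.1)) V
  (fun p => ltac:(by case: p)) (fun p => ltac:(by case: p)).
rewrite G2 //; have [_ ->] := fubini (G1.1 sV).
have [sV1 _] := fubini (G1.1 sV).
rewrite (eq_csum step) csumZ; last exact: sV1.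
by rewrite exprS rmorphM /=; ring.
Qed.

End PoissonLattice.

(** * Gram matrices and dual bases *)

Section GramForms.
Variable R : realType.
Local Notation C := R[i].

Definition nrm n (x : 'rV[R]_n) : R := dotv x x.

Lemma nrm_ge0 n (x : 'rV[R]_n) : 0 <= nrm x.
Proof. by apply: sumr_ge0 => i _; rewrite -expr2 sqr_ge0. Qed.

Lemma sqr_le_nrm n (x : 'rV[R]_n) i : x 0 i ^+ 2 <= nrm x.
Proof.
rewrite /nrm /dotv (bigD1 i) //= expr2 lerDl.
by apply: sumr_ge0 => k _; rewrite -expr2 sqr_ge0.
Qed.

Lemma nrm_eq0 n (x : 'rV[R]_n) : nrm x = 0 -> x = 0.
Proof.
move=> h; apply/rowP => i; rewrite mxE; apply/eqP; rewrite -sqrf_eq0 eq_le sqr_ge0 andbT.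
by rewrite -h sqr_le_nrm.
Qed.

Lemma dotvE n (x y : 'rV[R]_n) : dotv x y = (x *m y^T) 0 0.
Proof. by rewrite mxE; apply: eq_bigr => i _; rewrite mxE. Qed.

Lemma dotv_mulmx n m (x : 'rV[R]_n) (A : 'M[R]_(n, m)) (y : 'rV[R]_m) :
  dotv (x *m A) y = dotv x (y *m A^T).
Proof. by rewrite !dotvE trmx_mul trmxK mulmxA. Qed.

Lemma posdef_unit n (A : 'M[R]_n) :
  (forall x : 'rV_n, x != 0 -> 0 < dotv (x *m A) x) -> A \in unitmx.
Proof.
move=> h; rewrite -row_free_unit -kermx_eq0; apply/eqP/row_matrixP => i; rewrite row0.
apply/eqP; apply: contraT => /h.
have -> : row i (kermx A) *m A = 0 by rewrite -row_mul mulmx_ker row0.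
by rewrite /dotv big1 ?ltxx // => k _; rewrite mxE mul0r.
Qed.

Lemma forms_posdef n (A : 'M[R]_n) : A^T = A ->
  (forall x : 'rV_n, x != 0 -> 0 < dotv (x *m A) x) ->
  dual_forms (fun x : 'rV_n => dotv (x *m A) x) (fun w : 'rV_n => dotv (w *m invmx A) w).
Proof.
elim: n A => [|n IH] A sA pA.
  by apply: DF0 => x; rewrite /dotv big_ord0.
rewrite -[n.+1]/(1 + n)%N in A sA pA *.
pose a := A 0 0; pose r : 'rV[R]_n := ursubmx A; pose A1 : 'M[R]_n := drsubmx A.
have Ae : A = block_mx a%:M r r^T A1.
  rewrite -[LHS]submxK; congr block_mx.
    apply/matrixP => i j; rewrite !mxE !ord1 mulr1n /a; congr (A _ _); exact: val_inj.
  by rewrite /r trmx_ursub sA.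
have sA1 : A1^T = A1 by rewrite /A1 trmx_drsub sA.
have mulA (u : R) (y : 'rV[R]_n) :
    row_mx u%:M y *m A = row_mx (u * a + dotv y r)%:M (u *: r + y *m A1) :> 'rV_(1 + n).
  rewrite Ae mul_row_block; congr row_mx; last by rewrite mul_scalar_mx.
  by apply/matrixP => i j; rewrite !ord1 dotvE !mxE !big_ord1 !mxE eqxx !mulr1n.
have formA (u : R) (y : 'rV[R]_n) : dotv (row_mx u%:M y *m A) (row_mx u%:M y) =
    u * u * a + 2 * (u * dotv r y) + dotv (y *m A1) y.
  by rewrite mulA dotv_row dotvDl dotvZl (dotvC y r); ring.
have a0 : 0 < a.
  have := pA (row_mx 1%:M 0); rewrite formA !mulr1 mul1r {1}mul0mx /dotv big1; last first.
    by move=> i _; rewrite !mxE mulr0.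
  rewrite big1 ?mulr0 ?addr0; last by move=> i _; rewrite !mxE mul0r.
  apply; apply/eqP => /(congr1 (fun M : 'rV_(1 + n) => M 0 (lshift n 0))).
  by rewrite row_mxEl !mxE eqxx => /eqP; rewrite oner_eq0.
pose rho := a^-1 *: r; pose A2 := A1 - a^-1 *: (r^T *m r).
have an0 : a != 0 by rewrite gt_eqF.
have rr (y : 'rV[R]_n) : y *m (r^T *m r) = dotv y r *: r.
  by rewrite mulmxA [y *m r^T]mx11_scalar mul_scalar_mx -dotvE.
have mulA2 (y : 'rV[R]_n) : y *m A2 = y *m A1 - dotv y rho *: r.
  by rewrite /A2 mulmxBr -scalemxAr rr /rho dotvZr scalerA.
have formE (u : R) (y : 'rV[R]_n) : dotv (row_mx u%:M y *m A) (row_mx u%:M y) =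
    a * (u + dotv rho y) ^+ 2 + dotv (y *m A2) y.
  rewrite formA mulA2 dotvDl dotvNl dotvZl /rho dotvZr !dotvZl (dotvC y r).
  by field.
have sA2 : A2^T = A2 by rewrite /A2 linearB linearZ /= trmx_mul trmxK sA1.
have pA2 (y : 'rV[R]_n) : y != 0 -> 0 < dotv (y *m A2) y.
  (* With first coordinate - rho . y the completed square vanishes, so A2 inherits positivity from
     A. *)
  move=> y0; have := formE (- dotv rho y) y; rewrite addNr expr0n /= mulr0 add0r => <-.
  apply: pA; apply: contra y0 => /eqP h; apply/eqP/rowP => i.
  by have := congr1 (fun M : 'rV_(1 + n) => M 0 (rshift 1 i)) h; rewrite row_mxEr !mxE.
have uA := posdef_unit pA; have uA2 := posdef_unit pA2.
apply: (DFS a0 (IH A2 sA2 pA2) (rho := rho)) => x y; first exact: formE.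
pose u2 := (y - x *: rho) *m invmx A2; pose u0 := x / a - dotv rho u2.
have sol : row_mx u0%:M u2 *m A = row_mx x%:M y :> 'rV_(1 + n).
  have h2 : u2 *m A2 = y - x *: rho by rewrite mulmxKV.
  have h1 : u2 *m A1 = y - x *: rho + dotv u2 rho *: r by rewrite -h2 mulA2 subrK.
  rewrite mulA h1 /u0; congr row_mx.
    by congr (_%:M); rewrite /rho dotvZl (dotvC u2); field.
  rewrite scalerBl /rho !dotvZl !dotvZr scalerA (dotvC u2).
  by rewrite -[x / a]/(x * a^-1) addrC addrA addrAC; apply/rowP => i; rewrite !mxE; ring.
rewrite -{1}sol mulmxK // dotv_row /u0 -/u2 !dotvDr dotvNr dotvZr (dotvC rho).
by ring.
Qed.

(** The inverse of the Gram matrix of B is the Gram matrix of the dual basis. The constant K, which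
    is the inverse covolume, is left unspecified here. *)
Lemma poisson_lattice n (B : 'M[R]_n) : B \in unitmx -> exists K : R,
  forall lam (u : 'rV[R]_n), half lam ->
  csum (fun z : 'rV[int]_n => th lam (nrm (zr R z *m B + u))) =
  lam^-1 ^+ n * K%:C *
  csum (fun w : 'rV[int]_n => th lam^-1 (nrm (zr R w *m (invmx B)^T)) *
     ce (dotv (zr R w *m (invmx B)^T) u)).
Proof.
move=> uB; pose A := B *m B^T.
have sA : A^T = A by rewrite /A trmx_mul trmxK.
have formA (x : 'rV[R]_n) : dotv (x *m A) x = nrm (x *m B).
  by rewrite /A mulmxA dotv_mulmx trmxK.
have uBT : B^T \in unitmx by rewrite unitmx_tr.
have pA (x : 'rV[R]_n) : x != 0 -> 0 < dotv (x *m A) x.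
  move=> x0; rewrite formA lt0r nrm_ge0 andbT; apply: contra x0 => /eqP /nrm_eq0 h.
  by rewrite -[x](mulmxK uB) h mul0mx.
have [K hK] := poisson_forms (forms_posdef sA pA).
have iA : invmx A = (invmx B)^T *m invmx B.
  have uA := posdef_unit pA.
  apply: (can_inj (mulmxK uA)); rewrite mulVmx // /A mulmxA -(mulmxA _ _ B) mulVmx // mulmx1.
  by rewrite -trmx_mul mulmxV // trmx1.
exists K => lam u hl; have := hK lam (u *m invmx B) 0 hl.
rewrite (eq_csum (v := fun z => th lam (nrm (zr R z *m B + u)))); last first.
  move=> z; rewrite formA mulmxDl mulmxKV // (_ : dotv (zr R z) 0 = 0) ?ce0 ?mulr1 //.
  by rewrite /dotv big1 // => i _; rewrite [X in _ * X]mxE mulr0.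
move=> ->; congr (_ * _); apply: eq_csum => w; rewrite subr0 iA.
by rewrite mulmxA dotv_mulmx; congr (_ * ce _); rewrite dotv_mulmx trmxK.
Qed.

Lemma rbound_lattice n (B : 'M[R]_n) (c : R) : B \in unitmx -> 0 < c ->
  exists2 M : R, 0 <= M & forall u : 'rV[R]_n,
    rbound (fun z : 'rV[int]_n => expR (- c * nrm (zr R z *m B + u))) M.
Proof.
move=> uB c0; pose A := B *m B^T.
have sA : A^T = A by rewrite /A trmx_mul trmxK.
have formA (x : 'rV[R]_n) : dotv (x *m A) x = nrm (x *m B).
  by rewrite /A mulmxA dotv_mulmx trmxK.
have pA (x : 'rV[R]_n) : x != 0 -> 0 < dotv (x *m A) x.
  move=> x0; rewrite formA lt0r nrm_ge0 andbT; apply: contra x0 => /eqP /nrm_eq0 h.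
  by rewrite -[x](mulmxK uB) h mul0mx.
have [[M M0 h] _] := rbound_forms (forms_posdef sA pA) c0.
exists M => // u s us; have := h (u *m invmx B) s us.
by under eq_bigr do rewrite formA mulmxDl mulmxKV //.
Qed.

End GramForms.

(** * Homogeneous and harmonic polynomials *)

Section HomogeneousPolynomials.
Variables (R : realType) (n : nat).
Implicit Types (P Q : {mpoly R[n]}) (x : 'rV[R]_n).
Local Open Scope nat_scope.
Local Open Scope ring_scope.

Lemma mderiv_mpolyE i P :
  mderiv i P = \sum_(m <- msupp P) (P@_m * (m i)%:R) *: 'X_[m - U_(i)].
Proof.
rewrite {1}[P]mpolyE raddf_sum /=; apply: eq_bigr => m _.
by rewrite mderivZ mderivX scalerA.
Qed.

Lemma homog_mderiv i d P : P \is d.+1.-homog -> mderiv i P \is d.-homog.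
Proof.
move=> hP; rewrite mderiv_mpolyE big_seq; apply: rpred_sum => m ms.
have [m0|m0] := posnP (m i); first by rewrite m0 mulr0 scale0r dhomog0.
apply: dhomogZ; rewrite dhomogX; apply/eqP.
have := dhomog_mf hP ms => /=.
have -> : m = (m - U_(i) + U_(i))%MM by rewrite submK // lep1mP -lt0n.
rewrite mdegD mdeg1 addn1 => -[] <-; congr mdeg.
by rewrite addmK.
Qed.

Lemma euler_identity d P : P \is d.-homog -> \sum_(i < n) 'X_i * mderiv i P = d%:R *: P.
Proof.
move=> hP; rewrite [in RHS](mpolyE P) scaler_sumr.
under eq_bigr do rewrite mderiv_mpolyE mulr_sumr.
rewrite exchange_big /= !big_seq; apply: eq_bigr => m ms.
have <- : mdeg m = d by exact: (dhomog_mf hP ms).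
rewrite scalerA mulrC mdegE natr_sum mulr_sumr scaler_suml; apply: eq_bigr => i _.
rewrite -scalerAr; have [m0|m0] := posnP (m i); first by rewrite m0 mulr0 !scale0r.
by rewrite -mpolyXD addmC submK // lep1mP -lt0n.
Qed.

Lemma harmonic_mderiv i P : harmonic P -> harmonic (mderiv i P).
Proof.
rewrite /harmonic /laplacian => h.
rewrite (eq_bigr (fun k => mderiv i (mderiv k (mderiv k P)))); last first.
  by move=> k _; rewrite (mderiv_comm i k) (mderiv_comm i k).
by rewrite -raddf_sum /= h mderiv0.
Qed.

Lemma homog0_const P : P \is 0.-homog -> exists c, P = c%:MP.
Proof.
move=> hP; exists (\sum_(m <- msupp P) P@_m); rewrite raddf_sum {1}[P]mpolyE /= !big_seq.
apply: eq_bigr => m ms; have /eqP := dhomog_mf hP ms.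
by rewrite mdeg_eq0 => /eqP ->; rewrite mpolyX0 alg_mpolyC.
Qed.

Lemma evalvD P Q x : evalv (P + Q) x = evalv P x + evalv Q x.
Proof. by rewrite /evalv mevalD. Qed.

Lemma evalvM P Q x : evalv (P * Q) x = evalv P x * evalv Q x.
Proof. by rewrite /evalv mevalM. Qed.

Lemma evalvC c x : evalv (c%:MP : {mpoly R[n]}) x = c.
Proof. by rewrite /evalv mevalC. Qed.

Lemma evalvX i x : evalv ('X_i : {mpoly R[n]}) x = x 0 i.
Proof. by rewrite /evalv mevalXU. Qed.

Lemma evalvZ c P x : evalv (c *: P) x = c * evalv P x.
Proof. by rewrite /evalv mevalZ. Qed.

Lemma evalv_sum (I : Type) (s : seq I) (F : I -> {mpoly R[n]}) x :
  evalv (\sum_(i <- s) F i) x = \sum_(i <- s) evalv (F i) x.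
Proof. by rewrite /evalv raddf_sum. Qed.

Lemma euler_eval d P x : P \is d.-homog ->
  \sum_(i < n) x 0 i * evalv (mderiv i P) x = d%:R * evalv P x.
Proof.
move=> /euler_identity/(congr1 (fun Q => evalv Q x)); rewrite evalvZ => <-.
by rewrite evalv_sum; apply: eq_bigr => i _; rewrite evalvM evalvX.
Qed.

Lemma harmonic_eval P x : harmonic P -> \sum_(i < n) evalv (mderiv i (mderiv i P)) x = 0.
Proof.
by move=> /(congr1 (fun Q => evalv Q x)); rewrite /laplacian evalv_sum (_ : evalv 0 x = 0) // /evalv meval0.
Qed.

(** Serves growth and Taylor estimates, which are stable under sums and products and easy to check
    on constants and variables. *)
Lemma mpoly_alg_ind (T : {mpoly R[n]} -> Prop) : (forall c, T c%:MP) -> (forall i, T 'X_i) ->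
  (forall P Q, T P -> T Q -> T (P + Q)) -> (forall P Q, T P -> T Q -> T (P * Q)) -> forall P, T P.
Proof.
move=> hC hX hD hM P; rewrite [P]mpolyE.
have h1 : T 1 by rewrite -mpolyC1.
have hp i k : T ('X_i ^+ k) by elim: k => [|k IH]; rewrite ?expr0 // exprS; exact: hM.
elim/big_ind: _ => //; first by rewrite -mpolyC0.
move=> m _; rewrite -mul_mpolyC; apply: (hM) => //; rewrite mpolyXE_id.
by elim/big_ind: _.
Qed.

Lemma evalvN_homog d P x : P \is d.-homog -> evalv P (- x) = (-1) ^+ d * evalv P x.
Proof.
move=> hP; rewrite [P]mpolyE !evalv_sum mulr_sumr !big_seq; apply: eq_bigr => m ms.
have <- : mdeg m = d by exact: (dhomog_mf hP ms).
rewrite !evalvZ mulrCA; congr (_ * _); rewrite /evalv !mevalX mdegE.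
rewrite (eq_bigr (fun i => (-1) ^+ m i * x 0 i ^+ m i)); last first.
  by move=> i _; rewrite mxE -exprMn mulN1r.
by rewrite big_split /= prodrXr.
Qed.

End HomogeneousPolynomials.

(** * Theta series with harmonic coefficients *)

Section SecondOrder.
Variable R : realType.
Local Notation C := R[i].

(** One constant bounds the value, the derivative and the quadratic remainder together, so that the
    bound is stable under sums and products and can be summed over a lattice. *)
Definition taylor2 (f : R -> C) (f' : C) (b : R) :=
  [/\ cn (f 0) <= b, cn f' <= b &
      forall h, `|h| <= 1 -> cn (f h - f 0 - h%:C * f') <= h ^+ 2 * b].

Lemma expR_ge1 (x : R) : 0 <= x -> 1 <= expR x.
Proof. by move=> x0; rewrite -expR0 ler_expR. Qed.

Lemma taylor2_ge0 f f' b : taylor2 f f' b -> 0 <= b.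
Proof. by case=> h _ _; apply: le_trans h; exact: cn_ge0. Qed.

Lemma taylor2_le f f' b c : taylor2 f f' b -> b <= c -> taylor2 f f' c.
Proof.
case=> h1 h2 h3 bc; split; try exact: le_trans bc.
by move=> h /h3 H; apply: le_trans H _; rewrite ler_wpM2l ?sqr_ge0.
Qed.

Lemma taylor2D f f' b g g' c : taylor2 f f' b -> taylor2 g g' c ->
  taylor2 (fun h => f h + g h) (f' + g') (b + c).
Proof.
case=> h1 h2 h3 [k1 k2 k3]; split.
- exact: le_trans (cnD _ _) (lerD h1 k1).
- exact: le_trans (cnD _ _) (lerD h2 k2).
move=> h hh; rewrite (_ : _ - _ = (f h - f 0 - h%:C * f') + (g h - g 0 - h%:C * g')); last by ring.
by rewrite mulrDr; apply: le_trans (cnD _ _) (lerD (h3 h hh) (k3 h hh)).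
Qed.

Lemma taylor2M f f' b g g' c : taylor2 f f' b -> taylor2 g g' c ->
  taylor2 (fun h => f h * g h) (f' * g 0 + f 0 * g') (6 * (b * c)).
Proof.
move=> Tf Tg; have b0 := taylor2_ge0 Tf; have c0 := taylor2_ge0 Tg.
case: Tf => h1 h2 h3; case: Tg => k1 k2 k3.
have bc0 := mulr_ge0 b0 c0.
have M2 (x y : C) : cn x <= b -> cn y <= c -> cn (x * y) <= b * c.
  by move=> hx hy; rewrite cnM; apply: ler_pM; rewrite ?cn_ge0.
split.
- by apply: le_trans (M2 _ _ h1 k1) _; lra.
- by apply: le_trans (cnD _ _) _; have := M2 _ _ h2 k1; have := M2 _ _ h1 k2; lra.
move=> h hh; set r := f h - f 0 - h%:C * f'; set s := g h - g 0 - h%:C * g'.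
have hr : cn r <= h ^+ 2 * b by exact: h3.
have hs : cn s <= h ^+ 2 * c by exact: k3.
have h20 := sqr_ge0 h; have h21 : h ^+ 2 <= 1 by rewrite -real_normK ?num_real // exprn_ile1.
have -> : f h * g h - f 0 * g 0 - h%:C * (f' * g 0 + f 0 * g') =
   h%:C ^+ 2 * (f' * g') + f 0 * s + r * g 0 + h%:C * f' * s + h%:C * g' * r + r * s.
  have -> : f h = f 0 + h%:C * f' + r by rewrite /r; ring.
  have -> : g h = g 0 + h%:C * g' + s by rewrite /s; ring.
  by ring.
have ch : cn (h%:C : C) <= 1 by rewrite cn_real.
set X := h ^+ 2 * (b * c).
have t1 : cn (h%:C ^+ 2 * (f' * g')) <= X.
  rewrite cnM cnX cn_real real_normK ?num_real //; apply: ler_wpM2l => //; exact: M2.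
have t2 : cn (f 0 * s) <= X.
  rewrite cnM /X mulrCA; apply: ler_pM; rewrite ?cn_ge0 //.
have t3 : cn (r * g 0) <= X.
  rewrite cnM /X mulrA; apply: ler_pM; rewrite ?cn_ge0 //.
have t4 : cn (h%:C * f' * s) <= X.
  rewrite -mulrA cnM; apply: le_trans (_ : 1 * (b * (h ^+ 2 * c)) <= _); last by rewrite /X mul1r mulrCA.
  apply: ler_pM; rewrite ?cn_ge0 // cnM; apply: ler_pM; rewrite ?cn_ge0 //.
have t5 : cn (h%:C * g' * r) <= X.
  rewrite -mulrA cnM; apply: le_trans (_ : 1 * (c * (h ^+ 2 * b)) <= _); last first.
    by rewrite /X mul1r mulrCA (mulrC c).
  apply: ler_pM; rewrite ?cn_ge0 // cnM; apply: ler_pM; rewrite ?cn_ge0 //.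
have t6 : cn (r * s) <= X.
  rewrite cnM; apply: le_trans (_ : (h ^+ 2 * b) * (1 * c) <= _); last by rewrite /X mul1r mulrA.
  apply: ler_pM; rewrite ?cn_ge0 //; apply: le_trans hs _; exact: ler_wpM2r.
rewrite (_ : h ^+ 2 * (6 * (b * c)) = X + X + X + X + X + X); last by rewrite /X; ring.
do 5 (apply: le_trans (cnD _ _) _; apply: lerD => //).
Qed.

Lemma taylor2C c : taylor2 (fun=> c) 0 (cn c).
Proof.
split=> //; first by rewrite cn0 cn_ge0.
by move=> h _; rewrite subrr mulr0 subr0 cn0 mulr_ge0 ?sqr_ge0 ?cn_ge0.
Qed.

(** The summed quadratic remainders give |h| |F - k G| <= h^2 M for the two series F and G of
    derivatives; dividing by h and letting it tend to 0 identifies F with k G. *)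
Lemma csum_deriv (I J : eqType) (f : I -> R -> C) (f' : I -> C) (b : I -> R) (B : R)
  (g : J -> R -> C) (g' : J -> C) (c : J -> R) (D : R) (k : C) :
  (forall i, taylor2 (f i) (f' i) (b i)) -> rbound b B ->
  (forall j, taylor2 (g j) (g' j) (c j)) -> rbound c D ->
  (forall h, summ (fun i => f i h)) -> (forall h, summ (fun j => g j h)) ->
  (forall h, csum (fun i => f i h) = k * csum (fun j => g j h)) ->
  csum f' = k * csum g'.
Proof.
move=> hf hb hg hc sf sg E.
have B0 : 0 <= B by have := hb [::] isT; rewrite big_nil.
have D0 : 0 <= D by have := hc [::] isT; rewrite big_nil.
have sf' : summ f' by apply: (summ_le hb) => i; case: (hf i).
have sg' : summ g' by apply: (summ_le hc) => j; case: (hg j).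
have bnd (K : eqType) (F : K -> R -> C) (F' : K -> C) (w : K -> R) W h : `|h| <= 1 ->
    (forall i, taylor2 (F i) (F' i) (w i)) -> rbound w W -> (forall h, summ (fun i => F i h)) ->
    summ F' ->
    cn (csum (fun i => F i h) - csum (fun i => F i 0) - h%:C * csum F') <= h ^+ 2 * W.
  move=> hh hF hW sF sF'.
  rewrite -(csumB (sF h) (sF 0)) -(csumZ h%:C sF') -(csumB (summB (sF h) (sF 0)) (summZ h%:C sF')).
  apply: cn_csum_le => s us; apply: le_trans (_ : \sum_(i <- s) h ^+ 2 * w i <= _).
    by apply: ler_sum => i _; case: (hF i) => _ _; apply.
  by rewrite -mulr_sumr ler_wpM2l ?sqr_ge0 // hW.
apply/eqP; rewrite -subr_eq0; apply/eqP; apply: cn_small_eq0 => e e0.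
pose M := B + cn k * D; have M0 : 0 <= M by rewrite addr_ge0 // mulr_ge0 ?cn_ge0.
pose h := Num.min 1 (e / (M + 1)).
have h0 : 0 < h by rewrite lt_min ltr01 divr_gt0 //; lra.
have hh : `|h| <= 1 by rewrite gtr0_norm // ge_min lexx.
have he : h * M <= e.
  apply: le_trans (_ : e / (M + 1) * M <= _).
    by apply: ler_wpM2r => //; rewrite ge_min lexx orbT.
  rewrite mulrAC ler_pdivrMr; last lra.
  by apply: ler_wpM2l; lra.
have H1 := bnd _ _ _ _ _ h hh hf hb sf sf'; have H2 := bnd _ _ _ _ _ h hh hg hc sg sg'.
move: H1 H2; rewrite !E; set X := csum (fun j => g j h); set Y := csum (fun j => g j 0).
set F := csum f'; set G := csum g' => H1 H2.
have : cn (h%:C * (F - k * G)) <= h ^+ 2 * M.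
  have -> : h%:C * (F - k * G) = k * (X - Y - h%:C * G) - (k * X - k * Y - h%:C * F) by ring.
  apply: le_trans (cnB _ _) _; rewrite cnM.
  have : cn k * cn (X - Y - h%:C * G) <= cn k * (h ^+ 2 * D) by rewrite ler_wpM2l ?cn_ge0.
  rewrite /M; lra.
rewrite cnM cn_real gtr0_norm // expr2 -mulrA ler_pM2l // => H; exact: le_trans H he.
Qed.

End SecondOrder.

Section HarmonicTheta.
Variables (R : realType) (n : nat).
Local Notation C := R[i].
Implicit Types (P Q : {mpoly R[n]}) (x y u : 'rV[R]_n) (lam : C).

Definition ebas (i : 'I_n) : 'rV[R]_n := delta_mx 0 i.

Lemma dotv_ebas x i : dotv x (ebas i) = x 0 i.
Proof.
rewrite /dotv (bigD1 i) //= big1 ?addr0; first by rewrite mxE !eqxx mulr1.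
by move=> k ki; rewrite mxE (negbTE ki) andbF mulr0.
Qed.

Lemma nrm_ebas y h i : nrm (y + h *: ebas i) = nrm y + (2 * h * y 0 i + h ^+ 2).
Proof.
rewrite /nrm dotvDl !dotvDr !dotvZl !dotvZr (dotvC (ebas i) y) !dotv_ebas.
by rewrite (_ : ebas i 0 i = 1); [ring | rewrite mxE !eqxx].
Qed.

Lemma evalv_taylor2 P : exists2 K : R, 0 <= K & exists d, forall y i,
  taylor2 (fun h => (evalv P (y + h *: ebas i))%:C) (evalv (mderiv i P) y)%:C (K * (1 + nrm y) ^+ d).
Proof.
have ext y i (Q : {mpoly R[n]}) : evalv Q (y + 0 *: ebas i) = evalv Q y by rewrite scale0r addr0.
have pw y a b : (1 + nrm y) ^+ a <= (1 + nrm y) ^+ (a + b).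
  by rewrite ler_weXn2l ?leq_addr // lerDl nrm_ge0.
elim/mpoly_alg_ind: P => [c|k|P Q [K K0 [d hP]] [L L0 [e hQ]]|P Q [K K0 [d hP]] [L L0 [e hQ]]].
- exists `|c| => //; exists 0%N => y i; rewrite expr0 mulr1 mderivC -cn_real.
  have := taylor2C (c%:C : C); rewrite /evalv meval0.
  by congr taylor2; apply: funext => h; rewrite mevalC.
- exists 2 => //; exists 1%N => y i; rewrite expr1.
  have y0 : `|y 0 k| <= 1 + nrm y.
    have := sqr_le_nrm y k; have := sqr_ge0 (`|y 0 k| - 1); have := normr_ge0 (y 0 k).
    by have := real_normK (num_real (y 0 k)); nra.
  have n0 := nrm_ge0 y.
  have dk : evalv (mderiv i ('X_k : {mpoly R[n]})) y = (i == k)%:R.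
    rewrite mderivX /evalv mevalZ mnm1E eq_sym; case: eqP => [->|]; last by rewrite mul0r.
    rewrite (_ : (U_(k) - U_(k))%MM = 0%MM); last by apply/mnmP => j; rewrite mnmBE subnn mnm0E.
    by rewrite mpolyX0 meval1 mulr1.
  split.
  + by rewrite evalvX scale0r addr0 cn_real; lra.
  + rewrite dk cn_real ger0_norm ?ler0n //; case: eqP => _ /=; lra.
  + move=> h _; rewrite dk !evalvX !mxE eqxx mul0r addr0 /=.
    have e0 (a b : C) : a + b - a - b = 0 by ring.
    rewrite (eq_sym k) !(rmorphD, rmorphM) /= e0 cn0.
    by apply: mulr_ge0; [exact: sqr_ge0 | lra].
- exists (K + L); first exact: addr_ge0.
  exists (d + e)%N => y i; rewrite mderivD evalvD rmorphD /=.
  have := taylor2D (hP y i) (hQ y i).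
  rewrite (_ : (fun h => _ + _) = (fun h => (evalv (P + Q) (y + h *: ebas i))%:C)); last first.
    by apply: funext => h; rewrite evalvD rmorphD.
  move=> T; apply: (taylor2_le T); rewrite mulrDl; apply: lerD; apply: ler_wpM2l => //.
  by rewrite addnC pw.
- exists (6 * (K * L)); first by rewrite !mulr_ge0.
  exists (d + e)%N => y i; rewrite mderivM evalvD !evalvM.
  have := taylor2M (hP y i) (hQ y i); rewrite !ext.
  rewrite (_ : (fun h => _ * _) = (fun h => (evalv (P * Q) (y + h *: ebas i))%:C)); last first.
    by apply: funext => h; rewrite evalvM rmorphM.
  rewrite !(rmorphD, rmorphM) /= => T; apply: (taylor2_le T).
  by rewrite exprD le_eqVlt; apply/orP; left; apply/eqP; ring.
Qed.

Lemma th_taylor2 lam : half lam -> exists2 K : R, 0 <= K & forall y i,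
  taylor2 (fun h => th lam (nrm (y + h *: ebas i)))
    (- 2 * pi%:C * lam ^+ 2 * (y 0 i)%:C * th lam (nrm y))
    (K * expR (- (pi * Re (lam ^+ 2) / 2) * nrm y)).
Proof.
move=> hl; have p0 := @pi_gt0 R; have r0 := Re_sqr_gt0 hl.
pose c := pi * Re (lam ^+ 2); have c0 : 0 < c by rewrite mulr_gt0.
pose M := pi * cn (lam ^+ 2); have M0 : 0 <= M by rewrite mulr_ge0 ?cn_ge0 // ltW.
(* Absorbs the exponential of a term linear in |t|, through 2 M |t| <= 8 M^2 / c + (c / 4) N. *)
pose D := expR (M + 8 * M ^+ 2 / c).
have [K1 K10 hK1] := @poly_le_exp R (c / 4) 2 (ltac:(by lra)).
pose W := (2 * M + 1) ^+ 2.
have W1 : 1 <= W by rewrite /W expr2; nra.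
have W0 : 0 <= W := le_trans ler01 W1.
have MW : 2 * M <= W by rewrite /W; nra.
exists (64 * (W * D * K1)).
  by rewrite !mulr_ge0 ?expR_ge0 ?ltW //; lra.
move=> y i; set N := nrm y; have N0 : 0 <= N by exact: nrm_ge0.
have yN := sqr_le_nrm y i; set t := y 0 i in yN *; rewrite -/N in yN.
have t0 := normr_ge0 t; have tt := real_normK (num_real t).
have tN : `|t| <= 1 + N by have := sqr_ge0 (`|t| - 1); nra.
have MC0 : 0 <= 8 * M ^+ 2 / c by apply: divr_ge0; [apply: mulr_ge0 => //; exact: sqr_ge0 | exact: ltW].
have D1 : 1 <= D by rewrite -expR0 ler_expR addr_ge0.
pose E := expR (- c * N); have E0 : 0 < E by exact: expR_gt0.
have thE : cn (th lam N) = E by rewrite cn_th.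
(* The dominating weight [G] decays at half the rate of [E], leaving room for polynomial factors. *)
pose G := expR (- (c / 2) * N).
have G0 : 0 < G by exact: expR_gt0.
have EG : (1 + N) ^+ 2 * (E * expR (c / 4 * N)) <= K1 * G.
  apply: le_trans (_ : K1 * expR (c / 4 * N) * (E * expR (c / 4 * N)) <= _).
    by apply: ler_wpM2r; [rewrite mulr_ge0 ?expR_ge0 // ltW | exact: hK1].
  rewrite -mulrA ler_wpM2l ?(ltW K10) // le_eqVlt; apply/orP; left; apply/eqP.
  by rewrite /E /G -!expRD; congr expR; field.
have cN0 : 0 <= c / 4 * N by apply: mulr_ge0 => //; lra.
have EG1 : (1 + N) ^+ 2 * E <= K1 * G.
  apply: (le_trans _ EG); apply: ler_wpM2l; first exact: sqr_ge0.
  by rewrite ler_peMr ?(ltW E0) // expR_ge1.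
have WD1 : 1 <= W * D by nra.
have WD0 : 0 <= W * D := le_trans ler01 WD1.
have KG0 : 0 <= K1 * G by rewrite mulr_ge0 ?ltW.
have N1 : 1 <= (1 + N) ^+ 2 by nra.
split.
- rewrite scale0r addr0 thE; apply: le_trans (_ : (1 + N) ^+ 2 * E <= _); first by rewrite ler_peMl ?(ltW E0).
  apply: (le_trans EG1); rewrite -/c -/G (_ : 64 * (W * D * K1) * G = 64 * (W * D) * (K1 * G)); last by ring.
  by rewrite ler_peMl //; lra.
- rewrite !cnM thE cnN cn_real (_ : cn (2 : C) = 2) ?cn_nat // cn_real (gtr0_norm p0).
  rewrite -cnM -expr2 (_ : 2 * pi * cn (lam ^+ 2) * `|t| * E = 2 * M * `|t| * E); last by rewrite /M; ring.
  apply: le_trans (_ : 2 * M * ((1 + N) ^+ 2 * E) <= _).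
    rewrite -mulrA; apply: ler_wpM2l; first lra.
    by apply: ler_wpM2r; [exact: ltW | nra].
  rewrite -/c -/G (_ : 64 * (W * D * K1) * G = 64 * (W * D) * (K1 * G)); last by ring.
  apply: ler_pM => //; [lra | by rewrite mulr_ge0 ?sqr_ge0 // ltW|].
  nra.
move=> h hh; rewrite scale0r addr0.
pose k := - pi%:C * lam ^+ 2 * (2 * h * t + h ^+ 2)%:C.
have -> : th lam (nrm (y + h *: ebas i)) = th lam N * cexp k.
  by rewrite nrm_ebas thD -/t -/N.
have h2 : h ^+ 2 <= 1 by rewrite -real_normK ?num_real // exprn_ile1.
have h20 := sqr_ge0 h; have hn := real_normK (num_real h).
have kb : cn k <= `|h| * (M * (2 * `|t| + 1)).
  rewrite /k !cnM cnN !cn_real (gtr0_norm p0) -cnM -expr2 -/M mulrCA; apply: ler_wpM2l => //.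
  apply: le_trans (ler_normD _ _) _; rewrite !normrM normr_nat.
  have := normr_ge0 h; nra.
have k1 : cn k <= M * (2 * `|t| + 1).
  by apply: le_trans kb _; rewrite ler_piMl // mulr_ge0 //; lra.
have ek : expR (cn k) <= D * expR (c / 4 * N).
  rewrite -expRD ler_expR; apply: le_trans k1 _.
  have : 2 * M * `|t| <= 8 * M ^+ 2 / c + c / 4 * N.
    have := sqr_ge0 (4 * M - c * `|t|).
    have q8 : 8 * M ^+ 2 = c * (8 * M ^+ 2 / c) by field; exact: lt0r_neq0.
    move: q8; set q := 8 * M ^+ 2 / c => q8 sq.
    have : 0 <= c * (q + c / 4 * N - 2 * M * `|t|).
      rewrite mulrBr mulrDr -q8; have : c * `|t| ^+ 2 * c <= c * N * c by rewrite tt; nra.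
      nra.
    by rewrite pmulr_rge0 //; lra.
  lra.
have -> : th lam N * cexp k - th lam N - h%:C * (-2 * pi%:C * lam ^+ 2 * t%:C * th lam N) =
   th lam N * ((cexp k - 1 - k) - pi%:C * lam ^+ 2 * (h ^+ 2)%:C).
  by rewrite /k !(rmorphD, rmorphM, rmorphXn, rmorph_nat) /=; ring.
rewrite cnM thE.
have b1 : cn (cexp k - 1 - k) <= h ^+ 2 * (16 * (W * (1 + N) ^+ 2) * (D * expR (c / 4 * N))).
  apply: le_trans (cn_cexp_sub1B _) _.
  have kk : cn k ^+ 2 <= h ^+ 2 * (4 * (W * (1 + N) ^+ 2)).
    apply: le_trans (_ : (`|h| * (M * (2 * `|t| + 1))) ^+ 2 <= _).
      by rewrite ler_pXn2r ?nnegrE ?cn_ge0 // (le_trans (cn_ge0 k)).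
    rewrite exprMn hn; apply: ler_wpM2l => //.
    rewrite /W -exprMn (_ : 4 = 2 ^+ 2) -?exprMn; last by ring.
    have X0 : 0 <= M * (2 * `|t| + 1) by rewrite mulr_ge0 // addr_ge0 // mulr_ge0.
    have Y0 : 0 <= 2 * ((2 * M + 1) * (1 + N)) by rewrite !mulr_ge0 // addr_ge0 // mulr_ge0.
    by rewrite ler_pXn2r ?nnegrE //; nra.
  apply: le_trans (_ : (4 * (h ^+ 2 * (4 * (W * (1 + N) ^+ 2)))) * (D * expR (c / 4 * N)) <= _).
    apply: ler_pM => //; first by rewrite mulr_ge0 ?sqr_ge0.
      exact: expR_ge0.
    by rewrite ler_wpM2l.
  by rewrite le_eqVlt; apply/orP; left; apply/eqP; ring.
have b2 : cn (pi%:C * lam ^+ 2 * (h ^+ 2)%:C) <= h ^+ 2 * (16 * (W * (1 + N) ^+ 2) * (D * expR (c / 4 * N))).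
  rewrite cnM cn_real (ger0_norm h20) mulrC cnM cn_real (gtr0_norm p0) -/M; apply: ler_wpM2l => //.
  have e1 : 1 <= D * expR (c / 4 * N) by rewrite mulr_ege1 // expR_ge1.
  have WN : W <= W * (1 + N) ^+ 2 by rewrite ler_peMr.
  apply: le_trans (_ : 2 * M <= _); first by rewrite ler_peMl ?ler1n.
  apply: le_trans MW _; apply: le_trans (_ : 16 * (W * (1 + N) ^+ 2) <= _).
    by apply: (le_trans WN); rewrite ler_peMl ?ler1n // mulr_ge0 ?sqr_ge0.
  by rewrite ler_peMr // mulr_ge0 // mulr_ge0 ?sqr_ge0.
apply: le_trans (_ : E * (2 * (h ^+ 2 * (16 * (W * (1 + N) ^+ 2) * (D * expR (c / 4 * N))))) <= _).
  rewrite ler_wpM2l ?(ltW E0) //; apply: le_trans (cnB _ _) _.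
  by rewrite [2]mulr2n mulrDl !mul1r; apply: lerD.
rewrite [X in X <= _](_ : _ = h ^+ 2 * (32 * (W * D) * ((1 + N) ^+ 2 * (E * expR (c / 4 * N))))); last by ring.
apply: ler_wpM2l => //; rewrite -/c -/G.
rewrite (_ : 64 * (W * D * K1) * G = 64 * (W * D) * (K1 * G)); last by ring.
apply: ler_pM => //; [exact: mulr_ge0 | | by rewrite ler_wpM2r ?ler_nat].
by rewrite mulr_ge0 ?sqr_ge0 // mulr_ge0 ?expR_ge0 // ltW.
Qed.

End HarmonicTheta.

Section HarmonicTheta2.
Variables (R : realType) (n : nat) (B : 'M[R]_n).
Hypothesis uB : B \in unitmx.
Local Notation C := R[i].
Local Notation pt z := (zr R z *m B).
Local Notation dpt w := (zr R w *m (invmx B)^T).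
Implicit Types (P Q : {mpoly R[n]}) (x y u : 'rV[R]_n) (lam : C).

Lemma ce_taylor2 (a : R) : taylor2 (fun h => ce (a * h)) ('i * (2 * pi * a)%:C) (128 * (1 + a ^+ 2)).
Proof.
have p0 := @pi_gt0 R; have p4 := @pi_le4 R; have a2 := sqr_ge0 a.
have ci : cn ('i : C) = 1 by rewrite /cn /= expr0n add0r expr1n sqrtr1.
have aa := real_normK (num_real a); have a0 := normr_ge0 a.
split.
- by rewrite mulr0 ce0 cn1; lra.
- rewrite cnM ci mul1r cn_real !normrM normr_nat (gtr0_norm p0).
  have := sqr_ge0 (`|a| - 1); nra.
move=> h hh; rewrite mulr0 ce0 /ce.
rewrite (_ : h%:C * ('i * (2 * pi * a)%:C) = 'i * (2 * pi * (a * h))%:C); last first.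
  by rewrite !rmorphM /=; ring.
apply: le_trans (cn_cexpi_sub1B _) _.
have h2 := sqr_ge0 h; have pp : pi ^+ 2 <= 16 :> R by rewrite expr2; nra.
rewrite (_ : 2 * (2 * pi * (a * h)) ^+ 2 = h ^+ 2 * (8 * pi ^+ 2 * a ^+ 2)); last by ring.
apply: ler_wpM2l => //.
have : pi ^+ 2 * a ^+ 2 <= 16 * a ^+ 2 by apply: ler_wpM2r.
lra.
Qed.

Lemma rbound_poly_exp (A : 'M[R]_n) (c : R) d : A \in unitmx -> 0 < c -> exists2 M : R, 0 <= M & forall u,
  rbound (fun z : 'rV[int]_n => (1 + nrm (zr R z *m A + u)) ^+ d * expR (- c * nrm (zr R z *m A + u))) M.
Proof.
move=> uA c0; have c2 : 0 < c / 2 by lra.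
have [K K0 hK] := poly_le_exp d c2; have [M M0 hM] := rbound_lattice uA c2.
exists (K * M); first by rewrite mulr_ge0 // ltW.
move=> u s us; apply: le_trans (_ : \sum_(z <- s) K * expR (- (c / 2) * nrm (zr R z *m A + u)) <= _).
  apply: ler_sum => z _; set N := nrm _; have N0 : 0 <= N by exact: nrm_ge0.
  apply: le_trans (_ : K * expR (c / 2 * N) * expR (- c * N) <= _).
    by apply: ler_wpM2r; [exact: expR_ge0 | exact: hK].
  rewrite -mulrA -expRD le_eqVlt; apply/orP; left; apply/eqP; congr (_ * expR _).
  by field.
by rewrite -mulr_sumr ler_wpM2l ?hM // ltW.
Qed.

Lemma half_rate lam : half lam -> 0 < pi * Re (lam ^+ 2).
Proof. by move=> hl; rewrite mulr_gt0 ?pi_gt0 ?Re_sqr_gt0. Qed.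

Lemma cn_evalv P : exists2 K : R, 0 <= K & exists d, forall y,
  cn (evalv P y)%:C <= K * (1 + nrm y) ^+ d :> R.
Proof.
elim/mpoly_alg_ind: P => [c|k|P Q [K K0 [d hP]] [L L0 [e hQ]]|P Q [K K0 [d hP]] [L L0 [e hQ]]].
- by exists `|c| => //; exists 0%N => y; rewrite expr0 mulr1 evalvC cn_real.
- exists 1 => //; exists 1%N => y; rewrite expr1 mul1r evalvX cn_real.
  have := sqr_le_nrm y k; have := sqr_ge0 (`|y 0 k| - 1); have := normr_ge0 (y 0 k).
  by have := real_normK (num_real (y 0 k)); nra.
- exists (K + L); first exact: addr_ge0.
  exists (d + e)%N => y; rewrite evalvD rmorphD /=; apply: le_trans (cnD _ _) _.
  have n1 : 1 <= 1 + nrm y by rewrite lerDl nrm_ge0.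
  rewrite mulrDl; apply: lerD; [apply: le_trans (hP y) _ | apply: le_trans (hQ y) _].
    by rewrite ler_wpM2l // ler_weXn2l // leq_addr.
  by rewrite ler_wpM2l // ler_weXn2l // leq_addl.
- exists (K * L); first exact: mulr_ge0.
  exists (d + e)%N => y; rewrite evalvM rmorphM /= cnM exprD mulrACA.
  by apply: ler_pM; rewrite ?cn_ge0.
Qed.

Lemma summ_poly_th (A : 'M[R]_n) Q lam u : A \in unitmx -> half lam ->
  summ (fun z : 'rV[int]_n => (evalv Q (zr R z *m A + u))%:C * th lam (nrm (zr R z *m A + u))).
Proof.
move=> uA hl; have [K K0 [d hK]] := cn_evalv Q.
have [M M0 hM] := rbound_poly_exp d uA (half_rate hl).
apply: (@summ_le _ _ (fun z => K * ((1 + nrm (zr R z *m A + u)) ^+ d *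
   expR (- (pi * Re (lam ^+ 2)) * nrm (zr R z *m A + u)))) (K * M)).
  by move=> s us; rewrite -mulr_sumr ler_wpM2l // hM.
by move=> z; rewrite cnM cn_th mulrA; apply: ler_wpM2r; rewrite ?expR_ge0 ?hK.
Qed.

Lemma summ_poly_th0 (A : 'M[R]_n) Q lam (e : 'rV[int]_n -> R) : A \in unitmx -> half lam ->
  summ (fun z : 'rV[int]_n => (evalv Q (zr R z *m A))%:C * th lam (nrm (zr R z *m A)) * ce (e z)).
Proof.
move=> uA hl; apply: (summ_dom (summ_poly_th Q 0 uA hl)) => z.
by rewrite cnM cn_ce mulr1 addr0.
Qed.

Lemma unit_dual : (invmx B)^T \in unitmx.
Proof. by rewrite unitmx_tr unitmx_inv. Qed.

(** Induction on the degree, for all shifts u at once, since the identity for the i-th partial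
    derivative of P is differentiated along the i-th direction and summed over i. One side yields -
    2 pi lam^2 (j + 1) P, the other 2 pi i (j + 1) P, and the quotient is the new factor - i /
    lam^2. The same K serves all degrees, so it can be computed from P = 1. *)
Theorem theta_harmonic : exists K : R, forall j P lam u,
  P \is j.-homog -> harmonic P -> half lam ->
  csum (fun z : 'rV[int]_n => (evalv P (pt z + u))%:C * th lam (nrm (pt z + u))) =
  lam^-1 ^+ n * K%:C * (- 'i / lam ^+ 2) ^+ j *
  csum (fun w : 'rV[int]_n => (evalv P (dpt w))%:C * th lam^-1 (nrm (dpt w)) * ce (dotv (dpt w) u)).
Proof.
have [K hK] := poisson_lattice uB; exists K => j; elim: j => [|j IH] P lam u hP hH hl.
  have [c ->] := homog0_const hP; have hli := halfV hl.
  have one (Q : {mpoly R[n]}) y : evalv 1%:MP y = 1 :> R by rewrite evalvC.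
  have s1 : summ (fun z : 'rV[int]_n => th lam (nrm (pt z + u))).
    apply: (summ_dom (summ_poly_th (1%:MP) u uB hl)) => z; by rewrite evalvC mul1r.
  have s2 : summ (fun w : 'rV[int]_n => th lam^-1 (nrm (dpt w)) * ce (dotv (dpt w) u)).
    apply: (summ_dom (summ_poly_th0 (1%:MP) (fun w => dotv (dpt w) u) unit_dual hli)) => w.
    by rewrite evalvC mul1r.
  rewrite (eq_csum (v := fun z => c%:C * th lam (nrm (pt z + u)))); last by move=> z; rewrite evalvC.
  rewrite [in RHS](eq_csum (v := fun w => c%:C * (th lam^-1 (nrm (dpt w)) * ce (dotv (dpt w) u)))); last first.
    by move=> z; rewrite evalvC mulrA.
  by rewrite (csumZ _ s1) (csumZ _ s2) hK // expr0; ring.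
have hli := halfV hl; have l0 := half_neq0 hl.
set k := lam^-1 ^+ n * K%:C * (- 'i / lam ^+ 2) ^+ j.
pose f i (z : 'rV[int]_n) h := (evalv (mderiv i P) (pt z + u + h *: ebas R i))%:C *
   th lam (nrm (pt z + u + h *: ebas R i)).
pose f' i (z : 'rV[int]_n) := (evalv (mderiv i (mderiv i P)) (pt z + u))%:C * th lam (nrm (pt z + u)) +
  (evalv (mderiv i P) (pt z + u))%:C *
  (- 2 * pi%:C * lam ^+ 2 * ((pt z + u) 0 i)%:C * th lam (nrm (pt z + u))).
pose a i (w : 'rV[int]_n) : C := (evalv (mderiv i P) (dpt w))%:C * th lam^-1 (nrm (dpt w)) * ce (dotv (dpt w) u).
pose g i (w : 'rV[int]_n) h := a i w * ce (dpt w 0 i * h).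
pose g' i (w : 'rV[int]_n) := a i w * ('i * (2 * pi * dpt w 0 i)%:C).
have key i : csum (f' i) = k * csum (g' i).
  have [K1 K10 [d hK1]] := evalv_taylor2 (mderiv i P).
  have [K2 K20 hK2] := th_taylor2 n hl.
  have r0 : 0 < pi * Re (lam ^+ 2) / 2 by have := half_rate hl; lra.
  have [M M0 hM] := rbound_poly_exp d uB r0.
  have [K3 K30 [e hK3]] := cn_evalv (mderiv i P).
  have [M' M'0 hM'] := rbound_poly_exp e.+1 unit_dual (half_rate hli).
  apply: (@csum_deriv R _ _ (f i) (f' i) (fun z => 6 * (K1 * (1 + nrm (pt z + u)) ^+ d *
      (K2 * expR (- (pi * Re (lam ^+ 2) / 2) * nrm (pt z + u))))) (6 * K1 * K2 * M)
    (g i) (g' i) (fun w => 6 * 128 * K3 * ((1 + nrm (dpt w + 0)) ^+ e.+1 *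
        expR (- (pi * Re (lam^-1 ^+ 2)) * nrm (dpt w + 0)))) (6 * 128 * K3 * M')).
  - move=> z; have := taylor2M (hK1 (pt z + u) i) (hK2 (pt z + u) i).
    by rewrite scale0r addr0.
  - move=> s us; rewrite (eq_bigr (fun z => 6 * K1 * K2 * ((1 + nrm (pt z + u)) ^+ d *
      expR (- (pi * Re (lam ^+ 2) / 2) * nrm (pt z + u))))); last by move=> z _; ring.
    by rewrite -mulr_sumr; apply: ler_wpM2l; rewrite ?hM // !mulr_ge0.
  - move=> w; rewrite addr0.
    have := taylor2M (taylor2C (a i w)) (ce_taylor2 (dpt w 0 i)).
    rewrite mul0r add0r => T; apply: (taylor2_le T).
    have N0 := nrm_ge0 (dpt w); have N1 := sqr_le_nrm (dpt w) i.
    have q1 : cn (a i w) <= K3 * (1 + nrm (dpt w)) ^+ e * expR (- (pi * Re (lam^-1 ^+ 2)) * nrm (dpt w)).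
      by rewrite /a cnM cn_ce mulr1 cnM cn_th; apply: ler_wpM2r; rewrite ?expR_ge0 ?hK3.
    apply: le_trans (_ : 6 * ((K3 * (1 + nrm (dpt w)) ^+ e * expR (- (pi * Re (lam^-1 ^+ 2)) * nrm (dpt w))) *
       (128 * (1 + nrm (dpt w)))) <= _).
      by rewrite ler_wpM2l //; apply: ler_pM; rewrite ?cn_ge0 //; have := sqr_ge0 (dpt w 0 i); lra.
    by rewrite (exprS _ e) le_eqVlt; apply/orP; left; apply/eqP; ring.
  - by move=> s us; rewrite -mulr_sumr; apply: ler_wpM2l; rewrite ?hM' // !mulr_ge0.
  - move=> h; have := summ_poly_th (mderiv i P) (u + h *: ebas R i) uB hl.
    by congr summ; apply: funext => z; rewrite addrA.
  - move=> h; apply: (summ_dom (summ_poly_th0 (mderiv i P) (fun w => dotv (dpt w) u) unit_dual hli)) => w.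
    by rewrite /g cnM cn_ce mulr1.
  - move=> h.
    have := IH (mderiv i P) lam (u + h *: ebas R i) (homog_mderiv i hP) (harmonic_mderiv i hH) hl.
    rewrite -/k (eq_csum (v := fun z => f i z h)); last by move=> z; rewrite /f addrA.
    move=> ->; congr (_ * _); apply: eq_csum => w.
    by rewrite /g /a dotvDr dotvZr dotv_ebas ceD (mulrC h) -!mulrA.
have sP1 := summ_poly_th P u uB hl.
have sP2 := summ_poly_th0 P (fun w => dotv (dpt w) u) unit_dual hli.
have sf' i : summ (f' i).
  apply: summD; first exact: summ_poly_th.
  have := summZ (- 2 * pi%:C * lam ^+ 2) (summ_poly_th (mderiv i P * 'X_i) u uB hl).
  congr summ; apply: funext => z; rewrite evalvM evalvX rmorphM /=; ring.
have sg' i : summ (g' i).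
  have := summZ ('i * (2 * pi)%:C) (summ_poly_th0 (mderiv i P * 'X_i) (fun w => dotv (dpt w) u) unit_dual hli).
  congr summ; apply: funext => w; rewrite /g' /a evalvM evalvX !rmorphM /=; ring.
have [_ F1] := csum_sum (index_enum 'I_n) sf'; have [_ G1] := csum_sum (index_enum 'I_n) sg'.
have FE : csum (fun z => \sum_i f' i z) = (- 2 * pi%:C * lam ^+ 2 * j.+1%:R) *
    csum (fun z => (evalv P (pt z + u))%:C * th lam (nrm (pt z + u))).
  rewrite -csumZ //; apply: eq_csum => z; set y := pt z + u.
  rewrite /f' -/y big_split /= -mulr_suml -rmorph_sum /= harmonic_eval // mul0r add0r.
  rewrite (eq_bigr (fun i => (- 2 * pi%:C * lam ^+ 2 * th lam (nrm y)) *
     (y 0 i * evalv (mderiv i P) y)%:C)); last by move=> i _; rewrite rmorphM /=; ring.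
  by rewrite -mulr_sumr -rmorph_sum /= (euler_eval _ hP) rmorphM /= rmorph_nat; ring.
have GE : csum (fun w => \sum_i g' i w) = ('i * (2 * pi)%:C * j.+1%:R) *
    csum (fun w => (evalv P (dpt w))%:C * th lam^-1 (nrm (dpt w)) * ce (dotv (dpt w) u)).
  rewrite -csumZ //; apply: eq_csum => w; set y := dpt w.
  rewrite /g' /a -/y (eq_bigr (fun i => ('i * (2 * pi)%:C * th lam^-1 (nrm y) * ce (dotv y u)) *
     (y 0 i * evalv (mderiv i P) y)%:C)); last by move=> i _; rewrite !rmorphM /=; ring.
  by rewrite -mulr_sumr -rmorph_sum /= (euler_eval _ hP) rmorphM /= rmorph_nat; ring.
have : csum (fun z => \sum_i f' i z) = k * csum (fun w => \sum_i g' i w).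
  by rewrite F1 G1 mulr_sumr; apply: eq_bigr => i _; exact: key.
rewrite FE GE; set X := csum _; set Y := csum _ => H.
have p0 : pi%:C != 0 :> C by rewrite -cn_eq0 cn_real normr_eq0 gt_eqF // pi_gt0.
have j0 : j.+1%:R != 0 :> C by rewrite pnatr_eq0.
have c0 : - 2 * pi%:C * lam ^+ 2 * j.+1%:R != 0 :> C.
  by rewrite !mulf_neq0 // ?expf_neq0 // oppr_eq0 pnatr_eq0.
apply: (mulfI c0); rewrite H (exprSr _ j) -/k (_ : lam^-1 ^+ n * K%:C * ((- 'i / lam ^+ 2) ^+ j * (- 'i / lam ^+ 2)) * Y =
  k * (- 'i / lam ^+ 2) * Y); last by rewrite /k; ring.
by rewrite rmorphM /= rmorph_nat; field.
Qed.

End HarmonicTheta2.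

(** * Power series, modular forms and vanishing *)

Section PowerSeries.
Variable R : realType.
Local Notation C := R[i].
Implicit Types (a b : nat -> C) (q z : C).

Lemma expr_lt_eps (c e : R) : 0 <= c < 1 -> 0 < e -> exists n, c ^+ n < e.
Proof.
move=> /andP[c0 c1] e0; have [->|cn0] := eqVneq c 0; first by exists 1%N; rewrite expr1.
have cp : 0 < c by rewrite lt_neqAle eq_sym cn0.
pose d := c^-1 - 1; have d0 : 0 < d by rewrite subr_gt0 invf_gt1.
have [n hn] : exists n : nat, e^-1 < n%:R * d.
  exists (Num.truncn (e^-1 / d)).+1; rewrite -ltr_pdivrMr //.
  exact: truncnS_gt.
have bern m : 1 + m%:R * d <= c^-1 ^+ m.
  elim: m => [|m IH]; first by rewrite mul0r addr0 expr0.
  have e1 : c^-1 = 1 + d by rewrite /d; ring.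
  rewrite exprS {1}e1 -natr1; apply: le_trans (_ : (1 + d) * (1 + m%:R * d) <= _).
    have : 0 <= m%:R * d * d by rewrite !mulr_ge0 // ltW.
    by move: (m%:R) => x; nra.
  by apply: ler_wpM2l => //; lra.
exists n; rewrite -[c]invrK exprVn -[e]invrK ltf_pV2 ?posrE ?invr_gt0 // ?exprn_gt0 ?invr_gt0 //.
by apply: lt_le_trans hn _; apply: le_trans (bern n); rewrite lerDr.
Qed.

(** A single n0 serves every v dominated by u; this is applied to all points of a circle
    simultaneously. *)
Lemma nat_tail (u : nat -> C) (e : R) : summ u -> 0 < e -> exists n0, forall n, (n0 <= n)%N ->
  forall v : nat -> C, (forall i, cn (v i) <= cn (u i)) -> cn (csum v - \sum_(i < n) v i) <= e.
Proof.
move=> su e0; have [s0 [us0 h]] := csum_tail su e0.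
exists (\max_(i <- s0) i).+1 => n hn v hv.
have sub : {subset s0 <= iota 0 n}.
  move=> i i0; rewrite mem_iota /= add0n; apply: leq_trans hn; rewrite ltnS.
  exact: (@leq_bigmax_seq _ s0 xpredT id i).
have [rb _] := h (iota 0 n) (iota_uniq 0 n) sub.
have sv := summ_dom su hv.
pose w i := if i \in iota 0 n then v i else 0 : C.
have wz i : i \notin iota 0 n -> w i = 0 by rewrite /w => /negbTE ->.
have [sw cw] := csum_fin (iota_uniq 0 n) wz.
have -> : \sum_(i < n) v i = csum w.
  rewrite cw -(big_mkord xpredT v) /index_iota subn0 !big_seq.
  by apply: eq_bigr => i hi; rewrite /w hi.
rewrite -csumB //; apply: cn_csum_le => s us; apply: le_trans (rb s us).
by apply: ler_sum => i _; rewrite /w; case: ifP => _; rewrite ?subrr ?cn0 // subr0.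
Qed.

Lemma sqr_cn_conj z : (cn z ^+ 2)%:C = z * conjc z.
Proof.
by rewrite sqr_cn; case: z => x y; apply: complex_eqP; rewrite !(cReM, cImM) /=; ring.
Qed.

Lemma conjc_ce (x : R) : conjc (ce x) = ce (- x).
Proof. by rewrite !ceE mulrN cosN sinN. Qed.

Lemma parseval_fin N (b : nat -> C) : (0 < N)%N ->
  \sum_(k < N) cn (\sum_(m < N) b m * ce (k%:R / N%:R) ^+ m) ^+ 2 = N%:R * \sum_(m < N) cn (b m) ^+ 2.
Proof.
move=> N0; apply: complexI; rewrite rmorphM /= rmorph_nat !rmorph_sum /=.
rewrite (eq_bigr (fun k : 'I_N => \sum_(m < N) \sum_(l < N) (b m * ce (k%:R / N%:R) ^+ m) *
   conjc (b l * ce (k%:R / N%:R) ^+ l))); last first.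
  by move=> k _; rewrite sqr_cn_conj rmorph_sum /= mulr_suml; apply: eq_bigr => m _; rewrite mulr_sumr.
rewrite exchange_big mulr_sumr; apply: eq_bigr => m _ /=; rewrite exchange_big /=.
rewrite (bigD1 m) //= [X in _ + X]big1 ?addr0; last first.
  move=> l lm; rewrite (eq_bigr (fun k : 'I_N => (b m * conjc (b l)) *
      ce (k%:R * ((m%:Z - l%:Z)%:~R / N%:R)))).
    rewrite -mulr_sumr root_unity_sum //; case: ifP; last by rewrite mulr0.
    have ml : nat_of_ord l <> m by move=> h; move/eqP: lm; apply; apply: val_inj.
    by move: (ltn_ord m) (ltn_ord l) => h1 h2 /dvdnP[c hc]; case: c hc => [|c]; nia.
  move=> k _; rewrite rmorphM rmorphXn /= conjc_ce -!ceMn mulrACA -ceD; congr (_ * ce _).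
  by rewrite intrB !pmulrn; ring.
rewrite (eq_bigr (fun=> (cn (b m) ^+ 2)%:C)); last first.
  move=> k _; rewrite rmorphM rmorphXn /= conjc_ce -!ceMn mulrACA -ceD sqr_cn_conj.
  by rewrite (_ : _ + _ = 0) ?ce0 ?mulr1 //; ring.
by rewrite sumr_const card_ord mulr_natl.
Qed.

Definition dser a := forall q, cn q < 1 -> summ (fun m => a m * q ^+ m).
Definition ps a q : C := csum (fun m => a m * q ^+ m).

(** The mean over a circle is replaced by the mean over the N-th roots of unity: after truncation at
    N, with an error e uniform on the circle, finite Parseval is exact. Then e tends to 0. *)
Lemma bessel a (rho G : R) n : dser a -> 0 <= rho < 1 ->
  (forall x : R, cn (ps a (rho%:C * ce x)) <= G) ->
  \sum_(m < n) cn (a m * rho%:C ^+ m) ^+ 2 <= G ^+ 2.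
Proof.
move=> da /andP[r0 r1] hG; have G0 : 0 <= G := le_trans (cn_ge0 _) (hG 0).
have sr : summ (fun m => a m * rho%:C ^+ m) by apply: da; rewrite cn_real ger0_norm.
suff key e : 0 < e -> \sum_(m < n) cn (a m * rho%:C ^+ m) ^+ 2 <= (G + e) ^+ 2.
  apply/ler_addgt0Pr => e e0.
  pose d := Num.min 1 (e / (2 * G + 1)).
  have d0 : 0 < d by rewrite lt_min ltr01 divr_gt0 //; lra.
  have d1 : d <= 1 by rewrite ge_min lexx.
  have de : d * (2 * G + 1) <= e by rewrite -ler_pdivlMr; [rewrite ge_min lexx orbT | lra].
  by apply: le_trans (key d d0) _; nra.
move=> e0; have [n0 hn0] := nat_tail sr e0.
pose N := (maxn n0 n).+1; have nN : (n0 <= N)%N by rewrite /N; lia.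
have NN : 0 < N%:R :> R by rewrite ltr0n.
have step (k : 'I_N) : cn (\sum_(m < N) (a m * rho%:C ^+ m) * ce (k%:R / N%:R) ^+ m) ^+ 2 <= (G + e) ^+ 2.
  set S := \sum_(m < N) _; rewrite ler_pXn2r ?nnegrE ?cn_ge0 ?addr_ge0 ?(ltW e0) //.
  have := hn0 N nN (fun m => a m * (rho%:C * ce (k%:R / N%:R)) ^+ m).
  rewrite (_ : \sum_(i < N) _ = S); last by apply: eq_bigr => i _; rewrite exprMn mulrA.
  move=> /(_ _) H; rewrite -[S](subKr (ps a (rho%:C * ce (k%:R / N%:R)))).
  apply: le_trans (cnB _ _) _; apply: lerD; first exact: hG.
  by apply: H => i; rewrite exprMn mulrA cnM (cnX (ce _)) cn_ce expr1n mulr1.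
have := ler_sum (index_enum 'I_N) (P := xpredT) (fun k _ => step k).
rewrite (parseval_fin (fun m => a m * rho%:C ^+ m)) // sumr_const card_ord (_ : (G + e) ^+ 2 *+ N = N%:R * (G + e) ^+ 2) ?ler_pM2l // => [H|]; last by rewrite mulr_natl.
apply: le_trans H; rewrite -(big_mkord xpredT (fun m => cn (a m * rho%:C ^+ m) ^+ 2)).
rewrite -(big_mkord xpredT (fun m => cn (a m * rho%:C ^+ m) ^+ 2)).
rewrite (@big_cat_nat _ _ _ n 0 N) //=; last by rewrite /N; lia.
by rewrite lerDl; apply: sumr_ge0 => m _; exact: sqr_ge0.
Qed.

Lemma cauchy_schwarz n (f g : nat -> R) : (forall i, 0 <= f i) -> (forall i, 0 <= g i) ->
  (\sum_(i < n) f i * g i) ^+ 2 <= (\sum_(i < n) f i ^+ 2) * (\sum_(i < n) g i ^+ 2).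
Proof.
move=> f0 g0; elim: n => [|n IH]; first by rewrite !big_ord0 expr0n mul0r.
rewrite !big_ord_recr /=; move: IH.
have: 0 <= \sum_(i < n) f i * g i by apply: sumr_ge0 => i _; rewrite mulr_ge0.
have: 0 <= \sum_(i < n) f i ^+ 2 by apply: sumr_ge0 => i _; rewrite sqr_ge0.
have: 0 <= \sum_(i < n) g i ^+ 2 by apply: sumr_ge0 => i _; rewrite sqr_ge0.
move: (f0 n) (g0 n); set S := \sum_(i < n) f i * g i; set A := \sum_(i < n) f i ^+ 2.
set B := \sum_(i < n) g i ^+ 2; move: (f n) (g n) => x y x0 y0 B0 A0 S0 IH.
suff h : 2 * (S * (x * y)) <= A * y ^+ 2 + x ^+ 2 * B.
  rewrite sqrrD mulrDl !mulrDr -mulr_natl exprMn; lra.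
have P0 : 0 <= A * y ^+ 2 by rewrite mulr_ge0 ?sqr_ge0.
have Q0 : 0 <= x ^+ 2 * B by rewrite mulr_ge0 ?sqr_ge0.
rewrite -(ler_pXn2r (n := 2)) ?nnegrE //; [|by rewrite !mulr_ge0|exact: addr_ge0].
apply: le_trans (_ : 4 * ((A * y ^+ 2) * (x ^+ 2 * B)) <= _).
  rewrite (_ : (2 * (S * (x * y))) ^+ 2 = 4 * (S ^+ 2 * (x * y) ^+ 2)); last by ring.
  rewrite ler_wpM2l // (_ : A * y ^+ 2 * (x ^+ 2 * B) = (A * B) * (x * y) ^+ 2); last by ring.
  by rewrite ler_wpM2r ?sqr_ge0.
have := sqr_ge0 (A * y ^+ 2 - x ^+ 2 * B).
by move: (A * y ^+ 2) (x ^+ 2 * B) => p q; nra.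
Qed.

Lemma cauchy_schwarz_csum (u : nat -> C) (f g : nat -> R) (A B : R) : summ u ->
  (forall i, 0 <= f i) -> (forall i, 0 <= g i) -> (forall i, cn (u i) <= f i * g i) ->
  (forall n, \sum_(i < n) f i ^+ 2 <= A) -> (forall n, \sum_(i < n) g i ^+ 2 <= B) ->
  cn (csum u) ^+ 2 <= A * B.
Proof.
move=> su f0 g0 hu hA hB.
have A0 : 0 <= A by have := hA 0%N; rewrite big_ord0.
have B0 : 0 <= B by have := hB 0%N; rewrite big_ord0.
rewrite -[A * B]sqr_sqrtr ?mulr_ge0 // ler_pXn2r ?nnegrE ?cn_ge0 ?sqrtr_ge0 //.
apply/ler_addgt0Pr => e e0; have [n hn] := nat_tail su e0.
have {}hn := hn n (leqnn n) u (fun=> lexx _).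
rewrite -[csum u](subrK (\sum_(i < n) u i)) addrC; apply: le_trans (cnD _ _) _; apply: lerD => //.
apply: le_trans (_ : \sum_(i < n) f i * g i <= _).
  by apply: le_trans (cn_sum _ _ _) _; apply: ler_sum.
have S0 : 0 <= \sum_(i < n) f i * g i by apply: sumr_ge0 => i _; rewrite mulr_ge0.
rewrite -(ler_pXn2r (n := 2)) ?nnegrE ?sqrtr_ge0 // sqr_sqrtr ?mulr_ge0 //.
apply: le_trans (cauchy_schwarz _ f0 g0) _; apply: ler_pM => //; apply: sumr_ge0 => i _; exact: sqr_ge0.
Qed.

(** The square of the nome exp (i pi z), so that vectors of norm 2m contribute to the m-th power. *)
Definition qq z : C := cexp ('i * (2 * pi)%:C * z).

Lemma cn_qq z : cn (qq z) = expR (- (2 * pi * Im z)).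
Proof. by rewrite /qq cn_cexp; congr expR; case: z => x y; rewrite !(cReM, cImM) /=; ring. Qed.

Lemma cn_qq_lt1 z : 0 < Im z -> cn (qq z) < 1.
Proof. by move=> z0; rewrite cn_qq expR_lt1 oppr_lt0 !mulr_gt0 ?pi_gt0. Qed.

Lemma qq_split (x y : R) : qq (x +i* y) = (expR (- (2 * pi * y)))%:C * ce x.
Proof.
rewrite /qq /ce -cexp_real -cexpD; congr cexp.
by apply: complex_eqP; rewrite !(cReM, cImM, cReD, cImD) /=; ring.
Qed.

Lemma qqD_int z (j : int) : qq (z + j%:~R) = qq z.
Proof.
rewrite /qq mulrDr cexpD -[RHS]mulr1; congr (_ * _); rewrite -[RHS](ce_int R j) /ce; congr cexp.
by rewrite !rmorphM /= rmorph_int; ring.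
Qed.

(** Takes the place of the identity theorem: the Bessel bound with G = 0 on the circle that
    corresponds to height 1. *)
Lemma ps_eq0 a : dser a -> (forall z, 0 < Im z -> ps a (qq z) = 0) -> forall m, a m = 0.
Proof.
move=> da h m; have p0 := @pi_gt0 R; pose rho : R := expR (- (2 * pi * 1)).
have r0 : 0 < rho := expR_gt0 _.
have r1 : rho < 1 by rewrite expR_lt1; lra.
have := @bessel a rho 0 m.+1 da; rewrite (ltW r0) r1 => /(_ isT).
have H x : cn (ps a (rho%:C * ce x)) <= 0 by rewrite -qq_split h ?cn0 //= ltr01.
move=> /(_ H); rewrite big_ord_recr /= expr0n /= => S.
have S0 : 0 <= \sum_(i < m) cn (a i * rho%:C ^+ i) ^+ 2 by apply: sumr_ge0 => i _; exact: sqr_ge0.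
have : cn (a m * rho%:C ^+ m) ^+ 2 == 0 by rewrite eq_le sqr_ge0 andbT; lra.
rewrite sqrf_eq0 cn_eq0 mulf_eq0.
by case/orP => [/eqP //|]; rewrite -cn_eq0 cnX cn_real gt_eqF // exprn_gt0 // normr_gt0 gt_eqF.
Qed.

Definition conv a b m : C := \sum_(i < m.+1) a i * b (m - i)%N.

Lemma conv_ps a b q : summ (fun m => a m * q ^+ m) -> summ (fun m => b m * q ^+ m) ->
  summ (fun m => conv a b m * q ^+ m) /\ ps (conv a b) q = ps a q * ps b q.
Proof.
move=> sa sb; have [s1 e1] := csum_mul sa sb.
have [s2 e2] := csum_fibers (fun p : nat * nat => (p.1 + p.2)%N) s1.
have key m : csum (fun p : nat * nat => if (p.1 + p.2)%N == m then
    (a p.1 * q ^+ p.1) * (b p.2 * q ^+ p.2) else 0) = conv a b m * q ^+ m.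
  pose s := [seq (i, (m - i)%N) | i <- iota 0 m.+1].
  have us : uniq s by rewrite map_inj_uniq ?iota_uniq // => i j [].
  set u := (fun p : nat * nat => _).
  have uz p : p \notin s -> u p = 0.
    rewrite /u; case: eqP => // h /mapP[]; exists p.1; first by rewrite mem_iota /=; move: (p.1) (p.2) h => x y; lia.
    by case: p h => x y /=; move=> h; congr (_, _); lia.
  have [_ ->] := csum_fin us uz.
  rewrite big_map -[iota 0 m.+1]/(index_iota 0 m.+1) big_mkord /conv mulr_suml.
  apply: eq_bigr => i _; have im : (i <= m)%N by rewrite -ltnS.
  by rewrite /u /= subnKC // eqxx (_ : q ^+ m = q ^+ i * q ^+ (m - i)); [ring | by rewrite -exprD subnKC].
rewrite /ps -e1 e2 -(eq_csum key); split => //.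
by rewrite -(funext key).
Qed.

Lemma dser_conv a b : dser a -> dser b -> dser (conv a b).
Proof. by move=> da db q hq; case: (conv_ps (da q hq) (db q hq)). Qed.

Lemma conv_eq0 a b : b 0%N != 0 -> (forall m, conv a b m = 0) -> forall m, a m = 0.
Proof.
move=> b0 h m; elim/ltn_ind: m => m IH; have := h m; rewrite /conv big_ord_recr /= big1.
  by rewrite add0r subnn => /eqP; rewrite mulf_eq0 (negbTE b0) orbF => /eqP.
by move=> i _; rewrite IH ?mul0r.
Qed.

(** Invariance under z -> z + 1 is automatic for a series in exp (2 pi i z), and convergence in the
    disc contains regularity at the cusp; the inversion is the relation left to state. *)
Definition MF k a := dser a /\
  forall z, 0 < Im z -> ps a (qq (- z^-1)) = z ^+ k * ps a (qq z).

Lemma Im_oppV z : 0 < Im z -> Im (- z^-1) = Im z / cn z ^+ 2 /\ 0 < Im (- z^-1).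
Proof.
move=> z0; have zn : 0 < cn z ^+ 2.
  by rewrite sqr_cn ltr_wpDl ?sqr_ge0 ?exprn_gt0.
have -> : Im (- z^-1) = Im z / cn z ^+ 2.
  by rewrite sqr_cn cImN; case: z z0 zn => x y /= y0 zn; rewrite opprK.
by rewrite divr_gt0.
Qed.

Lemma MF_mul k l a b : MF k a -> MF l b -> MF (k + l) (conv a b).
Proof.
move=> [da ha] [db hb]; split; first exact: dser_conv.
move=> z z0.
have [_ zi] := Im_oppV z0.
have [_ ->] := conv_ps (da _ (cn_qq_lt1 zi)) (db _ (cn_qq_lt1 zi)).
have [_ ->] := conv_ps (da _ (cn_qq_lt1 z0)) (db _ (cn_qq_lt1 z0)).
by rewrite ha // hb // exprD; ring.
Qed.

Lemma MF_lin k a b c d : MF k a -> MF k b -> MF k (fun m => c * a m + d * b m).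
Proof.
move=> [da ha] [db hb].
have key q : cn q < 1 -> summ (fun m => (c * a m + d * b m) * q ^+ m) /\
    ps (fun m => c * a m + d * b m) q = c * ps a q + d * ps b q.
  move=> hq; rewrite /ps -(csumZ c (da q hq)) -(csumZ d (db q hq)).
  rewrite -(csumD (summZ c (da q hq)) (summZ d (db q hq))).
  have e : (fun m => (c * a m + d * b m) * q ^+ m) = (fun i => c * (a i * q ^+ i) + d * (b i * q ^+ i)).
    by apply: funext => m; ring.
  rewrite e; split => //; apply: summD; apply: summZ; [exact: da | exact: db].
split=> [q /key[]//|z z0]; have [_ zi] := Im_oppV z0.
have [_ ->] := key _ (cn_qq_lt1 zi); have [_ ->] := key _ (cn_qq_lt1 z0).
by rewrite ha // hb //; ring.
Qed.

End PowerSeries.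

Lemma near_int (R : realType) (x : R) : exists j : int, (x - j%:~R) ^+ 2 <= 1 / 4.
Proof.
exists (Num.floor (x + 1 / 2)); have := floor_itv (x + 1 / 2); rewrite intrD.
move: ((Num.floor (x + 1 / 2))%:~R : R) => j /andP[h1 h2].
have : 0 <= (1 / 2 - (x - j)) * (1 / 2 + (x - j)) by apply: mulr_ge0; lra.
by rewrite expr2; lra.
Qed.

(** * Vanishing of forms with many zero coefficients *)

Section Vanishing.
Variables (R : realType) (k r : nat) (lam T : R) (a : nat -> R[i]).
Local Notation C := R[i].
Hypotheses (lam0 : 0 < lam) (lam1 : lam < 1) (T0 : 0 < T) (T1 : T < 1).
(** The constant is 4 . 3.12 . 0.865 rounded down, a lower bound for 4 pi Im z when Im z >= Y. T
    bounds the ratio of the geometric series left by Cauchy-Schwarz, and [hr] says that the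
    resulting contraction factor is below 1. *)
Hypothesis hT : expR (- (10795 / 1000 * (1 - lam))) <= T.
Hypothesis hr : T ^+ r < lam ^+ k * (1 - T).
Hypotheses (r0 : (0 < r)%N) (Ma : MF k a) (a0 : forall m, (m < r)%N -> a m = 0).
Local Notation F z := (ps a (qq z)).
Local Notation psi z := (cn (F z) ^+ 2 * Im z ^+ k).
Local Notation Y := (865 / 1000 : R).

Lemma tail_geom (x : R) n : 0 <= x <= T ->
  \sum_(i < n) (if (i < r)%N then 0 else x ^+ i) <= T ^+ r / (1 - T).
Proof.
move=> /andP[x0 xT]; have t1 : 0 < 1 - T by rewrite subr_gt0.
rewrite ler_pdivlMr //; apply: le_trans (_ : T ^+ r - T ^+ (maxn n r) <= _); last first.
  by rewrite gerBl exprn_ge0 // ltW.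
elim: n => [|n IH]; first by rewrite big_ord0 mul0r max0n subrr.
rewrite big_ord_recr /= mulrDl; apply: le_trans (lerD IH (lexx _)) _.
case: ltnP => nr.
  by rewrite mul0r addr0 (maxn_idPr nr).
rewrite (maxn_idPl (leqW nr)).
have : x ^+ n * (1 - T) <= T ^+ n * (1 - T).
  by rewrite ler_wpM2r ?(ltW t1) // lerXn2r ?nnegrE // ltW.
by rewrite exprS; move: (x ^+ n) (T ^+ n) => p q; nra.
Qed.

(* [psi] is invariant under the modular group.  Parseval at height [lam * y] bounds the mean square of
   the coefficients, and Cauchy-Schwarz turns this into a bound for [psi] at height [y] that gains
   a factor smaller than 1 as soon as the first [r] coefficients vanish. *)
Lemma psi_contract (K : R) : (forall z, 0 < Im z -> psi z <= K) ->
  forall z, Y <= Im z -> psi z <= T ^+ r / (lam ^+ k * (1 - T)) * K.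
Proof.
move=> hK z zY; have p0 := @pi_gt0 R; have p3 := @pi_ge312 R.
set y := Im z; have y0 : 0 < y by rewrite /y; lra.
have K0 : 0 <= K.
  by apply: le_trans (hK z y0); rewrite mulr_ge0 ?sqr_ge0 // exprn_ge0 // ltW.
have ly0 : 0 < lam * y by rewrite mulr_gt0.
have lk0 : 0 < (lam * y) ^+ k by rewrite exprn_gt0.
have t1 : 0 < 1 - T by rewrite subr_gt0.
pose G := Num.sqrt (K / (lam * y) ^+ k).
have GG : G ^+ 2 = K / (lam * y) ^+ k by rewrite sqr_sqrtr // divr_ge0 // ltW.
pose rho := expR (- (2 * pi * (lam * y))); pose sig := expR (- (2 * pi * ((1 - lam) * y))).
have rho0 : 0 < rho := expR_gt0 _; have sig0 : 0 < sig := expR_gt0 _.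
have rho1 : rho < 1 by rewrite expR_lt1 oppr_lt0 !mulr_gt0.
have bes n : \sum_(m < n) (cn (a m) * rho ^+ m) ^+ 2 <= K / (lam * y) ^+ k.
  rewrite -GG; have := @bessel R a rho G n (proj1 Ma); rewrite (ltW rho0) rho1 => /(_ isT) H.
  apply: le_trans (H _) => [|x].
    by apply: ler_sum => m _; rewrite cnM cnX cn_real (gtr0_norm rho0).
  rewrite -qq_split -(ler_pXn2r (n := 2)) ?nnegrE ?cn_ge0 ?sqrtr_ge0 // GG ler_pdivlMr //.
  exact: (hK (x +i* (lam * y))).
have sT : sig ^+ 2 <= T.
  apply: le_trans hT; rewrite -expRM_natl ler_expR.
  have l1 : 0 < 1 - lam by rewrite subr_gt0.
  have py : 312 / 100 * Y <= pi * y by apply: ler_pM => //; lra.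
  have : 312 / 100 * Y * (1 - lam) <= pi * y * (1 - lam) by rewrite ler_wpM2r // ltW.
  lra.
have := @cauchy_schwarz_csum R (fun m => a m * qq z ^+ m) (fun m => cn (a m) * rho ^+ m)
  (fun m => if (m < r)%N then 0 else sig ^+ m) (K / (lam * y) ^+ k) (T ^+ r / (1 - T)).
rewrite -/(ps a (qq z)) => H.
apply: le_trans (_ : (K / (lam * y) ^+ k * (T ^+ r / (1 - T))) * y ^+ k <= _).
  rewrite ler_wpM2r ?exprn_ge0 ?(ltW y0) //; apply: H => //.
  - exact: (proj1 Ma _ (cn_qq_lt1 y0)).
  - by move=> i; rewrite mulr_ge0 ?cn_ge0 // exprn_ge0 // ltW.
  - by move=> i; case: ifP => // _; rewrite exprn_ge0 // ltW.
  - move=> i; case: ifP => [ir|_]; first by rewrite a0 // mul0r cn0 mulr0.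
    rewrite cnM cnX cn_qq -[X in _ <= X]mulrA -exprMn -expRD ler_wpM2l ?cn_ge0 // le_eqVlt; apply/orP; left.
    by apply/eqP; congr (expR _ ^+ i); rewrite -/y; ring.
  - move=> n; apply: le_trans (@tail_geom (sig ^+ 2) n _); last by rewrite sqr_ge0 sT.
    by apply: ler_sum => i _; case: ifP => _; rewrite ?expr0n // -!exprM mulnC.
rewrite exprMn le_eqVlt; apply/orP; left; apply/eqP.
have yk : y ^+ k != 0 by rewrite expf_neq0 // gt_eqF.
have lk : lam ^+ k != 0 by rewrite expf_neq0 // gt_eqF.
have tn : 1 - T != 0 by rewrite gt_eqF.
by move: (y ^+ k) (lam ^+ k) (T ^+ r) yk lk => A B D A0 B0; field; rewrite A0 B0 tn.
Qed.

(** The constant coefficient vanishes because r > 0, so the series decays like exp (- 2 pi Im z),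
    which outweighs the power of Im z. *)
Lemma psi_bound0 : exists K : R, forall z, Y <= Im z -> psi z <= K.
Proof.
have p0 := @pi_gt0 R; have p3 := @pi_ge312 R.
have [K1 K10 hK1] := @poly_le_exp R 1 k ltr01.
have e1 : cn (expR (- pi))%:C < 1 :> R.
  by rewrite cn_real ger0_norm ?expR_ge0 // expR_lt1; lra.
have [A hA] := proj1 Ma _ e1.
have A0 : 0 <= A by have := hA [::] isT; rewrite big_nil.
exists ((expR pi * A) ^+ 2 * K1) => z zY; set y := Im z; have y0 : 0 < y by rewrite /y; lra.
have fb : cn (F z) <= expR (- (2 * pi * y)) * (expR pi * A).
  apply: cn_csum_le => s us; rewrite mulrA -expRD.
  apply: le_trans (_ : \sum_(i <- s) expR (- (2 * pi * y) + pi) * cn (a i * (expR (- pi))%:C ^+ i) <= _).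
    apply: ler_sum => -[|i] _; first by rewrite a0 // !mul0r cn0 mulr0.
    rewrite !cnM !cnX cn_qq cn_real (ger0_norm (expR_ge0 _)) mulrCA ler_wpM2l ?cn_ge0 //.
    rewrite -!expRM_natl -expRD ler_expR -/y.
    have i1 : 0 <= i%:R :> R by [].
    have : 0 <= i%:R * (pi * (2 * y - 1)) by rewrite !mulr_ge0 ?(ltW p0) //; rewrite /y; lra.
    by rewrite -(natr1 i); move: (i%:R) => x; lra.
  by rewrite -mulr_sumr ler_wpM2l ?expR_ge0 // hA.
have fb2 : cn (F z) ^+ 2 <= expR (- (2 * pi * y)) ^+ 2 * (expR pi * A) ^+ 2.
  rewrite -exprMn ler_pXn2r ?nnegrE ?cn_ge0 //.
  by rewrite !mulr_ge0 ?expR_ge0.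
have yk : y ^+ k <= K1 * expR (1 * y).
  apply: le_trans (hK1 y (ltW y0)); rewrite lerXn2r ?nnegrE ?(ltW y0) //; lra.
apply: le_trans (_ : (expR (- (2 * pi * y)) ^+ 2 * (expR pi * A) ^+ 2) * (K1 * expR (1 * y)) <= _).
  by apply: ler_pM => //; rewrite ?sqr_ge0 // exprn_ge0 // ltW.
have -> : expR (- (2 * pi * y)) ^+ 2 * (expR pi * A) ^+ 2 * (K1 * expR (1 * y)) =
  (expR pi * A) ^+ 2 * K1 * (expR (- (2 * pi * y)) ^+ 2 * expR (1 * y)) by ring.
rewrite ler_piMr //; first by rewrite mulr_ge0 ?sqr_ge0 ?(ltW K10).
rewrite -expRM_natl -expRD -[X in _ <= X]expR0 ler_expR.
have : 3 * y <= pi * y by rewrite ler_wpM2r ?(ltW y0) //; lra.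
lra.
Qed.

Lemma psi_inv z : 0 < Im z -> psi (- z^-1) = psi z.
Proof.
move=> z0; have [ez zi] := Im_oppV z0; rewrite (proj2 Ma z z0) ez cnM cnX.
have c0 : cn z != 0.
  by rewrite cn_eq0; apply/eqP => zz; move: z0; rewrite zz /= ltxx.
rewrite exprMn expr_div_n -exprM mulnC exprM.
have := expf_neq0 k (expf_neq0 2 c0); move: ((cn z ^+ 2) ^+ k) => w w0; by field.
Qed.

(** A point below height Y is translated to |Re| <= 1/2 and inverted, which divides its height by at
    most 1/4 + 0.865^2 < 999/1000. Taking Y a little below sqrt 3 / 2 makes this gain uniform, so
    finitely many steps reach height Y. *)
Lemma psi_fundamental (K : R) : (forall z, Y <= Im z -> psi z <= K) ->
  forall z, 0 < Im z -> psi z <= K.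
Proof.
move=> hK.
have [c01 c0 Y0 Y1 YY] : [/\ 0 <= (999 / 1000 : R) < 1, 0 < 999 / 1000 :> R, 0 < Y, Y <= 1 &
    1 / 4 + Y ^+ 2 <= 999 / 1000] by rewrite expr2; split; lra.
suff key n : forall z, Y * (999 / 1000) ^+ n <= Im z -> psi z <= K.
  move=> z z0; have [n hn] := expr_lt_eps c01 z0; apply: (key n).
  apply: le_trans (ltW hn); rewrite ler_piMl ?exprn_ge0 ?(ltW c0) //.
elim: n => [|n IH] z hz; first by apply: hK; move: hz; rewrite expr0 mulr1.
have [zY|zY] := lerP Y (Im z); first exact: hK.
have y0 : 0 < Im z by apply: lt_le_trans hz; rewrite mulr_gt0 ?exprn_gt0 //.
have [j hj] := near_int (Re z); pose w := z + (- j)%:~R.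
have Fw : psi w = psi z by rewrite qqD_int /w cImD intC /= addr0.
have Iw : Im w = Im z by rewrite /w cImD intC /= addr0.
have Rw : Re w = Re z - j%:~R by rewrite /w cReD intC /= rmorphN.
have w0 : 0 < Im w by rewrite Iw.
have c2 : cn w ^+ 2 <= 999 / 1000.
  rewrite sqr_cn Iw Rw.
  have : Im z ^+ 2 <= Y ^+ 2 by rewrite lerXn2r ?nnegrE ?(ltW Y0) //; exact: ltW.
  by move=> h; apply: le_trans (lerD hj h) _.
have c20 : 0 < cn w ^+ 2 by rewrite sqr_cn ltr_wpDl ?sqr_ge0 ?exprn_gt0.
rewrite -Fw -psi_inv //; apply: IH; have [-> _] := Im_oppV w0; rewrite Iw ler_pdivlMr //.
have hz' : Y * (999 / 1000) ^+ n * (999 / 1000) <= Im z by rewrite -mulrA -exprSr.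
apply: le_trans hz'; by rewrite ler_wpM2l // mulr_ge0 ?exprn_ge0 ?(ltW Y0) ?(ltW c0) //.
Qed.

(** The contraction is applied above height Y and spread to the whole half plane by invariance, over
    and over, so psi is bounded by every th0^n K0 and must be 0. *)
Theorem vanishing m : a m = 0.
Proof.
apply: ps_eq0 => [|z z0]; first exact: (proj1 Ma).
have [K0 hK0] := psi_bound0; have h0 := psi_fundamental hK0.
have t1 : 0 < 1 - T by rewrite subr_gt0.
have lk : 0 < lam ^+ k * (1 - T) by rewrite mulr_gt0 ?exprn_gt0.
pose th0 := T ^+ r / (lam ^+ k * (1 - T)).
have th01 : 0 <= th0 < 1.
  by rewrite divr_ge0 ?(ltW lk) ?exprn_ge0 ?(ltW T0) //= ltr_pdivrMr // mul1r.
have it n : forall w, 0 < Im w -> psi w <= th0 ^+ n * K0.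
  elim: n => [|n IH]; first by move=> w; rewrite expr0 mul1r; exact: h0.
  apply: psi_fundamental => w wY; rewrite (exprS th0) -(mulrA th0); exact: (psi_contract IH wY).
have K00 : 0 <= K0.
  by apply: le_trans (h0 z z0); rewrite mulr_ge0 ?sqr_ge0 // exprn_ge0 // ltW.
have P0 : psi z <= 0.
  apply/ler_addgt0Pr => e e0; rewrite add0r.
  have eK : 0 < e / (K0 + 1) by apply: divr_gt0 => //; lra.
  have [n hn] := expr_lt_eps th01 eK.
  apply: le_trans (it n z z0) _; apply: le_trans (_ : e / (K0 + 1) * K0 <= _).
    by rewrite ler_wpM2r // ltW.
  by rewrite mulrAC ler_pdivrMr; [rewrite ler_wpM2l ?(ltW e0) //; lra | lra].
apply/eqP; rewrite -cn_eq0 -sqrf_eq0 eq_le sqr_ge0 andbT.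
by rewrite -(pmulr_lle0 _ (exprn_gt0 k z0)).
Qed.

End Vanishing.

(** * Theta series of even selfdual lattices *)

Section LatticeSums.
Variables (R : realType) (n : nat).
Local Notation C := R[i].
Implicit Types (L : 'rV[R]_n -> Prop) (P : {mpoly R[n]}).

Lemma zr_inj : injective (@zr R n).
Proof.
move=> x y /matrixP h; apply/matrixP => i j; have := h i j; rewrite !mxE => /eqP.
by rewrite eqr_int => /eqP.
Qed.

Lemma basis_inj (B : 'M[R]_n) : B \in unitmx -> injective (fun z : 'rV[int]_n => zr R z *m B).
Proof.
move=> uB x y /(congr1 (mulmx^~ (invmx B))) /=; rewrite !mulmxK //; exact: zr_inj.
Qed.

(** Indexed by the vectors themselves and not by coordinates, so that for a selfdual lattice the
    series over a basis and over its dual basis are the same sum. *)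
Definition latsum L (u : 'rV[R]_n -> C) : C := csum (fun x : 'rV[R]_n => if `[< L x >] then u x else 0).

Definition lsumm L (u : 'rV[R]_n -> C) := summ (fun x : 'rV[R]_n => if `[< L x >] then u x else 0).

Definition basis_of L (B : 'M[R]_n) := B \in unitmx /\
  forall x, L x <-> exists z : 'rV[int]_n, x = zr R z *m B.

Lemma latsum_basis L B u : basis_of L B ->
  (lsumm L u <-> summ (fun z : 'rV[int]_n => u (zr R z *m B))) /\
  (lsumm L u -> latsum L u = csum (fun z : 'rV[int]_n => u (zr R z *m B))).
Proof.
move=> [uB hB]; pose v := fun x => if `[< L x >] then u x else 0.
have e : (v \o (fun z : 'rV[int]_n => zr R z *m B)) = (fun z : 'rV[int]_n => u (zr R z *m B)).
  apply: funext => z; rewrite /v /=; case: asboolP => // -[]; apply/hB; by exists z.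
have := @csum_inj R _ _ (fun z : 'rV[int]_n => zr R z *m B) v (basis_inj uB); rewrite e; apply.
move=> x hx; rewrite /v; case: asboolP => // /hB[z xz]; by case: (hx z).
Qed.

Lemma selfdual_basis L B : basis_of L B -> selfdual L -> basis_of L (invmx B)^T.
Proof.
move=> [uB hB] sd; have uD : (invmx B)^T \in unitmx by rewrite unitmx_tr unitmx_inv.
split=> // x; split.
  move=> /sd hx.
  have hi i : exists z : int, dotv (row i B) x = z%:~R.
    apply: hx; apply/hB; exists (delta_mx 0 i); rewrite rowE; congr (_ *m _).
    by apply/matrixP => a b; rewrite !mxE; case: (_ && _).
  have [f hf] := choice hi; exists (\row_i f i); apply: (can_inj (mulmxK (_ : B^T \in unitmx))) => //.
    by rewrite unitmx_tr.
  rewrite -mulmxA -trmx_mul mulmxV // trmx1 mulmx1; apply/rowP => i.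
  by rewrite !mxE -hf /dotv; apply: eq_bigr => j _; rewrite !mxE mulrC.
move=> [w ->]; apply/sd => y /hB[z ->].
rewrite dotv_mulmx -mulmxA -trmx_mul mulmxV // trmx1 mulmx1.
exists (\sum_i z 0 i * w 0 i); rewrite /dotv rmorph_sum; apply: eq_bigr => i _.
by rewrite !mxE -rmorphM.
Qed.

Lemma lsumm_poly_th L B P lam : basis_of L B -> half lam ->
  lsumm L (fun x => (evalv P x)%:C * th lam (nrm x)).
Proof.
move=> hB hl; have [[_ h] _] := latsum_basis (fun x => (evalv P x)%:C * th lam (nrm x)) hB; apply: h.
have := summ_poly_th P 0 (proj1 hB) hl; congr summ; apply: funext => z; by rewrite addr0.
Qed.

Lemma half1 : half (1 : C).
Proof. by rewrite /half /= normr0 ltr01. Qed.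

Lemma th_nat (lam : C) (m : nat) : th lam (2 * m)%:R = th lam 2 ^+ m.
Proof.
elim: m => [|m IH]; first by rewrite muln0 /th mulr0 cexp0 expr0.
by rewrite mulnS natrD thD IH exprS.
Qed.

Lemma even_norm L x : even_lattice L -> L x -> exists m : nat, nrm x = (2 * m)%:R.
Proof.
move=> ev /ev[z hz]; have := nrm_ge0 x; rewrite /nrm hz ler0z => z0.
exists `|z|%N; rewrite natrM -[2 * z]/(2%:Z * z)%R intrM; congr (_ * _).
by rewrite pmulrn gez0_abs //; lia.
Qed.

Definition shellsum L P (m : nat) : C :=
  latsum (shell L (2 * m)%:R) (fun x => (evalv P x)%:C).

(** Each vector of the shell contributes exp (- pi r) to a summable theta series. This bounds the
    length of any list of distinct shell vectors, and a list of maximal length exhausts the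
    shell. *)
Lemma shell_finite L B (r : R) : basis_of L B -> exists2 s : seq 'rV[R]_n, uniq s &
  forall x, shell L r x <-> x \in s.
Proof.
move=> hB; have h1 := half1.
have [A hA] := lsumm_poly_th 1 hB h1.
pose e := expR (- (pi * r)); have e0 : 0 < e := expR_gt0 _.
pose good (s : seq 'rV[R]_n) := uniq s /\ forall x, x \in s -> shell L r x.
have bnd s : good s -> (size s)%:R <= A / e.
  move=> [us hs]; rewrite ler_pdivlMr //; apply: le_trans (hA s us).
  rewrite (_ : _ * e = \sum_(x <- s) e); last by rewrite big_const_seq count_predT iter_addr addr0 mulr_natl.
  rewrite !big_seq; apply: ler_sum => x xs; have [Lx nx] := hs x xs.
  case: asboolP => // _; rewrite cnM cn_th cn_real /evalv meval1 normr1 mul1r.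
  by rewrite /nrm nx expr1n /= mulr1 /e mulNr.
have [N hN] : exists N : nat, forall s, good s -> (size s <= N)%N.
  exists (Num.trunc (A / e)) => s /bnd h; rewrite leqNgt; apply/negP => h2.
  have := truncnS_gt (A / e); rewrite ltNge; case/negP.
  by apply: le_trans h; rewrite ler_nat.
pose Q k := `[< exists2 s, good s & size s = k >].
have Q0 : exists k, Q k by exists 0%N; apply/asboolP; exists [::].
have QN k : Q k -> (k <= N)%N by move=> /asboolP[s gs <-]; exact: hN.
case: (ex_maxnP Q0 QN) => k /asboolP[s [us hs] sk] kmax.
exists s => // x; split; last exact: hs.
move=> hx; apply/negPn/negP => xs.
have : Q (size (x :: s)).
  apply/asboolP; exists (x :: s) => //; split; first by rewrite /= xs.
  by move=> y; rewrite inE => /orP[/eqP ->|/hs].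
by move=> /kmax; rewrite /= sk ltnn.
Qed.

Lemma shellsum_seq L P m s : uniq s -> (forall x, shell L (2 * m)%:R x <-> x \in s) ->
  shellsum L P m = (\sum_(x <- s) evalv P x)%:C.
Proof.
move=> us hs; rewrite /shellsum /latsum; set v := (fun x => _).
have vz x : x \notin s -> v x = 0.
  by rewrite /v; case: asboolP => // /hs ->.
have [_ ->] := csum_fin us vz; rewrite rmorph_sum /= !big_seq; apply: eq_bigr => x xs.
by rewrite /v; case: asboolP => // -[]; apply/hs.
Qed.

(** Summation by fibres of half the norm. Truncation makes half the norm a map to [nat] on the whole
    space, and evenness makes it exact on L. *)
Lemma theta_qseries L B P lam : basis_of L B -> even_lattice L -> half lam ->
  summ (fun m => shellsum L P m * th lam 2 ^+ m) /\
  latsum L (fun x => (evalv P x)%:C * th lam (nrm x)) = ps (shellsum L P) (th lam 2).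
Proof.
move=> hB ev hl; have := lsumm_poly_th P hB hl; rewrite /lsumm /latsum.
set u := (fun x => _) => su.
have [s1 e1] := csum_fibers (fun x => Num.trunc (nrm x / 2)) su.
have key m : csum (fun x => if Num.trunc (nrm x / 2) == m then u x else 0) = shellsum L P m * th lam 2 ^+ m.
  have [s us hs] := shell_finite (2 * m)%:R hB.
  rewrite (shellsum_seq P us hs); set v := (fun x => _).
  have vE x : v x = if x \in s then (evalv P x)%:C * th lam 2 ^+ m else 0.
    rewrite /v /u; have [xs|/negP xs] := boolP (x \in s).
      have [Lx nx] := proj2 (hs x) xs.
      rewrite /nrm nx natrM mulrC mulKf ?pnatr_eq0 // natrK.
      by rewrite eqxx; case: asboolP => // _; rewrite -natrM th_nat.
    case: asboolP => [Lx|_]; last by case: ifP.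
    case: eqP => // tm; case: xs; apply/hs; split => //.
    have [k hk] := even_norm ev Lx; move: tm; rewrite hk natrM mulrC mulKf ?pnatr_eq0 // natrK.
    by move=> <-; rewrite -/(nrm x) hk natrM.
  have vz x : x \notin s -> v x = 0 by rewrite vE => /negbTE ->.
  have [_ ->] := csum_fin us vz; rewrite rmorph_sum /= mulr_suml !big_seq.
  by apply: eq_bigr => x xs; rewrite vE xs.
by rewrite /ps -(funext key).
Qed.

Lemma half_sqrt (t : C) : 0 < Re t -> exists2 lam, half lam & lam ^+ 2 = t.
Proof.
move=> t0; pose c := cn t; have ct : `|Re t| <= c := abs_Re_le t.
have cc : c ^+ 2 = Re t ^+ 2 + Im t ^+ 2 by exact: sqr_cn.
have ctp : Re t <= c by rewrite (le_trans _ ct) // ler_norm.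
pose x := Num.sqrt ((c + Re t) / 2).
have x2 : x ^+ 2 = (c + Re t) / 2 by rewrite sqr_sqrtr //; lra.
have x0 : 0 < x by rewrite sqrtr_gt0; lra.
pose y := Im t / (2 * x).
have xy : 2 * x * y = Im t by rewrite /y; field; exact: lt0r_neq0.
have y2 : y ^+ 2 = (c - Re t) / 2.
  have : 4 * x ^+ 2 * y ^+ 2 = Im t ^+ 2 by rewrite -xy; ring.
  rewrite x2 (_ : Im t ^+ 2 = (c + Re t) * (c - Re t)); last first.
    by rewrite -[Im t ^+ 2](addKr (Re t ^+ 2)) -cc; ring.
  rewrite (_ : 4 * ((c + Re t) / 2) * y ^+ 2 = (c + Re t) * (2 * y ^+ 2)); last by field.
  have cn0 : c + Re t != 0 by rewrite gt_eqF //; lra.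
  by move=> /(mulfI cn0) <-; field.
exists (x +i* y).
  rewrite /half /= -(ltr_pXn2r (n := 2)) ?nnegrE ?normr_ge0 ?(ltW x0) //.
  by rewrite real_normK ?num_real // y2 x2; lra.
apply: complex_eqP; rewrite expr2 ?cReM ?cImM /=.
  by rewrite -!expr2 x2 y2; field.
by rewrite -xy; ring.
Qed.

Lemma th_qq (lam z : C) : lam ^+ 2 = - 'i * z -> th lam 2 = qq z.
Proof. by rewrite /th /qq => ->; congr cexp; rewrite rmorphM /= !rmorph_nat; ring. Qed.

Lemma qq_onto (q : C) (rho : R) : 0 < rho < 1 -> exists2 z : C, 0 < Im z & cn (qq z) = rho.
Proof.
move=> /andP[r0 r1]; have p0 := @pi_gt0 R; exists (0 +i* (- ln rho / (2 * pi))) => /=.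
  by rewrite divr_gt0 ?mulr_gt0 // oppr_gt0 ln_lt0 // r0.
rewrite cn_qq /= -[RHS]lnK ?posrE //; congr expR.
by have := lt0r_neq0 p0; move: (pi : R) => p pn; field.
Qed.

(** At lam = 1 the terms are positive and the origin contributes 1. This lets the series be
    cancelled when the constant of the transformation formula is determined. *)
Lemma theta_one_neq0 L B : basis_of L B -> latsum L (fun x => (evalv 1 x)%:C * th 1 (nrm x)) != 0.
Proof.
move=> hB; set S := latsum _ _; have h1 := half1.
apply/eqP => S0.
have := @csum_real_ge R 'rV[R]_n (fun x => if `[< L x >] then expR (- pi * nrm x) else 0) 0.
have e : (fun x : 'rV[R]_n => (if `[< L x >] then expR (- pi * nrm x) else 0)%:C) =
   (fun x => if `[< L x >] then (evalv 1 x)%:C * th 1 (nrm x) else 0).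
  apply: funext => x; case: asboolP => // _; rewrite /evalv meval1 mul1r /th expr1n mulr1.
  by rewrite -cexp_real; congr cexp; rewrite rmorphM rmorphN.
rewrite e -[csum _]/S S0 /=.
have L0 : L 0 by apply/(proj2 hB); exists 0; rewrite (_ : zr R 0 = 0) ?mul0mx //; apply/matrixP => ? ?; rewrite !mxE.
case: asboolP => // _ H; suff : 1 <= 0 :> R by rewrite ler10.
apply: le_trans (H _ _) => [|x|].
- by rewrite (_ : nrm 0 = 0) ?mulr0 ?expR0 // /nrm /dotv big1 // => i _; rewrite mxE mul0r.
- by case: ifP => // _; exact: expR_ge0.
- exact: lsumm_poly_th hB h1.
Qed.

Theorem theta_MF L P (h j : nat) : n = (8 * h)%N -> even_selfdual_lattice L ->
  P \is j.-homog -> harmonic P -> MF (4 * h + j) (shellsum L P).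
Proof.
move=> nh [[B hB] sd ev] hP hH; have {}hB : basis_of L B := hB.
have hD := selfdual_basis hB sd.
have h1 := half1.
have i2 : 'i ^+ 2 = -1 :> C by exact: sqr_i.
have lat (Q : {mpoly R[n]}) lam B' : basis_of L B' -> half lam ->
    csum (fun z : 'rV[int]_n => (evalv Q (zr R z *m B'))%:C * th lam (nrm (zr R z *m B'))) =
    latsum L (fun x => (evalv Q x)%:C * th lam (nrm x)).
  move=> hB' hl.
  have [_ ->//] := latsum_basis (fun x => (evalv Q x)%:C * th lam (nrm x)) hB'.
  exact: lsumm_poly_th hB' hl.
have [K hK] := theta_harmonic (proj1 hB).
have tr jj (Q : {mpoly R[n]}) lam : Q \is jj.-homog -> harmonic Q -> half lam ->
   latsum L (fun x => (evalv Q x)%:C * th lam (nrm x)) =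
   lam^-1 ^+ n * K%:C * (- 'i / lam ^+ 2) ^+ jj * latsum L (fun x => (evalv Q x)%:C * th lam^-1 (nrm x)).
  move=> hQ hHQ hl; have := hK jj Q lam 0 hQ hHQ hl.
  rewrite -(lat Q lam B hB hl) -(lat Q lam^-1 _ hD (halfV hl)).
  rewrite (eq_csum (v := fun z => (evalv Q (zr R z *m B))%:C * th lam (nrm (zr R z *m B)))); last first.
    by move=> z; rewrite addr0.
  move=> ->; congr (_ * _); apply: eq_csum => w.
  by rewrite -(scale0r 0) dotvZr mul0r ce0 mulr1.
(* For P = 1 and lam = 1 the formula relates a nonzero number to itself; this encodes that a
   selfdual lattice has covolume 1. *)
have K1 : K%:C = 1 :> C.
  have hom1 : (1 : {mpoly R[n]}) \is 0.-homog by exact: dhomog1.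
  have har1 : harmonic (1 : {mpoly R[n]}).
    by rewrite /harmonic /laplacian big1 // => i _; rewrite -mpolyC1 mderivC mderiv0.
  have := tr 0%N 1 1 hom1 har1 h1; rewrite invr1 expr1n mul1r expr0 mulr1.
  set S := latsum _ _ => E.
  have S0 : S != 0 := theta_one_neq0 hB.
  by apply: (mulIf S0); rewrite mul1r -E.
have in0 : 'i != 0 :> C by apply/eqP => /(congr1 (@Im R)) /eqP; rewrite /= oner_eq0.
have iV : ('i : C)^-1 = - 'i by apply: (mulfI in0); rewrite divff // mulrN -expr2 i2 opprK.
have zlam (z : C) : 0 < Im z -> exists2 lam, half lam & lam ^+ 2 = - 'i * z.
  by move=> z0; apply: half_sqrt; case: z z0 => x y /= y0; rewrite !(mul0r, mul1r, oppr0, sub0r, add0r, opprK, mulN1r).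
split.
  move=> q q1; have [q0|qn0] := eqVneq q 0.
    have z0 m : m \notin [:: 0%N] -> shellsum L P m * q ^+ m = 0.
      by rewrite inE q0 => m0; rewrite expr0n (negbTE m0) mulr0.
    by have [] := csum_fin (isT : uniq [:: 0%N]) z0.
  (* Absolute summability depends only on |q|, so a point z with the same modulus is enough. *)
  have [z z0 qz] := @qq_onto q (cn q) (ltac:(by rewrite q1 lt_neqAle eq_sym cn_eq0 qn0 cn_ge0)).
  have [lam hl lz] := zlam z z0; have [s _] := theta_qseries P hB ev hl.
  apply: (summ_dom s) => m; rewrite !cnM !cnX -qz (th_qq lz) //.
move=> z z0; have [lam hl lz] := zlam z z0; have [_ zi] := Im_oppV z0.
have zn0 : z != 0 by apply/eqP => zz; move: z0; rewrite zz /= ltxx.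
have lzi : lam^-1 ^+ 2 = - 'i * (- z^-1).
  by rewrite exprVn lz invfM invrN iV; ring.
have := tr j P lam hP hH hl.
have [_ ->] := theta_qseries P hB ev hl; have [_ ->] := theta_qseries P hB ev (halfV hl).
rewrite (th_qq lz) (th_qq lzi) K1 mulr1 lz => ->.
rewrite nh (_ : (8 * h = 2 * (4 * h))%N); last by lia.
rewrite exprVn exprM lz.
have -> : - 'i / (- 'i * z) = z^-1 by rewrite invfM mulrA divff ?mul1r // oppr_eq0.
(* Divisibility of the rank by 8 makes the exponent a multiple of 4, which removes the root of
   unity. *)
have -> : (- 'i * z) ^+ (4 * h) = z ^+ (4 * h).
  by rewrite !exprM; congr (_ ^+ h); rewrite exprMn (_ : (- 'i) ^+ 4 = 1) ?mul1r //; ring: i2.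
rewrite mulrA exprD exprVn mulrA (_ : _ * _ / _ / _ = 1) ?mul1r //.
have := expf_neq0 (4 * h) zn0; have := expf_neq0 j zn0.
move: (z ^+ (4 * h)) (z ^+ j) => p r r0 p0; field; by rewrite p0 r0.
Qed.

End LatticeSums.

(** * Cusp forms of small weight *)

Section CuspForms.
Variable R : realType.
Local Notation C := R[i].
Implicit Types (a b : nat -> C).

(** For numerical lower bounds on exp: the argument is halved until 1 + x <= exp x is accurate, and
    each application squares a rounded value. *)
Lemma expR_double (x b c : R) : 0 <= b -> b <= expR (x / 2) -> c <= b * b -> c <= expR x.
Proof.
move=> b0 h h2; apply: le_trans h2 _; rewrite (_ : x = x / 2 + x / 2); last by field.
by rewrite expRD; apply: ler_pM.
Qed.

Lemma expR_ge12 : 12 <= expR (10795 / 1000 * (1 / 4) : R).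
Proof.
apply: (@expR_double _ (3625 / 1000)); [lra| |lra].
apply: (@expR_double _ (1904 / 1000)); [lra| |lra].
apply: (@expR_double _ (1380 / 1000)); [lra| |lra].
apply: (@expR_double _ (1175 / 1000)); [lra| |lra].
apply: (@expR_double _ (1084 / 1000)); [lra| |lra].
by apply: le_trans (expR_ge1Dx _); lra.
Qed.

Lemma expR_ge588 : 100 / 17 <= expR (10795 / 1000 * (1 / 6) : R).
Proof.
apply: (@expR_double _ (2 + 4295 / 10000)); [lra| |lra].
apply: (@expR_double _ (1 + 5587 / 10000)); [lra| |lra].
apply: (@expR_double _ (1 + 2485 / 10000)); [lra| |lra].
apply: (@expR_double _ (1 + 1174 / 10000)); [lra| |lra].
apply: (@expR_double _ (1 + 571 / 10000)); [lra| |lra].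
apply: (@expR_double _ (1 + 282 / 10000)); [lra| |lra].
apply: (@expR_double _ (1 + 281 / 20000)); [lra| |lra].
by apply: le_trans (expR_ge1Dx _); lra.
Qed.

Lemma expRN_le (x b : R) : 0 < b -> b^-1 <= expR x -> expR (- x) <= b.
Proof. by move=> b0 h; rewrite expRN -[b]invrK lef_pV2 ?posrE ?invr_gt0 ?expR_gt0. Qed.

(** Since lam^k <= exp (- k (1 - lam)), the hypotheses of [vanishing] force k < 10.795 r. With r = 1
    weight 8 leaves enough room, at lam = 3/4 and T = 1/12, whereas weight 14 is out of reach. *)
Lemma cusp8_eq0 a : MF 8 a -> a 0%N = 0 -> forall m, a m = 0.
Proof.
move=> Ma a0; apply: (@vanishing R 8 1 (3 / 4) (1 / 12) a _ _ _ _ _ _ isT Ma); [lra|lra|lra|lra| | |by case].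
- apply: expRN_le; first lra.
  apply: le_trans (_ : 12 <= _); first lra.
  by apply: le_trans expR_ge12 _; rewrite ler_expR; lra.
- by lra.
Qed.

Lemma cusp12_eq0 a : MF 12 a -> a 0%N = 0 -> a 1%N = 0 -> forall m, a m = 0.
Proof.
move=> Ma a0 a1; apply: (@vanishing R 12 2 (1 / 2) (1 / 100) a _ _ _ _ _ _ isT Ma); [lra|lra|lra|lra| | |by case=> [|[]]].
- apply: expRN_le; first lra.
  apply: le_trans (_ : 144 <= _); first lra.
  by apply: (@expR_double _ 12); [lra | apply: le_trans expR_ge12 _; rewrite ler_expR; lra | lra].
- by lra.
Qed.

(** The margin is narrow: (17/100)^3 is about 0.00491, against about 0.00504 for (5/6)^28 . 83/100.
    Hence the finer bound [expR_ge588] on exp. *)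
Lemma cusp28_eq0 a : MF 28 a -> a 0%N = 0 -> a 1%N = 0 -> a 2%N = 0 -> forall m, a m = 0.
Proof.
move=> Ma a0 a1 a2; apply: (@vanishing R 28 3 (5 / 6) (17 / 100) a _ _ _ _ _ _ isT Ma); [lra|lra|lra|lra| | |by case=> [|[|[]]]].
- apply: expRN_le; first lra.
  apply: le_trans (_ : 100 / 17 <= _); first lra.
  by apply: le_trans expR_ge588 _; rewrite ler_expR; lra.
- by lra.
Qed.

Lemma convS0 a b : conv a b 0 = a 0%N * b 0%N.
Proof. by rewrite /conv big_ord1. Qed.

Lemma conv1 a b : conv a b 1 = a 0%N * b 1%N + a 1%N * b 0%N.
Proof. by rewrite /conv !big_ord_recl big_ord0 /= addr0. Qed.

Lemma conv2 a b : conv a b 2 = a 0%N * b 2%N + a 1%N * b 1%N + a 2%N * b 0%N.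
Proof. by rewrite /conv !big_ord_recl big_ord0 /= addr0 addrA. Qed.

Lemma ps_conv a b z : dser a -> dser b -> 0 < Im z ->
  ps (conv a b) (qq z) = ps a (qq z) * ps b (qq z).
Proof. by move=> da db z0; case: (conv_ps (da _ (cn_qq_lt1 z0)) (db _ (cn_qq_lt1 z0))). Qed.

Section WithDelta.
Variables (D E : nat -> C).
Hypotheses (MD : MF 12 D) (D0 : D 0%N = 0) (D1 : D 1%N = 1) (Di : ps D (qq 'i) != 0).
Hypotheses (ME : MF 4 E) (E0 : E 0%N = 1) (Ei : ps E (qq 'i) != 0).

Lemma cusp12_Delta a : MF 12 a -> a 0%N = 0 -> forall m, a m = a 1%N * D m.
Proof.
move=> Ma a0 m; have M := MF_lin 1 (- a 1%N) Ma MD.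
have := cusp12_eq0 M; rewrite a0 D0 D1 !mulr0 addr0 mul1r mulr1 subrr.
by move=> /(_ erefl erefl m)/eqP; rewrite mul1r mulNr subr_eq0 => /eqP.
Qed.

(* The square of a form of weight 14 has weight 28, where three vanishing coefficients suffice;
   it equals [a_1^2 Delta^2 E_4], whose value at [i] is nonzero while weight 14 forces [f(i) = 0]. *)
Lemma cusp14_eq0 a : MF 14 a -> a 0%N = 0 -> forall m, a m = 0.
Proof.
move=> Ma a0; have [da ta] := Ma; have [dD _] := MD; have [dE _] := ME.
have i0 : 0 < Im ('i : C) by rewrite /= ltr01.
have i2 : 'i ^+ 2 = -1 :> C by exact: sqr_i.
have in0 : 'i != 0 :> C by apply/eqP => /(congr1 (@Im R)) /eqP; rewrite /= oner_eq0.
have ii : - ('i : C)^-1 = 'i by apply: (mulfI in0); rewrite mulrN divff // -expr2 i2.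
have fi : ps a (qq 'i) = 0.
  have := ta 'i i0; rewrite ii.
  have -> : ('i : C) ^+ 14 = -1 by ring: i2.
  by rewrite mulN1r => /eqP; rewrite -subr_eq0 opprK -mulr2n -mulr_natl mulf_eq0 pnatr_eq0 /= => /eqP.
have Ms := MF_mul Ma Ma; have Mg := MF_mul (MF_mul MD MD) ME.
have M := MF_lin 1 (- (a 1%N ^+ 2)) Ms Mg.
have H := cusp28_eq0 M.
have {}H m : conv a a m = a 1%N ^+ 2 * conv (conv D D) E m.
  apply/eqP; rewrite -subr_eq0 -mulNr -[X in X + _]mul1r; apply/eqP; apply: H.
  - by rewrite !convS0 a0 D0; ring.
  - by rewrite !conv1 !convS0 a0 D0; ring.
  - by rewrite !conv2 !conv1 !convS0 a0 D0 D1 E0; ring.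
have Hps z : 0 < Im z -> ps a (qq z) ^+ 2 = a 1%N ^+ 2 * (ps D (qq z) ^+ 2 * ps E (qq z)).
  move=> z0; rewrite !expr2 -(ps_conv dD dD z0) -(ps_conv (dser_conv dD dD) dE z0) -(ps_conv da da z0) -expr2.
  rewrite /ps -csumZ; last exact: (dser_conv (dser_conv dD dD) dE (cn_qq_lt1 z0)).
  by apply: eq_csum => m; rewrite H mulrA.
have a1 : a 1%N = 0.
  have := Hps 'i i0; rewrite fi expr0n /= => /esym/eqP.
  by rewrite !mulf_eq0 (negbTE Di) (negbTE Ei) !orbF orbb => /eqP.
apply: (ps_eq0 da) => z z0; apply/eqP; rewrite -sqrf_eq0 Hps // a1 expr0n /= mul0r; exact: eqxx.
Qed.

(** E has constant coefficient 1, so convolution with it is injective; weights 6 and 10 climb to 14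
    in steps of 4. *)
Lemma cusp_lift k a : MF k a -> a 0%N = 0 ->
  (forall b, MF (k + 4) b -> b 0%N = 0 -> forall m, b m = 0) -> forall m, a m = 0.
Proof.
move=> Ma a0 h; apply: (@conv_eq0 _ a E); first by rewrite E0 oner_eq0.
by apply: h; [exact: MF_mul | rewrite convS0 a0 mul0r].
Qed.

Lemma cusp10_eq0 a : MF 10 a -> a 0%N = 0 -> forall m, a m = 0.
Proof. by move=> Ma a0; apply: (cusp_lift Ma a0); exact: cusp14_eq0. Qed.

Lemma cusp6_eq0 a : MF 6 a -> a 0%N = 0 -> forall m, a m = 0.
Proof. by move=> Ma a0; apply: (cusp_lift Ma a0); exact: cusp10_eq0. Qed.

End WithDelta.
End CuspForms.

(** * Jacobi's identity *)

Section JacobiIdentity.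
Local Notation P := {poly int}.

Definition tri (n : nat) : nat := 'C(n.+1, 2).

Lemma triS n : tri n.+1 = (tri n + n.+1)%N.
Proof. by rewrite /tri binS bin1. Qed.

Lemma tri0 : tri 0 = 0%N. Proof. by []. Qed.

Lemma leq_tri n : (n <= tri n)%N.
Proof. by elim: n => // n IH; rewrite triS; lia. Qed.

Lemma tri2 n : (2 * tri n)%N = (n * n.+1)%N.
Proof. by elim: n => // n IH; rewrite triS mulnDr IH; lia. Qed.

Definition qpoch (n : nat) : P := \prod_(1 <= k < n.+1) (1 - 'X^k).

Lemma qpochS n : qpoch n.+1 = qpoch n * (1 - 'X^(n.+1)).
Proof. by rewrite /qpoch big_nat_recr. Qed.

Lemma qpoch0 : qpoch 0 = 1.
Proof. by rewrite /qpoch big_geq. Qed.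

Lemma one_subX_neq0 k : (0 < k)%N -> 1 - 'X^k != 0 :> P.
Proof.
move=> k0; apply/eqP => /(congr1 (fun p : P => p`_0)); rewrite coefB coef1 coefXn coef0 eqxx.
by rewrite eq_sym (gtn_eqF k0).
Qed.

Lemma qpoch_neq0 n : qpoch n != 0.
Proof.
elim: n => [|n IH]; first by rewrite qpoch0 oner_eq0.
by rewrite qpochS mulf_neq0 // one_subX_neq0.
Qed.

(* [jacobi_bin N j] is the Gaussian binomial coefficient [2N+1 choose N-j]; at [j = 0] the
   index [j.-1] implements its symmetry under [j -> -1-j]. *)
Fixpoint jacobi_bin (N : nat) : nat -> P := match N with
  | 0 => fun j => (j == 0%N)%:R
  | M.+1 => fun j => 'X^(M + 2 + j) * jacobi_bin M j.+1 + (1 + 'X^(2 * M + 2)) * jacobi_bin M j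
      + 'X^(M.+1 - j) * jacobi_bin M j.-1 end.

Lemma jacobi_bin_out N j : (N < j)%N -> jacobi_bin N j = 0.
Proof.
elim: N j => [|N IH] [|j] //= h; rewrite !IH ?mulr0 ?addr0 //; lia.
Qed.

(** The three-term recurrence that defines [jacobi_bin] consists of two q-Pascal steps. Multiplying
    out the q-factorials keeps the product formula inside the polynomial ring. *)
Lemma jacobi_binE N j : (j <= N)%N ->
  jacobi_bin N j * (qpoch (N - j) * qpoch (N + j).+1) = qpoch (2 * N).+1.
Proof.
elim: N j => [|N IH] j; first by rewrite leqn0 => /eqP -> /=; rewrite qpoch0 !mul1r.
rewrite leq_eqVlt => /orP[/eqP ->|].
  rewrite /= (@jacobi_bin_out N N.+2) // (@jacobi_bin_out N N.+1) // !mulr0 !add0r.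
  rewrite subnn expr0 mul1r qpoch0 mul1r.
  have := IH N (leqnn N); rewrite subnn qpoch0 mul1r (_ : (N + N).+1 = (2 * N).+1); last by lia.
  have -> : (N.+1 + N.+1).+1 = (2 * N).+3 by lia.
  have -> : (2 * N.+1).+1 = (2 * N).+3 by lia.
  by rewrite (qpochS (2 * N).+2) (qpochS (2 * N).+1) => h; rewrite !mulrA h.
rewrite ltnS => jN.
pose Q := qpoch (2 * N).+1; pose x : P := 'X; pose A : P := 'X^(N - j); pose B : P := 'X^((N + j).+1).
have AB : A * B = 'X^((2 * N).+1) by rewrite -exprD; congr ('X^_); lia.
have E1 : qpoch (N.+1 - j) = qpoch (N - j) * (1 - x * A) by rewrite subSn // qpochS exprS.
have E2 : qpoch (N.+1 + j).+1 = qpoch (N + j).+1 * (1 - x * B) by rewrite addSn qpochS exprS.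
have EQ : qpoch (2 * N.+1).+1 = Q * ((1 - x * (A * B)) * (1 - x * (x * (A * B)))).
  have -> : (2 * N.+1).+1 = (2 * N).+3 by lia.
  by rewrite (qpochS (2 * N).+2) (qpochS (2 * N).+1) AB -!exprS mulrA.
rewrite E1 E2 EQ /=.
have t2 : jacobi_bin N j * (qpoch (N - j) * qpoch (N + j).+1) = Q by exact: IH.
have t1 : jacobi_bin N j.+1 * (qpoch (N - j) * qpoch (N + j).+1 * (1 - x * B)) = Q * (1 - A).
  case: (ltnP j N) => jN'; last first.
    rewrite jacobi_bin_out; last by lia.
    by rewrite /A (_ : N - j = 0)%N ?expr0 ?subrr ?mulr0 ?mul0r //; lia.
  have := IH j.+1 jN'; rewrite (_ : (N - j = (N - j.+1).+1)%N); last by lia.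
  rewrite (qpochS (N - j.+1)) addnS (qpochS (N + j).+1) (_ : 'X^((N - j.+1).+1) = A); last first.
    by congr ('X^_); lia.
  rewrite (exprS _ (N + j).+1) -/B -/Q -/x => <-; ring.
have t3 : jacobi_bin N j.-1 * (qpoch (N - j) * (1 - x * A) * qpoch (N + j).+1) = Q * (1 - B).
  case: (posnP j) => j0.
    move: t2; rewrite j0 /= subn0 addn0 /B j0 addn0 /A j0 subn0 => <-; rewrite /x exprS; ring.
  have := IH j.-1; rewrite (_ : (j.-1 <= N)%N = true); last by lia.
  move=> /(_ isT); rewrite (_ : (N - j.-1 = (N - j).+1)%N); last by lia.
  rewrite (_ : (N + j.-1).+1 = (N + j)%N); last by lia.
  rewrite (qpochS (N - j)) (qpochS (N + j)) -/B -/Q (exprS _ (N - j)) -/x -/A => <-; ring.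
have -> : 'X^(N + 2 + j) = x * B by rewrite -exprS; congr ('X^_); lia.
have -> : 'X^(N.+1 - j) = x * A by rewrite -exprS; congr ('X^_); lia.
have -> : 'X^(2 * N + 2) = x * (A * B) by rewrite AB -exprS; congr ('X^_); lia.
set q1 := qpoch (N - j) in t1 t2 t3 *; set q2 := qpoch (N + j).+1 in t1 t2 t3 *.
move: t1 t2 t3; move: (jacobi_bin N j.+1) (jacobi_bin N j) (jacobi_bin N j.-1) => a1 a2 a3 t1 t2 t3.
rewrite (_ : _ * _ = x * B * (1 - x * A) * (a1 * (q1 * q2 * (1 - x * B))) +
  (1 + x * (A * B)) * (1 - x * A) * (1 - x * B) * (a2 * (q1 * q2)) +
  x * A * (1 - x * B) * (a3 * (q1 * (1 - x * A) * q2))); last by ring.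
by rewrite t1 t2 t3; ring.
Qed.

Definition jcoef (j : nat) : int := (-1) ^+ j * (2 * j + 1)%:Z.

Definition jterm (j : nat) : P := (jcoef j)%:P * 'X^(tri j).

(** This is the derivative of the finite triple product at its zero z = 1. In the induction, after
    the index shifts of [S1] and [S3] the weights 2j - 1 and 2j + 3 add up to 2 (2j + 1), so the
    recurrence multiplies the sum by (1 - X^(N+1))^2. *)
Lemma jacobi_finite N M : (N < M)%N -> \sum_(j < M) jterm j * jacobi_bin N j = qpoch N ^+ 2.
Proof.
elim: N M => [|N IH] M NM.
  case: M NM => // M _; rewrite big_ord_recl /= big1 ?addr0; last by move=> i _; rewrite mulr0.
  by rewrite /jterm /jcoef expr0 mul1r mulr1 tri0 expr0 mulr1 qpoch0 expr1n.
pose d j : P := ((-1) ^+ j)%:P * 'X^(N.+1 + tri j).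
have S1 K : \sum_(j < K) jterm j * ('X^(N + 2 + j) * jacobi_bin N j.+1) =
    - \sum_(j < K.+1) (2 * j%:R - 1) * d j * jacobi_bin N j - d 0%N * jacobi_bin N 0.
  elim: K => [|K IHK]; first by rewrite big_ord0 big_ord1 /= mulr0; ring.
  rewrite big_ord_recr [in RHS]big_ord_recr /= IHK.
  suff -> : jterm K * ('X^(N + 2 + K) * jacobi_bin N K.+1) = - ((2 * K.+1%:R - 1) * d K.+1 * jacobi_bin N K.+1) by ring.
  rewrite /jterm /jcoef /d triS (_ : (N.+1 + (tri K + K.+1) = tri K + (N + 2 + K))%N); last by lia.
  rewrite (exprD _ (tri K)) (exprS _ K) !rmorphM /= polyCN polyC1 (_ : (2 * K + 1)%:Z%:P = 2 * K%:R + 1 :> P); last first.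
    by rewrite PoszD PoszM !rmorphD !rmorphM /= -!natz !rmorph_nat.
  by rewrite -(natr1 K); ring.
have S3 K : \sum_(j < K.+1) jterm j * ('X^(N.+1 - j) * jacobi_bin N j.-1) =
    d 0%N * jacobi_bin N 0 - \sum_(j < K) (2 * j%:R + 3) * d j * jacobi_bin N j.
  elim: K => [|K IHK].
    by rewrite big_ord0 big_ord1 /jterm /jcoef /d tri0 addn0 subn0 /= mulr1 mul1r; ring.
  rewrite big_ord_recr [in RHS]big_ord_recr /= IHK.
  suff -> : jterm K.+1 * ('X^(N.+1 - K.+1) * jacobi_bin N K) = - ((2 * K%:R + 3) * d K * jacobi_bin N K) by ring.
  case: (leqP K N) => KN; last by rewrite jacobi_bin_out // !mulr0 oppr0.
  rewrite /jterm /jcoef /d triS (_ : (N.+1 + tri K = tri K + K.+1 + (N.+1 - K.+1))%N); last by lia.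
  rewrite (exprD _ (tri K + K.+1)) (exprS (-1) K) !rmorphM /= polyCN polyC1 (_ : (2 * K.+1 + 1)%:Z%:P = 2 * K%:R + 3 :> P); last first.
    rewrite (_ : (2 * K.+1 + 1 = 2 * K + 3)%N); last by lia.
    by rewrite PoszD PoszM !rmorphD !rmorphM /= -!natz !rmorph_nat.
  by ring.
case: M NM => // M NM.
have last0 : jacobi_bin N M.+1 = 0 by apply: jacobi_bin_out; lia.
have lastM : jacobi_bin N M = 0 by apply: jacobi_bin_out; lia.
rewrite /= (eq_bigr (fun j : 'I_M.+1 => jterm j * ('X^(N + 2 + j) * jacobi_bin N j.+1) +
    (1 + 'X^(2 * N + 2)) * (jterm j * jacobi_bin N j) + jterm j * ('X^(N.+1 - j) * jacobi_bin N j.-1))); last first.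
  by move=> j _; ring.
rewrite !big_split /= -mulr_sumr IH; last by lia.
rewrite S1 S3 2!big_ord_recr /= last0 lastM !mulr0 !addr0.
have S4 : \sum_(j < M) (2 * j%:R - 1) * d j * jacobi_bin N j + \sum_(j < M) (2 * j%:R + 3) * d j * jacobi_bin N j =
   2 * 'X^(N.+1) * \sum_(j < M) jterm j * jacobi_bin N j.
  rewrite -big_split mulr_sumr; apply: eq_bigr => j _ /=; rewrite /d /jterm /jcoef exprD rmorphM /=.
  rewrite (_ : (2 * j + 1)%:Z%:P = 2 * j%:R + 1 :> P); first by ring.
  by rewrite PoszD PoszM !rmorphD !rmorphM /= -!natz !rmorph_nat.
rewrite IH in S4; last by lia.
rewrite qpochS (_ : 'X^(2 * N + 2) = 'X^(N.+1) ^+ 2 :> P); last by rewrite -exprM; congr ('X^_); lia.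
move: S4; set s1 := \sum_(j < M) _; set s2 := \sum_(j < M) _ => S4.
transitivity ((1 + 'X^(N.+1) ^+ 2) * qpoch N ^+ 2 - (s1 + s2)); first by ring.
by rewrite S4; ring.
Qed.

Definition cong1 (k : nat) (p : P) := exists r, p = 1 + 'X^k * r.

Lemma cong1M k p q : cong1 k p -> cong1 k q -> cong1 k (p * q).
Proof. by move=> [r ->] [s ->]; exists (r + s + r * ('X^k * s)); ring. Qed.

Lemma cong1_prod k m n : (k <= m)%N -> cong1 k (\prod_(m <= i < n) (1 - 'X^i)).
Proof.
move=> km; rewrite big_seq_cond; elim/big_ind: _ => [|p q|i].
- by exists 0; rewrite mulr0 addr0.
- exact: cong1M.
rewrite andbT mem_index_iota => /andP[mi _]; exists (- 'X^(i - k)).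
by rewrite mulrN -exprD subnKC // (leq_trans km).
Qed.

Lemma qpoch_split m n : (m <= n)%N -> qpoch n = qpoch m * \prod_(m.+1 <= i < n.+1) (1 - 'X^i).
Proof. by move=> mn; rewrite /qpoch -big_cat_nat. Qed.

Definition jpoly N : P := \sum_(j < N.+1) jterm j.

(** [qpoch N] times the binomial is 1 modulo X^(N-j+1), and the j-th term carries X^(tri j) with tri
    j >= j, so each error is divisible by X^(N+1). *)
Lemma jacobi_cube N : exists r, qpoch N ^+ 3 = jpoly N + 'X^(N.+1) * r.
Proof.
have key (j : 'I_N.+1) : exists r, jterm j * (qpoch N * jacobi_bin N j) = jterm j + 'X^(N.+1) * r.
  have jN : (j <= N)%N by rewrite -ltnS.
  have [r hr] : cong1 (N - j).+1 (qpoch N * jacobi_bin N j).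
    have e1 : jacobi_bin N j * qpoch (N - j) = \prod_((N + j).+2 <= i < (2 * N).+2) (1 - 'X^i).
      apply: (mulIf (qpoch_neq0 (N + j).+1)); rewrite -mulrA jacobi_binE // mulrC -qpoch_split //; lia.
    rewrite (qpoch_split (leq_subr j N)) mulrAC mulrC (mulrC (qpoch _)) e1.
    by apply: cong1M; apply: cong1_prod; lia.
  exists ((jcoef j)%:P * 'X^(tri j + (N - j).+1 - N.+1) * r); rewrite hr mulrDr mulr1; congr (_ + _).
  have e : 'X^(tri j) * 'X^((N - j).+1) = 'X^(N.+1) * 'X^(tri j + (N - j).+1 - N.+1) :> P.
    by rewrite -!exprD; congr ('X^_); have := leq_tri j; lia.
  transitivity ((jcoef j)%:P * ('X^(tri j) * 'X^((N - j).+1)) * r); first by rewrite /jterm; ring.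
  by rewrite e; ring.
have [f hf] := choice key.
exists (\sum_j f j); rewrite exprS -(jacobi_finite (ltnSn N)) mulr_sumr /jpoly mulr_sumr -big_split.
by apply: eq_bigr => j _; rewrite mulrCA hf.
Qed.

Lemma cong_exp N (p q : P) k : (exists r, p = q + 'X^N * r) -> exists r, p ^+ k = q ^+ k + 'X^N * r.
Proof.
move=> [r ->]; elim: k => [|k [s IH]]; first by exists 0; rewrite mulr0 addr0.
exists (q * s + r * q ^+ k + 'X^N * (r * s)); rewrite exprS IH exprS; ring.
Qed.

(** The exponent 24 is 3 . 8; the leading factor X accounts for the shift from m + 1 to m, and the
    truncation is exact in degree m. *)
Lemma tau_jpoly m : ramanujan_tau m.+1 = (jpoly m.+1 ^+ 8)`_m.
Proof.
rewrite /ramanujan_tau coefXM /= prodrXl -/(qpoch m.+1) (exprM _ 3 8).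
have [r ->] := cong_exp 8 (jacobi_cube m.+1).
by rewrite coefD coefXnM ltnW // addr0.
Qed.

Lemma tau0 : ramanujan_tau 0 = 0.
Proof. by rewrite /ramanujan_tau coefXM. Qed.

Lemma tau1 : ramanujan_tau 1 = 1.
Proof.
rewrite tau_jpoly /jpoly big_ord_recl big_ord1.
have e (p : P) k : (p ^+ k)`_0 = p`_0 ^+ k.
  by elim: k => [|k IH]; rewrite ?expr0 ?coef1 // !exprS coef0M IH.
by rewrite e coefD /jterm !coefCM !coefXn /= mulr0 addr0 mulr1 /jcoef.
Qed.

End JacobiIdentity.

(** * The lattice W8 *)

Section IntegralReals.
Variable R : realType.
Implicit Types x y : R.

Lemma is_intRD x y : is_intR x -> is_intR y -> is_intR (x + y).
Proof. by move=> [a ->] [b ->]; exists (a + b); rewrite intrD. Qed.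

End IntegralReals.

(** * Orthogonal sums of lattices *)

Section DirectSum.
Variables (R : realType) (n1 n2 : nat).
Variables (L1 : 'rV[R]_n1 -> Prop) (L2 : 'rV[R]_n2 -> Prop).

Definition dsum (x : 'rV[R]_(n1 + n2)) := L1 (lsubmx x) /\ L2 (rsubmx x).

Lemma dotv_split (x y : 'rV[R]_(n1 + n2)) :
  dotv x y = dotv (lsubmx x) (lsubmx y) + dotv (rsubmx x) (rsubmx y).
Proof.
by rewrite /dotv big_split_ord; congr (_ + _); apply: eq_bigr => i _; rewrite !mxE.
Qed.

Lemma lattice0 n (L : 'rV[R]_n -> Prop) : is_lattice L -> L 0.
Proof.
move=> [B [_ h]]; apply/h; exists 0; rewrite (_ : map_mx _ 0 = 0) ?mul0mx //.
by apply/matrixP => ? ?; rewrite !mxE.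
Qed.

Lemma dotv0l n (x : 'rV[R]_n) : dotv 0 x = 0.
Proof. by rewrite -(scale0r 0) dotvZl mul0r. Qed.

Lemma esd_dsum : even_selfdual_lattice L1 -> even_selfdual_lattice L2 -> even_selfdual_lattice dsum.
Proof.
move=> [lat1 sd1 ev1] [lat2 sd2 ev2]; split.
- case: (lat1) => B1 [u1 h1]; case: (lat2) => B2 [u2 h2].
  exists (block_mx B1 0 0 B2); split.
    by rewrite unitmxE det_ublock unitrM -!unitmxE u1 u2.
  move=> x; split.
    move=> [/h1[z1 e1] /h2[z2 e2]]; exists (row_mx z1 z2).
    rewrite map_row_mx mul_row_block !mulmx0 addr0 add0r -e1 -e2; symmetry; exact: hsubmxK.
  move=> [z ->]; rewrite -[z]hsubmxK map_row_mx mul_row_block !mulmx0 addr0 add0r.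
  by split; [rewrite row_mxKl; apply/h1; exists (lsubmx z) | rewrite row_mxKr; apply/h2; exists (rsubmx z)].
- move=> y; split.
    move=> [y1 y2] x [x1 x2]; rewrite dotv_split; apply: is_intRD.
      by move/sd1: y1; apply.
    by move/sd2: y2; apply.
  move=> h; split.
    apply/sd1 => x hx; have := h (row_mx x 0); rewrite dotv_split row_mxKl row_mxKr dotv0l addr0; apply.
    by split; rewrite ?row_mxKl ?row_mxKr //; exact: lattice0.
  apply/sd2 => x hx; have := h (row_mx 0 x); rewrite dotv_split row_mxKl row_mxKr dotv0l add0r; apply.
  by split; rewrite ?row_mxKl ?row_mxKr //; exact: lattice0.
- move=> x [/ev1[a ha] /ev2[b hb]]; exists (a + b).
  by rewrite dotv_split ha hb -intrD mulrDr.
Qed.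

End DirectSum.

Section LatticeW8.
Variable R : realType.
Local Notation W8 := (@W8 R).
Implicit Types x y : 'rV[R]_8.

(** The coordinates are h/2 + d_i with one common integer h. The eight halves add up to 4h, which is
    even, so the parity condition falls on the sum of the d_i alone. *)
Lemma W8P x : W8 x <-> exists (h : int) (d : 'I_8 -> int) (t : int),
  (forall i, x 0 i = h%:~R / 2 + (d i)%:~R) /\ \sum_i d i = 2 * t.
Proof.
split.
  move=> [/(_ 0)[h hh] /choice[d hd] [s hs]].
  exists h, d, (s - 2 * h).
  have e i : x 0 i = h%:~R / 2 + (d i)%:~R by rewrite -hd -hh; field.
  split=> //; apply/eqP; rewrite -(eqr_int R); apply/eqP; rewrite rmorph_sum /=.
  have : \sum_i x 0 i = 8 * (h%:~R / 2) + \sum_i (d i)%:~R.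
    by rewrite (eq_bigr _ (fun i _ => e i)) big_split /= sumr_const card_ord mulr_natl.
  rewrite hs => E; rewrite (_ : \sum_i _ = (2 * s)%:~R - 8 * (h%:~R / 2)); last by rewrite E; ring.
  by rewrite !(intrM, intrB); field.
move=> [h [d [t [e st]]]]; split.
- move=> i; exists (h + 2 * d i); by rewrite e !(intrD, intrM); field.
- move=> i; exists (d i - d 0); rewrite !e intrB; ring.
exists (2 * h + t); rewrite (eq_bigr _ (fun i _ => e i)) big_split /= sumr_const card_ord -rmorph_sum /= st.
by rewrite -mulr_natl !(intrD, intrM); field.
Qed.

Lemma int_sqr_sub (d : int) : exists c : int, d * d - d = 2 * c.
Proof.
have e : exists c : int, d = 2 * c \/ d = 2 * c + 1.
  exists (divz d 2); have := divz_eq d 2; have := modz_ge0 d (isT : (2 : int) != 0).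
  have := ltz_pmod d (isT : (0 : int) < 2); lia.
by case: e => c [] ->; [exists (2 * c * c - c) | exists (2 * c * c + c)]; ring.
Qed.

Lemma W8_dot x y : W8 x -> W8 y -> is_intR (dotv x y).
Proof.
move=> /W8P[h [d [t [ex st]]]] /W8P[k [e [u [ey su]]]].
exists (2 * h * k + h * u + k * t + \sum_i d i * e i).
have -> : dotv x y = \sum_i (h%:~R * k%:~R / 4 + h%:~R / 2 * (e i)%:~R + k%:~R / 2 * (d i)%:~R + (d i * e i)%:~R).
  by apply: eq_bigr => i _; rewrite ex ey intrM; field.
rewrite !big_split /= sumr_const card_ord -!mulr_sumr -!rmorph_sum /= st su -mulr_natl.
by rewrite !(intrD, intrM); field.
Qed.

Lemma W8_even : even_lattice W8.
Proof.
move=> x /W8P[h [d [t [ex st]]]].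
have [c hc] := choice (fun i => int_sqr_sub (d i)).
exists (h * h + h * t + t + \sum_i c i).
have -> : dotv x x = \sum_i (h%:~R * h%:~R / 4 + (h%:~R + 1) * (d i)%:~R + 2 * (c i)%:~R).
  apply: eq_bigr => i _; have := congr1 (fun z : int => z%:~R : R) (hc i); rewrite /= intrB !intrM => e.
  by rewrite -e ex; field.
rewrite !big_split /= sumr_const card_ord -!mulr_sumr -!rmorph_sum /= st -mulr_natl.
by rewrite !(intrD, intrM); field.
Qed.

(** Pairing with 2 e_i, with e_i - e_0 and with the vector of all halves returns the three defining
    conditions. *)
Lemma W8_selfdual : selfdual W8.
Proof.
move=> y; split; first by move=> hy x hx; exact: W8_dot.
move=> h; split.
- move=> i; have := h (2 *: ebas R i); rewrite dotvZl dotvC dotv_ebas; apply.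
  apply/W8P; exists 0, (fun j => 2 * (j == i)%:R), 1; split.
    by move=> j; rewrite !mxE eqxx /= !(intrM, mul0r, add0r); case: (j == i).
  by rewrite -mulr_sumr (bigD1 i) //= eqxx big1 ?addr0 // => j /negbTE ->.
- move=> i; have := h (ebas R i - ebas R 0); rewrite dotvDl dotvNl !(dotvC _ y) !dotv_ebas; apply.
  apply/W8P; exists 0, (fun j => (j == i)%:R - (j == 0)%:R), 0; split.
    by move=> j; rewrite !mxE eqxx /= mul0r add0r intrB; case: (j == i); case: (j == 0).
  rewrite sumrB (bigD1 i) //= eqxx big1 ?addr0; last by move=> j /negbTE ->.
  by rewrite (bigD1 0) //= big1 ?addr0 // => j /negbTE ->.
have [z hz] : is_intR (dotv (const_mx (1 / 2)) y).
  apply: h; apply/W8P; exists 1, (fun=> 0), 0; split; last by rewrite big1.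
  by move=> i; rewrite mxE addr0.
exists z; rewrite intrM -hz /dotv mulr_sumr; by apply: eq_bigr => i _; rewrite mxE; field.
Qed.

(** Integral part of a triangular basis: 2 e_0, then e_i - e_(i-1) for 1 <= i <= 6, and as row 7 the
    vector of all halves, with integral part 0. *)
Definition w8int (i j : nat) : int := if i == 7%N then 0
  else if i == 0%N then (if j == 0%N then 2 else 0)
  else (if j == i then 1 else 0) - (if j.+1 == i then 1 else 0).

Definition w8mx : 'M[R]_8 :=
  \matrix_(i, j) ((w8int i j)%:~R + (if i == 7%N :> nat then 1 / 2 else 0)).

Lemma ord8_ind (T : nat -> Prop) : T 0%N -> T 1%N -> T 2%N -> T 3%N -> T 4%N -> T 5%N -> T 6%N -> T 7%N ->
  forall i, (i < 8)%N -> T i.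
Proof. by move=> ? ? ? ? ? ? ? ? [|[|[|[|[|[|[|[|]]]]]]]]. Qed.

Lemma sum8 (V : zmodType) (G : nat -> V) : \sum_(i < 8) G i =
  G 0%N + (G 1%N + (G 2%N + (G 3%N + (G 4%N + (G 5%N + (G 6%N + G 7%N)))))).
Proof. by rewrite -(big_mkord xpredT G); do 8 rewrite big_ltn //; rewrite big_geq // addr0. Qed.

Lemma w8mx_unit : w8mx \in unitmx.
Proof.
rewrite unitmxE unitfE det_trig; last first.
  apply/is_trig_mxP => i j; rewrite mxE; have := ltn_ord j; move: (nat_of_ord j) => {}j j8.
  by move: (nat_of_ord i) (ltn_ord i); apply: ord8_ind; move: j j8; apply: ord8_ind => // _; rewrite /w8int /= ?addr0.
apply/prodf_neq0 => i _; rewrite mxE; move: (nat_of_ord i) (ltn_ord i); apply: ord8_ind; rewrite /w8int /= ?addr0 ?add0r ?mul1r ?invr_eq0 ?pnatr_eq0 ?intr_eq0 //.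
Qed.

Lemma w8int_sum (i : 'I_8) : \sum_(j < 8) w8int i j = 2 * (if i == 0%N :> nat then 1 else 0).
Proof. by rewrite (sum8 (w8int i)); move: (nat_of_ord i) (ltn_ord i); apply: ord8_ind. Qed.

Lemma w8mx_point (z : 'rV[int]_8) (j : 'I_8) :
  (zr R z *m w8mx) 0 j = (z 0 (inord 7))%:~R / 2 + (\sum_(i < 8) z 0 i * w8int i j)%:~R.
Proof.
rewrite mxE (eq_bigr (fun i : 'I_8 => (z 0 i)%:~R * (if i == 7%N :> nat then 1 / 2 else 0) +
   (z 0 i * w8int i j)%:~R)); last by move=> i _; rewrite !mxE mulrDr addrC intrM.
rewrite big_split /= -rmorph_sum; congr (_ + _).
rewrite (bigD1 (inord 7)) //= inordK // eqxx big1 ?addr0 ?mul1r // => i i7.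
by case: eqP => [e|_]; [move/eqP: i7; case; apply: val_inj; rewrite /= inordK | rewrite mulr0].
Qed.

Lemma W8_basis : basis_of W8 w8mx.
Proof.
split=> [|x]; first exact: w8mx_unit.
rewrite W8P; split.
  move=> [h [d [t [ex st]]]].
  pose D k : int := d (inord k).
  (* Back substitution: h + 2 d_7 copies of the row of halves settle the last coordinate. The other
     coefficients are partial sums, from the right, of d_j - d_7; the coefficient of 2 e_0 is half
     of the full sum. *)
  pose Z k : int := nth 0 [:: t - 4 * D 7%N;
    D 1%N + D 2%N + D 3%N + D 4%N + D 5%N + D 6%N - 6 * D 7%N;
    D 2%N + D 3%N + D 4%N + D 5%N + D 6%N - 5 * D 7%N;
    D 3%N + D 4%N + D 5%N + D 6%N - 4 * D 7%N;
    D 4%N + D 5%N + D 6%N - 3 * D 7%N; D 5%N + D 6%N - 2 * D 7%N; D 6%N - D 7%N; h + 2 * D 7%N] k.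
  have dD (i : 'I_8) : d i = D i by rewrite /D inord_val.
  have {}st : \sum_(i < 8) D i = 2 * t by rewrite -st; apply: eq_bigr => i _; rewrite dD.
  rewrite sum8 in st.
  exists (\row_i Z i); apply/rowP => j; rewrite w8mx_point ex !mxE inordK // dD.
  rewrite (eq_bigr (fun i : 'I_8 => Z i * w8int i j)); last by move=> i _; rewrite mxE.
  have -> : \sum_(i < 8) Z i * w8int i j = D j - D 7%N.
    rewrite (sum8 (fun i => Z i * w8int i j)) /Z.
    by move: (nat_of_ord j) (ltn_ord j); apply: ord8_ind; rewrite /w8int /=; move: st; clear; lia.
  by rewrite /Z /= intrD intrB intrM; field.
move=> [z ->]; exists (z 0 (inord 7)), (fun j => \sum_(i < 8) z 0 i * w8int i j), (z 0 0); split.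
  exact: w8mx_point.
rewrite exchange_big /= (eq_bigr (fun i : 'I_8 => z 0 i * (2 * (if i == 0%N :> nat then 1 else 0)))); last first.
  by move=> i _; rewrite -w8int_sum mulr_sumr.
rewrite (bigD1 0) //= big1 ?addr0; first by rewrite mulr1 mulrC.
by move=> i i0; case: eqP => [e|_]; [move/eqP: i0; case; apply: val_inj | rewrite !mulr0].
Qed.

Lemma W8_esd : even_selfdual_lattice W8.
Proof. by split; [exists w8mx; exact: W8_basis | exact: W8_selfdual | exact: W8_even]. Qed.

End LatticeW8.

(** * The discriminant as a theta series of W8 *)

Section ProductSums.
Variable R : realType.
Local Notation C := R[i].

Lemma csum_prod n (phi : int -> C) : summ phi ->
  summ (fun k : 'rV[int]_n => \prod_(i < n) phi (k 0 i)) /\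
  csum (fun k : 'rV[int]_n => \prod_(i < n) phi (k 0 i)) = csum phi ^+ n.
Proof.
move=> sp; elim: n => [|n [IH1 IH2]].
  have z0 (k : 'rV[int]_0) : k \notin [:: 0] -> \prod_(i < 0) phi (k 0 i) = 0.
    by rewrite inE => /eqP[]; apply/rowP => -[].
  have [s1 ->] := csum_fin (isT : uniq [:: (0 : 'rV[int]_0)]) z0.
  by split=> //; rewrite big_seq1 big_ord0 expr0.
have [s1 e1] := csum_mul IH1 sp.
have [r1 r2] := csum_reindex (fun k : 'rV[int]_(1 + n) => \prod_(i < 1 + n) phi (k 0 i)) (@zpairK n) (@zunpairK n).
have e : (fun k : 'rV[int]_(1 + n) => \prod_(i < 1 + n) phi (k 0 i)) \o (@zpair n) =
   (fun p : 'rV[int]_n * int => (\prod_(i < n) phi (p.1 0 i)) * phi p.2).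
  apply: funext => p; rewrite /= /zpair big_split_ord /= big_ord1 row_mxEl mxE eqxx mulr1n mulrC.
  by congr (_ * _); apply: eq_bigr => i _; rewrite row_mxEr.
rewrite e in r1 r2; have s2 := proj2 r1 s1; split=> //.
by rewrite [LHS](r2 s2) e1 IH2 exprSr.
Qed.

Lemma csum_antisym (I : eqType) (phi : I -> C) (s : I -> I) : summ phi -> involutive s ->
  (forall k, phi (s k) = - phi k) -> csum phi = 0.
Proof.
move=> sp ss h; have [_ r] := csum_reindex phi ss ss; have := r sp.
have -> : csum (phi \o s) = - csum phi by rewrite -csumN //; apply: eq_csum => k; exact: h.
by move/eqP; rewrite -subr_eq0 opprK -mulr2n -mulr_natl mulf_eq0 pnatr_eq0 /= => /eqP.
Qed.

Definition sg (k : int) : C := if (2 %| k)%Z then 1 else -1.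

Lemma sgD k l : sg (k + l) = sg k * sg l.
Proof.
have par (x : int) : exists a : int, x = 2 * a \/ x = 2 * a + 1.
  exists (divz x 2); have := divz_eq x 2; have := modz_ge0 x (isT : (2 : int) != 0).
  have := ltz_pmod x (isT : (0 : int) < 2); lia.
have ev (a : int) : sg (2 * a) = 1 by rewrite /sg dvdz_mulr.
have od (a : int) : sg (2 * a + 1) = -1.
  by rewrite /sg; case: ifP => // /dvdzP[z hz]; exfalso; lia.
have [a [->|->]] := par k; have [b [->|->]] := par l.
- by rewrite -mulrDr !ev mulr1.
- by rewrite addrA -mulrDr ev !od mul1r.
- by rewrite addrAC -mulrDr ev !od mulr1.
- have -> : 2 * a + 1 + (2 * b + 1) = 2 * (a + b + 1) by ring.
  by rewrite ev !od mulrNN mulr1.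
Qed.

Lemma sg0 : sg 0 = 1. Proof. by rewrite /sg dvdz0. Qed.

Lemma sgN k : sg (- k) = sg k. Proof. by rewrite /sg dvdzE abszN -dvdzE. Qed.

Lemma cn_sg k : cn (sg k) = 1.
Proof. by rewrite /sg; case: ifP; rewrite ?cnN cn1. Qed.

Lemma sg_sum n (k : 'rV[int]_n) : sg (\sum_i k 0 i) = \prod_i sg (k 0 i).
Proof. by rewrite (big_morph sg sgD sg0). Qed.

Lemma sgn_nat (n : nat) : sg n = (-1) ^+ n.
Proof.
elim: n => [|n IH]; first by rewrite sg0 expr0.
by rewrite -addn1 PoszD sgD IH addn1 exprSr; congr (_ * _).
Qed.

Lemma th0 (lam : C) : th lam 0 = 1.
Proof. by rewrite /th mulr0 cexp0. Qed.

Lemma summ_shift_th (lam : C) (h : R) : half lam ->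
  summ (fun k : int => (k%:~R + h)%:C * th lam ((k%:~R + h) ^+ 2)).
Proof.
move=> hl; have := summ_poly_th ('X_0 : {mpoly R[1]}) (const_mx h) (unitmx1 R 1) hl.
have can1 : cancel (fun k : int => k%:M : 'rV[int]_1) (fun z => z 0 0) by move=> k; rewrite mxE.
have can2 : cancel (fun z : 'rV[int]_1 => z 0 0) (fun k : int => k%:M : 'rV[int]_1).
  by move=> z; rewrite -mx11_scalar.
move=> su; have [[r _] _] := csum_reindex (fun z : 'rV[int]_1 => (evalv 'X_0 (zr R z *m 1%:M + const_mx h))%:C *
   th lam (nrm (zr R z *m 1%:M + const_mx h))) can1 can2.
have := r su; congr summ; apply: funext => k /=; rewrite mulmx1 evalvX !mxE eqxx mulr1n.
by rewrite /nrm /dotv big_ord1 !mxE eqxx mulr1n expr2.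
Qed.

End ProductSums.

Section DeltaSeries.
Variable R : realType.
Local Notation C := R[i].

Definition halfshift (e : bool) : R := if e then 1 / 2 else 0.

(** Parametrizes Z^8 and its translate by the vector of all halves; the same parity condition on the
    integers cuts W8 out of both. *)
Definition w8par (p : bool * 'rV[int]_8) : 'rV[R]_8 := zr R p.2 + const_mx (halfshift p.1).

Lemma half_notint (z : int) : (z%:~R : R) <> 1 / 2.
Proof.
move=> h; have : (2 * z)%:~R = 1%:~R :> R by rewrite intrM h; field.
by move/eqP; rewrite eqr_int => /eqP; lia.
Qed.

Lemma w8par_inj : injective w8par.
Proof.
move=> [e k] [f l] /rowP h.
have {}h i : (k 0 i)%:~R + halfshift e = (l 0 i)%:~R + halfshift f by have := h i; rewrite !mxE.
have ef : e = f.
  have := h 0; case: e f {h} => [] [] //= h; exfalso.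
  - by apply: (@half_notint (l 0 0 - k 0 0)); rewrite intrB; move: h; rewrite /halfshift => h; lra.
  - by apply: (@half_notint (k 0 0 - l 0 0)); rewrite intrB; move: h; rewrite /halfshift => h; lra.
subst f; congr pair; apply/rowP => i; have /addIr/eqP := h i.
by rewrite eqr_int => /eqP.
Qed.

Lemma w8par_W8 p : @W8 R (w8par p) <-> (2 %| \sum_i p.2 0 i)%Z.
Proof.
case: p => e k /=; split.
  move=> [_ _ [z]]; rewrite (eq_bigr (fun i => (k 0 i)%:~R + halfshift e)); last by move=> i _; rewrite !mxE.
  rewrite big_split /= sumr_const card_ord -rmorph_sum /= => h.
  suff : \sum_i k 0 i = 2 * (z - (if e then 2 else 0)) by move=> ->; apply: dvdz_mulr.
  apply/eqP; rewrite -(eqr_int R) intrM intrB; apply/eqP; move: h; rewrite intrM.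
  by case: e; rewrite /halfshift -mulr_natl => h; lra.
move=> /dvdzP[z hz]; apply/W8P; exists (if e then 1 else 0), (fun i => k 0 i), z; split.
  by move=> i; rewrite !mxE addrC /halfshift; case: e; rewrite ?mul0r.
by rewrite hz mulrC.
Qed.

Lemma W8_w8par x : @W8 R x -> exists p, w8par p = x.
Proof.
move=> /W8P[h [d [t [ex _]]]]; pose c := divz h 2; pose r := modz h 2.
have hr : h = c * 2 + r := divz_eq h 2.
have r01 : r = 0 \/ r = 1.
  by have := modz_ge0 h (isT : (2 : int) != 0); have := ltz_pmod h (isT : (0 : int) < 2); rewrite -/r; lia.
exists (r == 1, \row_i (d i + c)); apply/rowP => i; rewrite ex !mxE hr intrD intrD intrM.
by case: r01 => ->; rewrite /halfshift /=; lra.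
Qed.

Definition xprod : {mpoly R[8]} := 'X_[[multinom 1%N | i < 8]].

Lemma evalv_xprod x : evalv xprod x = \prod_i x 0 i.
Proof. by rewrite /evalv mevalX; apply: eq_bigr => i _; rewrite mnmE expr1. Qed.

Lemma xprod_homog : xprod \is 8.-homog.
Proof.
have e : mdeg [multinom 1%N | i < 8] = 8%N.
  by rewrite mdegE (eq_bigr (fun=> 1%N)) ?sum1_card ?card_ord // => i _; rewrite mnmE.
by rewrite /xprod dhomogX; apply/eqP; exact: e.
Qed.

Lemma xprod_harmonic : harmonic xprod.
Proof.
rewrite /harmonic /laplacian big1 // => i _; rewrite /xprod mderivX mderivZ mderivX.
by rewrite mnmBE mnmE mnm1E eqxx subnn scale0r scaler0.
Qed.

Definition phi (lam : C) (e : bool) (k : int) : C :=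
  (k%:~R + halfshift e)%:C * th lam ((k%:~R + halfshift e) ^+ 2).

Lemma xprod_w8par lam p :
  (evalv xprod (w8par p))%:C * th lam (nrm (w8par p)) = \prod_i phi lam p.1 (p.2 0 i).
Proof.
rewrite evalv_xprod rmorph_prod /= /nrm /dotv (big_morph (th lam) (thD lam) (th0 lam)) -big_split /=.
by apply: eq_bigr => i _; rewrite /phi !mxE expr2.
Qed.

Lemma phi_sym lam e k : phi lam e (- k - (if e then 1 else 0)) = - phi lam e k.
Proof.
rewrite /phi; have -> : (- k - (if e then 1 else 0))%:~R + halfshift e = - (k%:~R + halfshift e) :> R.
  by rewrite intrB rmorphN /= /halfshift; case: e => /=; field.
by rewrite sqrrN rmorphN mulNr.
Qed.

(** The series in Jacobi's identity, which represents the cube of prod (1 - q^k). *)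
Definition jser (q : C) : C := csum (fun n : nat => (jcoef n)%:~R * q ^+ (tri n)).

(** The terms at k and -k-1 coincide, because the sign and the odd factor both change. Since (n +
    1/2)^2 = 1/4 + 2 tri n, the two together give the n-th term of Jacobi's series. *)
Lemma odd_theta lam : half lam ->
  summ (fun n : nat => (jcoef n)%:~R * th lam 2 ^+ tri n) /\
  csum (fun k => sg R k * phi lam true k) = th lam (1 / 4) * jser (th lam 2).
Proof.
move=> hl; pose u (k : int) := sg R k * phi lam true k.
have su : summ u.
  by apply: (summ_dom (summ_shift_th (1 / 2) hl)) => k; rewrite /u cnM cn_sg mul1r.
pose p (k : int) : nat := if (0 <= k) then `|k|%N else `|- k - 1|%N.
have [s1 e1] := csum_fibers p su.
have key n : csum (fun k => if p k == n then u k else 0) = th lam (1 / 4) * ((jcoef n)%:~R * th lam 2 ^+ tri n).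
  pose s : seq int := [:: n%:Z; - n%:Z - 1].
  have us : uniq s by rewrite /= inE andbT; lia.
  set v := (fun k => _); have vz k : k \notin s -> v k = 0.
    by rewrite /v !inE /p; case: ifP => // /eqP; case: ifP; lia.
  have [_ ->] := csum_fin us vz; rewrite big_cons big_seq1 /v.
  have -> : p n%:Z == n by rewrite /p.
  have -> : p (- n%:Z - 1) == n by rewrite /p; case: ifP; lia.
  have -> : u (- n%:Z - 1) = u n%:Z.
    rewrite /u (phi_sym lam true n) sgD sgN (_ : sg R (-1) = -1) // mulrN1 mulrNN //.
  rewrite /u -mulr2n /phi -pmulrn sgn_nat /halfshift.
  have -> : (n%:R + 1 / 2) ^+ 2 = 1 / 4 + (2 * tri n)%:R :> R.
    by rewrite tri2 natrM -(natr1 n); field.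
  rewrite thD th_nat /jcoef intrM rmorphXn rmorphN /= rmorph1 -pmulrn.
  have -> : (n%:R + 1 / 2)%:C = (2 * n + 1)%:R / 2 :> C.
    by rewrite natrD natrM rmorphD /= rmorph_nat rmorphM /= fmorphV rmorph_nat rmorph1; field.
  by rewrite -mulr_natl; field.
have st0 : th lam (1 / 4) != 0 by exact: cexp_neq0.
have s2 : summ (fun n : nat => (jcoef n)%:~R * th lam 2 ^+ tri n).
  have := summZ (th lam (1 / 4))^-1 s1; congr summ; apply: funext => n; by rewrite key mulKf.
by split=> //; rewrite e1 (funext key) csumZ.
Qed.

(** The parity condition is inserted as (1 + [sg]) / 2, after which the sum over eight coordinates
    splits into four eighth powers. Both untwisted ones and the twisted one on Z^8 vanish by
    antisymmetry. The twisted half-integral one gives Jacobi's series, and the eighth power of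
    [th lam (1 / 4)] is [th lam 2]. *)
Lemma theta_xprod lam : half lam ->
  latsum (@W8 R) (fun x => (evalv xprod x)%:C * th lam (nrm x)) = th lam 2 * jser (th lam 2) ^+ 8 / 2.
Proof.
move=> hl; have := lsumm_poly_th xprod (W8_basis R) hl; rewrite /latsum /lsumm.
set u := (fun x => _) => su.
have uz x : (forall p, w8par p <> x) -> u x = 0.
  by move=> h; rewrite /u; case: asboolP => // /W8_w8par[p hp]; case: (h p).
have [[r1 _] r2] := csum_inj w8par_inj uz.
have uE : u \o w8par = (fun p : bool * 'rV[int]_8 => 2^-1 * (\prod_i phi lam p.1 (p.2 0 i) +
    \prod_i (sg R (p.2 0 i) * phi lam p.1 (p.2 0 i)))).
  apply: funext => p; rewrite /u /= xprod_w8par.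
  have -> : \prod_i (sg R (p.2 0 i) * phi lam p.1 (p.2 0 i)) =
      sg R (\sum_i p.2 0 i) * \prod_i phi lam p.1 (p.2 0 i) by rewrite sg_sum -big_split.
  rewrite /sg.
  case: asboolP => [/w8par_W8 ->|/w8par_W8/negP/negbTE ->]; first by rewrite mul1r; field.
  by rewrite mulN1r subrr mulr0.
have s1 := r1 su; rewrite (r2 su); rewrite uE in s1 *.
have [_ ->] := fubini s1.
have sphi e : summ (phi lam e) by exact: summ_shift_th.
have ssphi e : summ (fun k => sg R k * phi lam e k).
  by apply: (summ_dom (sphi e)) => k; rewrite cnM cn_sg mul1r.
have row e : csum (fun k : 'rV[int]_8 => 2^-1 * (\prod_i phi lam e (k 0 i) +
    \prod_i (sg R (k 0 i) * phi lam e (k 0 i)))) =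
    2^-1 * (csum (phi lam e) ^+ 8 + csum (fun k => sg R k * phi lam e k) ^+ 8).
  have [a1 <-] := csum_prod 8 (sphi e); have [b1 <-] := csum_prod 8 (ssphi e).
  by rewrite -csumD // -csumZ //; apply: summD.
have inv e : involutive (fun k : int => - k - (if e then 1 else 0)) by move=> k; case: e; ring.
have phi0 e : csum (phi lam e) = 0 by apply: (csum_antisym (sphi e) (inv e)) => k; exact: phi_sym.
have sphi0 : csum (fun k => sg R k * phi lam false k) = 0.
  apply: (csum_antisym (ssphi false) (inv false)) => k.
  by rewrite phi_sym subr0 sgN mulrN.
have [_ B] := odd_theta hl.
rewrite (eq_csum (v := fun e => 2^-1 * (csum (phi lam e) ^+ 8 + csum (fun k => sg R k * phi lam e k) ^+ 8))) //.
have bz (e : bool) : e \notin [:: true; false] -> 2^-1 * (csum (phi lam e) ^+ 8 + csum (fun k => sg R k * phi lam e k) ^+ 8) = 0 :> C.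
  by case: e.
have [_ ->] := csum_fin (isT : uniq [:: true; false]) bz.
rewrite big_cons big_seq1 !phi0 sphi0 B expr0n /= !add0r mulr0 addr0 exprMn mulrC; congr (_ * _ / _).
by rewrite -[th lam (1 / 4) ^+ 8]/(th lam (1 / 4) ^+ (2 * 4)) exprM expr2 -thD !exprS expr0 mulr1 -!thD; congr th; field.
Qed.

Definition one_ser (m : nat) : C := (m == 0%N)%:R.

Definition cpow (a : nat -> C) k := iter k (conv a) one_ser.

Lemma cpow_ps a q k : summ (fun m => a m * q ^+ m) ->
  summ (fun m => cpow a k m * q ^+ m) /\ ps (cpow a k) q = ps a q ^+ k.
Proof.
move=> sa; elim: k => [|k [s e]].
  have z0 m : m \notin [:: 0%N] -> one_ser m * q ^+ m = 0.
    by rewrite inE /one_ser => /negbTE ->; rewrite mul0r.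
  have [s e] := csum_fin (isT : uniq [:: 0%N]) z0; split=> //.
  by rewrite /ps e big_seq1 mul1r.
have [s' e'] := conv_ps sa s; split=> //; by rewrite /= e' e exprS.
Qed.

Lemma coef_cpow (p : {poly int}) (a : nat -> C) N : (forall i, (i <= N)%N -> (p`_i)%:~R = a i) ->
  forall k i, (i <= N)%N -> ((p ^+ k)`_i)%:~R = cpow a k i.
Proof.
move=> h; elim=> [|k IH] i iN.
  by rewrite expr0 coef1 /cpow /= /one_ser; case: (i == 0%N).
rewrite exprS coefM rmorph_sum /cpow /= /conv; apply: eq_bigr => j _.
have ji : (j <= i)%N by rewrite -ltnS.
by rewrite rmorphM /= h ?IH //; [exact: leq_trans (leq_subr _ _) iN | exact: leq_trans ji iN].
Qed.

(** Diagonal coefficients suffice, because the m-th coefficient of [jpoly M] no longer changes once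
    M >= m. *)
Definition jseq (m : nat) : C := ((jpoly m)`_m)%:~R.

Lemma jpoly_stable M i : (i <= M)%N -> (jpoly M)`_i = (jpoly i)`_i.
Proof.
elim: M => [|M IH]; first by rewrite leqn0 => /eqP ->.
rewrite leq_eqVlt => /orP[/eqP -> //|]; rewrite ltnS => iM.
rewrite /jpoly big_ord_recr /= coefD -/(jpoly M) IH // /jterm coefCM coefXn.
by rewrite (_ : (i == _) = false) ?mulr0 ?addr0 //; have := leq_tri M.+1; lia.
Qed.

Lemma jser_ps q : summ (fun n : nat => (jcoef n)%:~R * q ^+ (tri n)) ->
  summ (fun m => jseq m * q ^+ m) /\ jser q = ps jseq q.
Proof.
move=> su; have [s1 e1] := csum_fibers tri su.
have key m : csum (fun n => if tri n == m then (jcoef n)%:~R * q ^+ (tri n) else 0) = jseq m * q ^+ m.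
  set v := (fun n => _); have vz n : n \notin iota 0 m.+1 -> v n = 0.
    by rewrite /v mem_iota; case: eqP => // e; have := leq_tri n; lia.
  have [_ ->] := csum_fin (iota_uniq 0 m.+1) vz.
  rewrite -[iota 0 m.+1]/(index_iota 0 m.+1) big_mkord /jseq /jpoly coef_sum rmorph_sum mulr_suml.
  apply: eq_bigr => j _; rewrite /v /jterm coefCM coefXn eq_sym.
  by case: eqP => [<-|_]; rewrite ?mulr1 // mulr0 mul0r.
by rewrite /jser /ps -(funext key).
Qed.

Definition Delta (m : nat) : C := (ramanujan_tau m)%:~R.

Lemma Delta_ps q : summ (fun n : nat => (jcoef n)%:~R * q ^+ (tri n)) ->
  summ (fun m => Delta m * q ^+ m) /\ ps Delta q = q * jser q ^+ 8.
Proof.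
move=> su; have [s1 e1] := jser_ps su; have [s2 e2] := cpow_ps 8 s1.
have D1 m : Delta m.+1 = cpow jseq 8 m.
  rewrite /Delta tau_jpoly; apply: (@coef_cpow _ _ m.+1); last exact: leqnSn.
  by move=> i im; rewrite /jseq jpoly_stable.
have dz m : (forall n, n.+1 <> m) -> Delta m * q ^+ m = 0.
  by case: m => [_|m h]; [rewrite /Delta tau0 mul0r | case: (h m)].
have [[_ r1] r2] := csum_inj succn_inj dz.
have e : (fun m => Delta m * q ^+ m) \o succn = (fun m => q * (cpow jseq 8 m * q ^+ m)).
  by apply: funext => m; rewrite [LHS]/(Delta m.+1 * q ^+ m.+1) D1 exprS mulrCA.
rewrite e in r1 r2; have s3 := r1 (summZ q s2); split=> //.
by rewrite /ps (r2 s3) csumZ // e1 -e2.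
Qed.

Lemma half_of_upper (z : C) : 0 < Im z -> exists2 lam, half lam & th lam 2 = qq z.
Proof.
move=> z0; have [|lam hl lz] := @half_sqrt R (- 'i * z); last by exists lam => //; exact: th_qq.
by case: z z0 => x y /= y0; rewrite !(mul0r, mul1r, oppr0, sub0r, add0r, opprK, mulN1r).
Qed.

Lemma dser_upper (a : nat -> C) : (forall z, 0 < Im z -> summ (fun m => a m * qq z ^+ m)) -> dser a.
Proof.
move=> h q q1; have [q0|qn0] := eqVneq q 0.
  have z0 m : m \notin [:: 0%N] -> a m * q ^+ m = 0.
    by rewrite inE q0 => m0; rewrite expr0n (negbTE m0) mulr0.
  by have [] := csum_fin (isT : uniq [:: 0%N]) z0.
have [z z0 qz] := @qq_onto R q (cn q) (ltac:(by rewrite q1 lt_neqAle eq_sym cn_eq0 qn0 cn_ge0)).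
by apply: (summ_dom (h z z0)) => m; rewrite !cnM !cnX qz.
Qed.

Lemma Delta_upper (z : C) : 0 < Im z ->
  summ (fun m => Delta m * qq z ^+ m) /\ ps Delta (qq z) = qq z * jser (qq z) ^+ 8.
Proof.
move=> z0; have [lam hl <-] := half_of_upper z0; apply: Delta_ps; by case: (odd_theta hl).
Qed.

Lemma dser_Delta : dser Delta.
Proof. by apply: dser_upper => z z0; case: (Delta_upper z0). Qed.

Lemma shellsum_xprod m : shellsum (@W8 R) xprod m = Delta m / 2.
Proof.
have [dT _] := theta_MF (erefl : 8 = (8 * 1)%N) (W8_esd R) xprod_homog xprod_harmonic.
pose a k : C := shellsum (@W8 R) xprod k - Delta k / 2.
have key q : cn q < 1 -> summ (fun k => a k * q ^+ k) /\ ps a q = ps (shellsum (@W8 R) xprod) q - 2^-1 * ps Delta q.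
  move=> q1; have sT := dT q q1; have sD := dser_Delta q1; rewrite /ps -(csumZ 2^-1 sD) -(csumB sT (summZ 2^-1 sD)).
  have e : (fun k => a k * q ^+ k) = (fun k => shellsum (@W8 R) xprod k * q ^+ k - 2^-1 * (Delta k * q ^+ k)).
    by apply: funext => k; rewrite /a; ring.
  by rewrite e; split=> //; exact: (summB sT (summZ 2^-1 sD)).
have da : dser a by move=> q /key[].
have : a m = 0; last by move/eqP; rewrite /a subr_eq0 => /eqP.
apply: (ps_eq0 da) => z z0; have [_ ->] := key _ (cn_qq_lt1 z0).
have [_ ->] := Delta_upper z0; have [lam hl lz] := half_of_upper z0.
have [_ e] := theta_qseries xprod (W8_basis R) (@W8_even R) hl.
by rewrite -lz -e theta_xprod // mulrC subrr.
Qed.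

(** Modularity of the product is inherited from the harmonic theta series of W8, with which it was
    identified coefficient by coefficient. *)
Lemma MF_Delta : MF 12 Delta.
Proof.
have M := theta_MF (erefl : 8 = (8 * 1)%N) (W8_esd R) xprod_homog xprod_harmonic.
by have := MF_lin 2 0 M M; congr MF; apply: funext => m; rewrite shellsum_xprod; field.
Qed.

Lemma Delta0 : Delta 0 = 0. Proof. by rewrite /Delta tau0. Qed.
Lemma Delta1 : Delta 1 = 1. Proof. by rewrite /Delta tau1. Qed.

(** At z = i one has |q| = exp (- 2 pi) <= 1/9. Since 2n + 1 <= 3^n and tri n >= n, the terms n >= 1
    of Jacobi's series add up to at most 1/2 in modulus, against the leading term 1. *)
Lemma Delta_i_neq0 : ps Delta (qq 'i) != 0.
Proof.
have i0 : 0 < Im ('i : C) by rewrite /= ltr01.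
have [_ ->] := Delta_upper i0; have [lam hl lz] := half_of_upper i0.
have [su _] := odd_theta hl; rewrite mulf_neq0 ?expf_neq0 //; first exact: cexp_neq0.
rewrite -lz; have q9 : cn (th lam 2) <= 1 / 9.
  rewrite lz cn_qq /= mulr1; apply: expRN_le; first lra.
  have p3 := @pi_ge312 R; apply: le_trans (_ : expR 6 <= _); last by rewrite ler_expR; lra.
  have -> : expR (6 : R) = expR 1 ^+ 6 by rewrite -expRM_natl mulr1.
  apply: le_trans (_ : 2 ^+ 6 <= _); first by rewrite !exprS expr0; lra.
  by rewrite lerXn2r ?nnegrE ?expR_ge0 //; have := expR_ge1Dx (1 : R).
set q := th lam 2 in su q9 *; apply/eqP => J0.
pose v (n : nat) : C := if n == 0%N then 0 else (jcoef n)%:~R * q ^+ tri n.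
have sv : summ v by apply: (summ_dom su) => n; rewrite /v; case: ifP; rewrite ?cn0 ?cn_ge0.
have w0 n : n \notin [:: 0%N] -> (n == 0%N)%:R = 0 :> C by rewrite inE => /negbTE ->.
have [sw ew] := csum_fin (isT : uniq [:: 0%N]) w0.
have : csum (fun n => v n) = -1.
  apply/eqP; rewrite -addr_eq0; apply/eqP; rewrite -[RHS]J0 /jser [X in _ + X = _](_ : 1 = csum (fun n : nat => (n == 0%N)%:R)).
    rewrite -csumD //; apply: eq_csum => n; rewrite /v; case: eqP => [->|_]; last by rewrite addr0.
    by rewrite add0r /jcoef tri0 expr0 mulr1.
  by rewrite ew big_seq1.
move=> /(congr1 (@cn R)); rewrite cnN cn1 => E.
suff : cn (csum (fun n => v n)) <= 1 / 2 by rewrite E; lra.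
have geo N : \sum_(n < N.+1) (if n == 0%N :> nat then 0 else (3^-1 : R) ^+ n) = 1 / 2 - 3^-1 ^+ N / 2.
  elim: N => [|N IH]; first by rewrite big_ord1 /= expr0; field.
  by rewrite big_ord_recr /= IH exprS; field.
apply: cn_csum_le => s us.
pose g n : R := if n == 0%N then 0 else (3^-1 : R) ^+ n.
have g0 n : 0 <= g n by rewrite /g; case: ifP => // _; rewrite exprn_ge0 // invr_ge0.
have vg n : cn (v n) <= g n.
  rewrite /v /g; case: eqP => [_|n0]; first by rewrite cn0.
  rewrite cnM cnX /jcoef intrM cnM rmorphXn rmorphN /= rmorph1 cnX cnN cn1 expr1n mul1r -pmulrn cn_nat.
  have t1 : (2 * n + 1)%:R <= 3 ^+ n :> R.
    rewrite -natrX ler_nat; elim: n {n0} => // n IH; rewrite expnS; lia.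
  have t2 : cn q ^+ tri n <= (1 / 9) ^+ n.
    apply: le_trans (_ : (1 / 9 : R) ^+ tri n <= _); first by rewrite lerXn2r ?nnegrE ?cn_ge0 //; lra.
    by rewrite ler_wiXn2l ?leq_tri //; lra.
  apply: le_trans (ler_pM _ _ t1 t2) _ => //; first by rewrite exprn_ge0 ?cn_ge0.
  by rewrite -exprMn (_ : 3 * (1 / 9) = 3^-1 :> R) //; field.
apply: le_trans (_ : \sum_(i <- s) g i <= _); first exact: ler_sum.
pose N := \max_(i <- s) i.
have sub : {subset s <= iota 0 N.+1}.
  by move=> i si; rewrite mem_iota /= add0n ltnS; exact: (@leq_bigmax_seq _ s xpredT id i).
apply: le_trans (sum_le_subset g0 us (iota_uniq 0 N.+1) sub) _.
rewrite -[iota 0 N.+1]/(index_iota 0 N.+1) big_mkord geo.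
have : 0 <= 3^-1 ^+ N :> R by rewrite exprn_ge0 // invr_ge0.
lra.
Qed.

End DeltaSeries.

(** * Spherical designs *)

Section Designs.
Variables (R : realType) (n : nat).
Local Notation C := R[i].
Implicit Types (L : 'rV[R]_n -> Prop) (P : {mpoly R[n]}).

Lemma evalv_homog0 j P : P \is j.+1.-homog -> evalv P 0 = 0.
Proof.
move=> hP; have := euler_eval 0 hP; rewrite big1 => [/esym/eqP|i _]; last by rewrite mxE mul0r.
by rewrite mulf_eq0 pnatr_eq0 /= => /eqP.
Qed.

Lemma shell0 L x : shell L (2 * 0)%:R x -> x = 0.
Proof. by rewrite muln0 => -[_]; exact: nrm_eq0. Qed.

Lemma shellsum_cusp L B j P : basis_of L B -> P \is j.+1.-homog -> shellsum L P 0 = 0.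
Proof.
move=> hB hP; have [s us hs] := shell_finite (2 * 0)%:R hB; rewrite (shellsum_seq P us hs).
by rewrite big_seq big1 // => x /hs/shell0 ->; exact: evalv_homog0 hP.
Qed.

Lemma shellsum_one L : is_lattice L -> shellsum L 1 0 = 1.
Proof.
move=> hL; rewrite (@shellsum_seq R n L 1 0 [:: 0]) //.
  by rewrite big_seq1 /evalv meval1.
move=> x; rewrite inE; split=> [/shell0 -> //|/eqP ->]; split; first exact: lattice0.
by rewrite muln0 dotv0l.
Qed.

Lemma lattice_opp L x : is_lattice L -> L x -> L (- x).
Proof.
move=> [B [_ h]] /h[z ->]; apply/h; exists (- z); rewrite -mulNmx; congr (_ *m _).
by apply/matrixP => i j; rewrite !mxE rmorphN.
Qed.

Lemma shell_opp L (r : R) x : is_lattice L -> shell L r x -> shell L r (- x).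
Proof. by move=> hL [Lx nx]; split; [exact: lattice_opp | rewrite dotvNl dotvNr opprK]. Qed.

Lemma sum_antipodal (s : seq 'rV[R]_n) j P : uniq s -> (forall x, x \in s -> - x \in s) ->
  odd j -> P \is j.-homog -> \sum_(x <- s) evalv P x = 0.
Proof.
move=> us hs oj hP.
have ps : perm_eq s [seq - x | x <- s].
  apply: uniq_perm; rewrite ?(map_inj_uniq oppr_inj) // => x.
  apply/idP/mapP => [xs|[y ys ->]]; last exact: hs.
  by exists (- x); [exact: hs | rewrite opprK].
have : \sum_(x <- s) evalv P x = - \sum_(x <- s) evalv P x.
  rewrite {1}(perm_big _ ps) big_map -sumrN; apply: eq_bigr => x _.
  by rewrite (evalvN_homog x hP) -signr_odd oj expr1 mulN1r.
by move=> /eqP; rewrite -subr_eq0 opprK -mulr2n -mulr_natl mulf_eq0 pnatr_eq0 /= => /eqP.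
Qed.

Lemma design_of_shellsum L m t : is_lattice L ->
  (forall j P, (1 <= j <= t)%N -> ~~ odd j -> P \is j.-homog -> harmonic P -> shellsum L P m = 0) ->
  spherical_design t (shell L (2 * m)%:R).
Proof.
move=> hL h; have [B hB] := hL; have [s us hs] := shell_finite (2 * m)%:R (hB : basis_of L B).
exists s; split=> //; first by exists (2 * m)%:R => x /hs[].
move=> j P jt hP hH; have [oj|ej] := boolP (odd j).
  by apply: (sum_antipodal us _ oj hP) => x /hs/(shell_opp hL)/hs.
by have := h j P jt ej hP hH; rewrite (shellsum_seq P us hs) => /complexI.
Qed.

Lemma shellsum_of_design L m t j P : spherical_design t (shell L (2 * m)%:R) ->
  (1 <= j <= t)%N -> P \is j.-homog -> harmonic P -> shellsum L P m = 0.
Proof. by move=> [s [us hs _ hd]] jt hP hH; rewrite (shellsum_seq P us hs) (hd j P jt hP hH). Qed.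

End Designs.

(** * From tau(m) = 0 to designs *)

Section ThetaVanishing.
Variables (R : realType) (m : nat).
Local Notation C := R[i].
Hypothesis tau_m : ramanujan_tau m = 0.

(** The Eisenstein series of weight 4, obtained as a theta series. The lemmas on cusp forms ask for
    its weight, its constant coefficient 1 and a nonzero value at i. *)
Definition theta_E4 : nat -> C := shellsum (@W8 R) 1.

Lemma harmonic1 n : harmonic (1 : {mpoly R[n]}).
Proof. by rewrite /harmonic /laplacian big1 // => i _; rewrite -mpolyC1 mderivC mderiv0. Qed.

Lemma MF_E4 : MF 4 theta_E4.
Proof.
by have := theta_MF (erefl : 8 = (8 * 1)%N) (W8_esd R) (dhomog1 _ _) (@harmonic1 8).
Qed.

Lemma E4_0 : theta_E4 0 = 1.
Proof. by apply: shellsum_one; case: (W8_esd R). Qed.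

Lemma E4_i_neq0 : ps theta_E4 (qq 'i) != 0.
Proof.
have [_ e] := theta_qseries 1 (W8_basis R) (@W8_even R) (half1 R).
have <- : th (1 : C) 2 = qq 'i by apply: th_qq; rewrite expr1n mulNr -expr2 sqr_i opprK.
by rewrite -e; exact: theta_one_neq0 (W8_basis R).
Qed.

Lemma cusp6 a : MF 6 a -> a 0%N = 0 -> forall k, a k = 0 :> C.
Proof.
exact: (cusp6_eq0 (MF_Delta R) (Delta0 R) (Delta1 R) (Delta_i_neq0 R) MF_E4 E4_0 E4_i_neq0).
Qed.

Lemma cusp10 a : MF 10 a -> a 0%N = 0 -> forall k, a k = 0 :> C.
Proof.
exact: (cusp10_eq0 (MF_Delta R) (Delta0 R) (Delta1 R) (Delta_i_neq0 R) MF_E4 E4_0 E4_i_neq0).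
Qed.

Lemma cusp14 a : MF 14 a -> a 0%N = 0 -> forall k, a k = 0 :> C.
Proof.
exact: (cusp14_eq0 (MF_Delta R) (Delta0 R) (Delta1 R) (Delta_i_neq0 R) MF_E4 E4_0 E4_i_neq0).
Qed.

Lemma cusp12 a : MF 12 a -> a 0%N = 0 -> a m = 0 :> C.
Proof.
move=> Ma a0; rewrite (cusp12_Delta (MF_Delta R) (Delta0 R) (Delta1 R) Ma a0).
by rewrite /Delta tau_m mulr0.
Qed.

Lemma W8_design : spherical_design 11 (shell (@W8 R) (2 * m)%:R).
Proof.
have [lat _ _] := W8_esd R; apply: design_of_shellsum => // -[//|j] P jt ej hP hH.
have M := theta_MF (erefl : 8 = (8 * 1)%N) (W8_esd R) hP hH.
have a0 := shellsum_cusp (W8_basis R) hP; move: j jt ej M {hP} a0.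
move=> [|[|[|[|[|[|[|[|[|[|[|j]]]]]]]]]]] // _ _ M a0.
- exact: cusp6.
- exact: cusp8_eq0.
- exact: cusp10.
- exact: cusp12.
- exact: cusp14.
Qed.

Lemma even_selfdual16_design (L : 'rV[R]_16 -> Prop) : even_selfdual_lattice L ->
  spherical_design 7 (shell L (2 * m)%:R).
Proof.
move=> hL; have [lat _ _] := hL; have [B hB] := lat.
apply: design_of_shellsum => // -[//|j] P jt ej hP hH.
have M := theta_MF (erefl : 16 = (8 * 2)%N) hL hP hH.
have a0 := shellsum_cusp (hB : basis_of L B) hP; move: j jt ej M {hP} a0.
move=> [|[|[|[|[|[|[|j]]]]]]] // _ _ M a0.
- exact: cusp10.
- exact: cusp12.
- exact: cusp14.
Qed.

End ThetaVanishing.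

Lemma spherical_design_le (R : realType) n t u (X : 'rV[R]_n -> Prop) : (t <= u)%N ->
  spherical_design u X -> spherical_design t X.
Proof.
move=> tu [s [us hs hr hd]]; exists s; split=> // j P /andP[j1 jt]; apply: hd.
by rewrite j1 (leq_trans jt tu).
Qed.

Section RealPartFourthPower.
Variables (R : realType) (n : nat) (p q : 'I_n).
Hypothesis pq : p != q.
Local Notation a := ('X_p : {mpoly R[n]}).
Local Notation b := ('X_q : {mpoly R[n]}).

(* The real part of [(X_p + i X_q)^4]. *)
Definition re4 : {mpoly R[n]} := a * a * a * a + (- 6)%:MP * (a * a * b * b) + b * b * b * b.

Lemma evalv_re4 x : evalv re4 x = x 0 p ^+ 4 - 6 * (x 0 p * x 0 q) ^+ 2 + x 0 q ^+ 4.
Proof. by rewrite /re4 !(evalvD, evalvM, evalvC, evalvX); ring. Qed.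

Lemma re4_homog : re4 \is 4.-homog.
Proof.
have hX i : ('X_i : {mpoly R[n]}) \is 1.-homog by rewrite dhomogX; apply/eqP; exact: mdeg1.
have h4 i j k l : ('X_i * 'X_j * 'X_k * 'X_l : {mpoly R[n]}) \is 4.-homog.
  exact: (dhomogM (dhomogM (dhomogM (hX i) (hX j)) (hX k)) (hX l)).
by rewrite /re4 mul_mpolyC; apply: rpredD => //; apply: rpredD => //; apply: rpredZ.
Qed.

Lemma mderivX1 k i : mderiv k ('X_i : {mpoly R[n]}) = ((k == i)%:R)%:MP.
Proof.
rewrite mderivX mnm1E eq_sym; case: eqP => [->|_]; last by rewrite scale0r mpolyC0.
rewrite (_ : (U_(i) - U_(i))%MM = 0%MM); last by apply/mnmP => j; rewrite mnmBE subnn mnm0E.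
by rewrite mpolyX0 scale1r mpolyC1.
Qed.

Lemma re4_harmonic : harmonic re4.
Proof.
rewrite /harmonic /laplacian.
(* With u and v the Kronecker symbols of k at p and q, one formula covers all second derivatives,
   and the contributions of p and q cancel. *)
have F k : mderiv k (mderiv k re4) = let u := ((k == p)%:R)%:MP in let v := ((k == q)%:R)%:MP in
   12 * (a * a * u * u) + (- 6)%:MP * (2 * b * b * u * u + 8 * a * b * u * v + 2 * a * a * v * v) +
   12 * (b * b * v * v).
  rewrite /re4 !(mderivD, mderivM, mderivC, mderivX1) /=; ring.
have six : (- 6)%:MP = - 6 :> {mpoly R[n]} by rewrite mpolyCN rmorph_nat.
rewrite (bigD1 p) //= (bigD1 q) /=; last by rewrite eq_sym.
rewrite big1 ?addr0; last first.
  by move=> k /andP[/negbTE kp /negbTE kq]; rewrite F /= kp kq mpolyC0; ring.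
by rewrite !F /= !eqxx (negbTE pq) eq_sym (negbTE pq) mpolyC0 mpolyC1 six; ring.
Qed.

End RealPartFourthPower.

(** * The lattice W8 + W8 and the converse implications *)

Section SumOfTwoW8.
Variable R : realType.
Local Notation C := R[i].

Definition W8W8 : 'rV[R]_16 -> Prop := @dsum R 8 8 (@W8 R) (@W8 R).

Definition re4W : {mpoly R[16]} := re4 R (lshift 8 (0 : 'I_8)) (rshift 8 (0 : 'I_8)).

Lemma W8W8_esd : even_selfdual_lattice W8W8.
Proof. exact: (esd_dsum (W8_esd R) (W8_esd R)). Qed.

(* A vector of norm 2 lies in one of the two summands, so the mixed term of [re4W] vanishes. *)
Lemma re4W_root x : shell W8W8 (2 * 1)%:R x ->
  evalv re4W x = x 0 (lshift 8 (0 : 'I_8)) ^+ 4 + x 0 (rshift 8 (0 : 'I_8)) ^+ 4.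
Proof.
move=> [[x1 x2] nx]; rewrite /re4W evalv_re4.
have [u hu] := even_norm (@W8_even R) x1; have [v hv] := even_norm (@W8_even R) x2.
have uv : (u + v = 1)%N.
  have : (2 * u + 2 * v)%:R = (2 * 1)%:R :> R by rewrite natrD -hu -hv -nx (@dotv_split R 8 8).
  by move/eqP; rewrite eqr_nat => /eqP; lia.
suff -> : x 0 (lshift 8 (0 : 'I_8)) * x 0 (rshift 8 (0 : 'I_8)) = 0 by rewrite expr0n mulr0 subr0.
have [u0|v0] : u = 0%N \/ v = 0%N by lia.
- move: hu; rewrite u0 muln0 => /nrm_eq0/rowP/(_ 0); rewrite !mxE => ->; exact: mul0r.
- move: hv; rewrite v0 muln0 => /nrm_eq0/rowP/(_ 0); rewrite !mxE => ->; exact: mulr0.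
Qed.

(** On vectors of norm 2 the polynomial is a sum of two fourth powers, hence nonnegative, and the
    root e_0 + e_1 of the first summand gives it the value 1. *)
Lemma shellsum_re4W : shellsum W8W8 re4W 1 != 0.
Proof.
have [[B hB] _ _] := W8W8_esd; have [s us hs] := shell_finite (2 * 1)%:R (hB : basis_of W8W8 B).
rewrite (shellsum_seq _ us hs) -cn_eq0 cn_real normr_eq0 gt_eqF //.
pose i1 : 'I_8 := inord 1; have i10 : (i1 == 0) = false by apply/eqP => /(congr1 val); rewrite /= inordK.
pose r : 'rV[R]_8 := ebas R 0 + ebas R i1.
have rW : @W8 R r.
  apply/W8P; exists 0, (fun j => (j == 0)%:R + (j == i1)%:R), 1; split.
    by move=> j; rewrite !mxE eqxx /= mul0r add0r intrD; case: (j == 0); case: (j == i1).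
  rewrite big_split /= (bigD1 0) //= big1 ?addr0; last by move=> j /negbTE ->.
  by rewrite (bigD1 i1) //= eqxx big1 ?addr0 // => j /negbTE ->.
have rr : dotv r r = 2.
  by rewrite /r dotvDr !dotv_ebas !mxE !eqxx eq_sym i10 /= addr0 add0r.
pose x : 'rV[R]_(8 + 8) := row_mx r 0.
have W80 : @W8 R 0 by apply: lattice0; case: (W8_esd R).
have xs : x \in s.
  apply/hs; split; first by split; rewrite ?row_mxKl ?row_mxKr.
  by rewrite (@dotv_split R 8 8) row_mxKl row_mxKr dotv0l addr0 rr.
have Px : 0 < evalv re4W x.
  have xl : x 0 (lshift 8 (0 : 'I_8)) = 1 by rewrite row_mxEl !mxE !eqxx eq_sym i10 /= addr0.
  have xr : x 0 (rshift 8 (0 : 'I_8)) = 0 by rewrite row_mxEr mxE.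
  have pos : 0 < x 0 (lshift 8 (0 : 'I_8)) ^+ 4 + x 0 (rshift 8 (0 : 'I_8)) ^+ 4.
    by rewrite xl xr expr1n expr0n addr0.
  by rewrite re4W_root; [exact: pos | apply/hs].
rewrite (big_rem x) //=; apply: ltr_pwDl => //.
rewrite big_seq; apply: sumr_ge0 => y /mem_rem/hs/re4W_root ->.
by rewrite addr_ge0 // exprn_even_ge0.
Qed.

Lemma tau_of_design16 m : spherical_design 4 (shell W8W8 (2 * m)%:R) -> ramanujan_tau m = 0.
Proof.
move=> hd; have pq : (lshift 8 (0 : 'I_8)) != (rshift 8 (0 : 'I_8)) by [].
have hom := re4_homog R (lshift 8 (0 : 'I_8)) (rshift 8 (0 : 'I_8)).
have har := re4_harmonic R pq.
have [[B hB] _ _] := W8W8_esd.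
have M := theta_MF (erefl : 16 = (8 * 2)%N) W8W8_esd hom har.
have a0 := shellsum_cusp (hB : basis_of W8W8 B) hom.
have := cusp12_Delta (MF_Delta R) (Delta0 R) (Delta1 R) M a0 m.
rewrite (shellsum_of_design hd _ hom har) // => /esym/eqP.
by rewrite mulf_eq0 (negbTE shellsum_re4W) /= /Delta intr_eq0 => /eqP.
Qed.

Lemma tau_of_design8 m : spherical_design 8 (shell (@W8 R) (2 * m)%:R) -> ramanujan_tau m = 0.
Proof.
move=> hd; have := shellsum_of_design hd _ (xprod_homog R) (xprod_harmonic R).
rewrite shellsum_xprod => /(_ isT)/eqP.
by rewrite mulf_eq0 invr_eq0 pnatr_eq0 orbF /Delta intr_eq0 => /eqP.
Qed.

End SumOfTwoW8.

Theorem proposition11p4 (R : realType) (m : nat) : (1 <= m)%N ->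
  [/\ ramanujan_tau m = 0 <-> spherical_design 8 (shell (@W8 R) (2 * m)%:R),
      spherical_design 8 (shell (@W8 R) (2 * m)%:R) ->
        spherical_design 11 (shell (@W8 R) (2 * m)%:R),
      ramanujan_tau m = 0 <->
        (forall L : 'rV[R]_16 -> Prop, even_selfdual_lattice L ->
           spherical_design 4 (shell L (2 * m)%:R)) &
      (forall L : 'rV[R]_16 -> Prop, even_selfdual_lattice L ->
           spherical_design 4 (shell L (2 * m)%:R)) ->
        (forall L : 'rV[R]_16 -> Prop, even_selfdual_lattice L ->
           spherical_design 7 (shell L (2 * m)%:R))].
Proof.
move=> _; split.
- split=> [t|]; last exact: tau_of_design8.
  exact: spherical_design_le (W8_design R t).
- by move=> /tau_of_design8; exact: W8_design.
- split=> [t L hL|h]; first exact: spherical_design_le (even_selfdual16_design t hL).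
  by apply: (@tau_of_design16 R); apply: h; exact: W8W8_esd.
- by move=> h L hL; apply: even_selfdual16_design => //; apply: (@tau_of_design16 R); apply: h; exact: W8W8_esd.
Qed.
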